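(* Let $X_i$, $i=1,2$, be metric measure spaces satisfying the doubling condition with exponent $n_i$. Assume that the nonnegative self-adjoint operators $L_i$ on $L^2(X_i)$, $i=1,2$, satisfy restriction type estimates $(\mathrm{ST}_{p_i,2}^2)$ for some $p_i$ with $1\le p_i<2$. Then there is a constant $C$ such that the following two-parameter restriction type estimates hold. (i) For every $R_1,R_2>0$ and all Borel functions $F$ with $\operatorname{supp}F\subseteq[0,R_1]\times[0,R_2]$, $$\big\|F(\sqrt{L_1},\sqrt{L_2})P_{B_1(x_1,r_1)\times B_2(x_2,r_2)}\big\|_{L^{p_1}(X_1;L^{p_2}(X_2))\to L^2(X_1\times X_2)}\le C\prod_{i=1}^2\Big(\frac{(R_ir_i)^{n_i}}{V_i(x_i,r_i)}\Big)^{1/p_i-1/2}\big\|\delta_{(R_1,R_2)}F\big\|_{L^2(\mathbb{R}^2)}$$ for all $x_i\in X_i$ and all $r_i\ge1/R_i$, $i=1,2$. (ii) For every $R_1>0$ and all Borel functions $F$ with $\operatorname{supp}F\subseteq[0,R_1]\times[0,\infty)$, $$\big\|F(\sqrt{L_1},\sqrt{L_2})P_{B_1(x_1,r_1)\times X_2}\big\|_{L^{p_1}(X_1;L^2(X_2))\to L^2(X_1\times X_2)}\le C\Big(\frac{(R_1r_1)^{n_1}}{V_1(x_1,r_1)}\Big)^{1/p_1-1/2}\big\|\delta_{(R_1,1)}F\big\|_{L^\infty_{\lambda_2}(\mathbb{R};L^2_{\lambda_1}(\mathbb{R}))}$$ for all $x_1\in X_1$ and all $r_1\ge1/R_1$.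 (iii) For every $R_2>0$ and all Borel functions $F$ with $\operatorname{supp}F\subseteq[0,\infty)\times[0,R_2]$, $$\big\|F(\sqrt{L_1},\sqrt{L_2})P_{X_1\times B_2(x_2,r_2)}\big\|_{L^{p_2}(X_2;L^2(X_1))\to L^2(X_1\times X_2)}\le C\Big(\frac{(R_2r_2)^{n_2}}{V_2(x_2,r_2)}\Big)^{1/p_2-1/2}\big\|\delta_{(1,R_2)}F\big\|_{L^\infty_{\lambda_1}(\mathbb{R};L^2_{\lambda_2}(\mathbb{R}))}$$ for all $x_2\in X_2$ and all $r_2\ge1/R_2$.
   Context: For $i=1,2$: $X_i$ has a metric $d_i$ and a Borel measure $\mu_i$; $B_i(x_i,r)$ is the open ball of center $x_i$ and radius $r$, and $V_i(x_i,r)=\mu_i(B_i(x_i,r))$. The doubling condition with exponent $n_i$: there are positive constants $C,n_i$ with $V_i(x_i,\lambda r)\le C\lambda^{n_i}V_i(x_i,r)$ for all $x_i\in X_i$, $\lambda\ge1$, $r>0$. Standing assumption: $\mu_i(X_i)=\infty$. The product $X_1\times X_2$ carries $\mu_1\times\mu_2$. Functional calculus: $E$ is the unique spectral decomposition on $L^2(X_1\times X_2)$ with $E(A_1\times A_2)=E_{L_1}(A_1)\otimes E_{L_2}(A_2)$ for Borel $A_i\subset\mathbb{R}$; $F(\sqrt{L_1},\sqrt{L_2}):=\int F(\sqrt{\lambda_1},\sqrt{\lambda_2})\,dE(\lambda_1,\lambda_2)$. $(\mathrm{ST}^2_{p,2})$: for $1\le p<2$, $L_i$ satisfies $(\mathrm{ST}^2_{p,2})$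 if there is $C>0$ such that for each $R>0$ and all Borel functions $F$ on $\mathbb{R}$ with $\operatorname{supp}F\subset[0,R]$, $\|F(\sqrt{L_i})P_{B_i(x_i,r)}\|_{L^p(X_i)\to L^2(X_i)}\le C\big(\frac{(Rr)^{n_i}}{V_i(x_i,r)}\big)^{1/p-1/2}\|F(R\,\cdot)\|_{L^2(\mathbb{R})}$ for all $x_i\in X_i$ and $r\ge1/R$. Notation: $P_Ef=\chi_Ef$. $(\delta_{(R_1,R_2)}F)(\lambda_1,\lambda_2)=F(R_1\lambda_1,R_2\lambda_2)$. Mixed norms: $\|f\|_{L^{p}(X_1;L^{q}(X_2))}=\big\|\,\|f(x_1,x_2)\|_{L^{q}_{x_2}(X_2)}\big\|_{L^{p}_{x_1}(X_1)}$, $\|f\|_{L^{p}(X_2;L^{q}(X_1))}=\big\|\,\|f(x_1,x_2)\|_{L^{q}_{x_1}(X_1)}\big\|_{L^{p}_{x_2}(X_2)}$, and for functions on $\mathbb{R}\times\mathbb{R}$, $\|F\|_{L^\infty_{\lambda_2}(\mathbb{R};L^2_{\lambda_1}(\mathbb{R}))}=\big\|\,\|F(\lambda_1,\lambda_2)\|_{L^2_{\lambda_1}(\mathbb{R})}\big\|_{L^\infty_{\lambda_2}(\mathbb{R})}$, and similarly with the roles of $\lambda_1,\lambda_2$ exchanged. *)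

(* Defs.v *)
From HB Require Import structures.
From mathcomp Require Import all_boot all_order all_algebra.
From mathcomp Require Import all_classical all_reals all_analysis.
From mathcomp Require Import complex.
Set Implicit Arguments.
Unset Strict Implicit.
Unset Printing Implicit Defensive.
Import Order.TTheory GRing.Theory Num.Theory.
Import numFieldNormedType.Exports.
Import ComplexField.Normc.
Local Open Scope classical_set_scope.
Local Open Scope ring_scope.
Local Open Scope complex_scope.

HB.mixin Record Metric_isBorel d (R : realType) M
    & Metric R M & Measurable d M := {
  measurable_borelE : (@measurable d M) = <<s [set A : set M | open A] >>
}.

#[short(type="borelMetricType")]
HB.structure Definition BorelMetric d (R : realType) :=
  { M of Metric R M & Measurable d M & Metric_isBorel d R M }.

(* Functions are complex valued; elements of L^2 are handled through their
   measurable representatives, so all operator identities are stated almost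
   everywhere. *)
Section Lebesgue_spaces.
Context d (T : measurableType d) (R : realType).
Implicit Types (mu : {measure set T -> \bar R}) (f g : T -> R[i]).

Definition cmeasurable f :=
  measurable_fun setT (fun x => complex.Re (f x)) /\
  measurable_fun setT (fun x => complex.Im (f x)).

Definition cLnorm mu (p : \bar R) f : \bar R :=
  Lnorm mu p (fun x => (normc (f x))%:E).

Definition inL2 mu f := cmeasurable f /\ (cLnorm mu 2%:E f < +oo)%E.

Definition ae_eq_fun mu f g := {ae mu, forall x, f x = g x}.

Definition L2dot mu f g : R[i] :=
  (\int[mu]_x complex.Re (f x * (g x)^*)) +i*
  (\int[mu]_x complex.Im (f x * (g x)^*)).

(* P_B *)
Definition restr (B : set T) f : T -> R[i] := fun x => (\1_B x)%:C * f x.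

End Lebesgue_spaces.

(* A possibly unbounded operator on L^2 is given by its graph:
   [A f] is the set of representatives of the value of A at f, and it is empty
   when f is not in the domain. *)
Section operators.
Context d (T : measurableType d) (R : realType).
Variable mu : {measure set T -> \bar R}.
Local Notation graph := ((T -> R[i]) -> set (T -> R[i])).
Implicit Types (A : graph) (f g h u v : T -> R[i]).

Record linear_operator A : Prop := {
  op_L2 : forall f g, A f g -> inL2 mu f /\ inL2 mu g;
  op_ae : forall f g u v, A f g -> inL2 mu u -> inL2 mu v ->
    ae_eq_fun mu f u -> ae_eq_fun mu g v -> A u v;
  op_functional : forall f g h, A f g -> A f h -> ae_eq_fun mu g h;
  op0 : A (fun=> 0) (fun=> 0);
  op_linear : forall (a : R[i]) f g u v, A f g -> A u v ->
    A (fun x => a * f x + u x) (fun x => a * g x + v x)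
}.

Definition densely_defined A := forall f (e : R), inL2 mu f -> 0 < e ->
  exists g h, A g h /\ (cLnorm mu 2%:E (fun x => f x - g x)%R < e%:E)%E.

Definition adjoint A : graph := fun u v =>
  [/\ inL2 mu u, inL2 mu v & forall f g, A f g -> L2dot mu g u = L2dot mu f v].

Definition self_adjoint A :=
  [/\ linear_operator A, densely_defined A & A = adjoint A].

Definition nonnegative A := forall f g, A f g -> 0 <= L2dot mu g f.

(* ||A||_{N -> L^2}, with N a (semi)norm: the supremum of ||A f||_2 over the
   f in L^2 with N f <= 1, where ||A f||_2 = +oo for f outside of the domain
   of A (infimum over the empty set). *)
Definition opnorm (N : (T -> R[i]) -> \bar R) A : \bar R :=
  ereal_sup [set ereal_inf [set cLnorm mu 2%:E g | g in A f]
            | f in [set f | inL2 mu f /\ (N f <= 1)%E]].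

End operators.

Section spectral_calculus.
Context d (T : measurableType d) (R : realType).
Variable mu : {measure set T -> \bar R}.
Context d' (S : measurableType d').
Implicit Types (E : set S -> (T -> R[i]) -> (T -> R[i])) (f g : T -> R[i]).

(* Spectral decompositions, that is, projection-valued measures on S acting
   on L^2(mu). *)
Record spectral_decomposition E : Prop := {
  sd_L2 : forall A f, measurable A -> inL2 mu f -> inL2 mu (E A f);
  sd_ae : forall A f g, measurable A -> inL2 mu f -> inL2 mu g ->
    ae_eq_fun mu f g -> ae_eq_fun mu (E A f) (E A g);
  sd_linear : forall A (a : R[i]) f g, measurable A -> inL2 mu f -> inL2 mu g ->
    ae_eq_fun mu (E A (fun x => a * f x + g x))
                 (fun x => a * E A f x + E A g x);
  sd_sym : forall A f g, measurable A -> inL2 mu f -> inL2 mu g ->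
    L2dot mu (E A f) g = L2dot mu f (E A g);
  sd_mul : forall A B f, measurable A -> measurable B -> inL2 mu f ->
    ae_eq_fun mu (E (A `&` B) f) (E A (E B f));
  sd_setT : forall f, inL2 mu f -> ae_eq_fun mu (E setT f) f;
  sd_sigma_additive : forall (A : nat -> set S) f,
    (forall k, measurable (A k)) -> trivIset setT A -> inL2 mu f ->
    (fun n => cLnorm mu 2%:E
       (fun x => E (\bigcup_k A k) f x - \sum_(k < n) E (A k) f x)) @ \oo
    --> 0%E
}.

(* nu is the measure <E(.) f, f> = ||E(.) f||^2 *)
Definition spectral_distribution E f (nu : {measure set S -> \bar R}) :=
  forall A, measurable A -> nu A = (cLnorm mu 2%:E (E A f) `^ 2)%E.

(* Graph of the operator \int phi dE. Let nu = <E(.) f, f>. The value at f is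
   the L^2 limit of \sum_i c_i E(A_i) f along the simple functions
   \sum_i c_i 1_{A_i} converging to phi in L^2(nu). By the isometry
   ||\sum_i c_i E(A_i) f||_2 = ||\sum_i c_i 1_{A_i}||_{L^2(nu)} this limit is
   unique, and it exists exactly when phi is in L^2(nu), which is the usual
   domain of \int phi dE. *)
Definition spectral_integral E (phi : S -> R[i]) :
    (T -> R[i]) -> set (T -> R[i]) := fun f g =>
  [/\ inL2 mu f, inL2 mu g &
    exists2 nu : {measure set S -> \bar R}, spectral_distribution E f nu &
    forall e : R, 0 < e ->
    exists n (c : 'I_n -> R[i]) (A : 'I_n -> set S),
    [/\ forall i, measurable (A i),
        (cLnorm nu 2%:E
          (fun s => phi s - \sum_(i < n) c i * (\1_(A i) s)%:C)%R < e%:E)%E &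
        (cLnorm mu 2%:E
          (fun x => g x - \sum_(i < n) c i * E (A i) f x)%R < e%:E)%E]].

End spectral_calculus.

Section functional_calculus.
Context d (T : measurableType d) (R : realType).
Variable mu : {measure set T -> \bar R}.

Definition spectral_decomposition_of
    (L : (T -> R[i]) -> set (T -> R[i]))
    (E : set R -> (T -> R[i]) -> (T -> R[i])) :=
  spectral_decomposition mu E /\
  L = spectral_integral mu E (fun t : R => t%:C).

(* F(sqrt L), where E is the spectral decomposition of L >= 0 *)
Definition fun_sqrt (E : set R -> (T -> R[i]) -> (T -> R[i])) (F : R -> R[i]) :=
  spectral_integral mu E (fun t : R => F (Num.sqrt t)).

(* F(sqrt L_1, sqrt L_2), where E is the joint spectral decomposition *)
Definition fun_sqrt2 (E : set (R * R) -> (T -> R[i]) -> (T -> R[i]))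
    (F : R * R -> R[i]) :=
  spectral_integral mu E (fun t : R * R => F (Num.sqrt t.1, Num.sqrt t.2)).

End functional_calculus.

Section product.
Context d1 d2 (T1 : measurableType d1) (T2 : measurableType d2) (R : realType).
Variables (mu1 : {measure set T1 -> \bar R})
          (mu2 : {sigma_finite_measure set T2 -> \bar R}).

Definition tensor (f1 : T1 -> R[i]) (f2 : T2 -> R[i]) : T1 * T2 -> R[i] :=
  fun x => f1 x.1 * f2 x.2.

(* E(A_1 x A_2) = E_1(A_1) (x) E_2(A_2); the right-hand side is the bounded
   operator determined by its values on elementary tensors, which span a dense
   subspace. *)
Definition tensor_decomposition
    (E1 : set R -> (T1 -> R[i]) -> (T1 -> R[i]))
    (E2 : set R -> (T2 -> R[i]) -> (T2 -> R[i]))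
    (E : set (R * R) -> (T1 * T2 -> R[i]) -> (T1 * T2 -> R[i])) :=
  forall A1 A2, measurable A1 -> measurable A2 ->
  forall f1 f2, inL2 mu1 f1 -> inL2 mu2 f2 ->
  ae_eq_fun (mu1 \x mu2)%E
    (E (A1 `*` A2) (tensor f1 f2)) (tensor (E1 A1 f1) (E2 A2 f2)).

(* mixnorm12 p q is the norm of L^p(T1; L^q(T2)), mixnorm21 p q the norm of
   L^p(T2; L^q(T1)). *)
Definition mixnorm12 (p q : \bar R) (f : T1 * T2 -> R[i]) : \bar R :=
  Lnorm mu1 p (fun x1 => cLnorm mu2 q (fun x2 => f (x1, x2))).

Definition mixnorm21 (p q : \bar R) (f : T1 * T2 -> R[i]) : \bar R :=
  Lnorm mu2 p (fun x2 => cLnorm mu1 q (fun x1 => f (x1, x2))).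

End product.

Definition supp (S : topologicalType) (R : realType) (F : S -> R[i]) : set S :=
  closure [set s | F s != 0].

Definition dilate (R : realType) (R1 R2 : R) (F : R * R -> R[i]) :
  R * R -> R[i] := fun l => F (R1 * l.1, R2 * l.2).

Section metric_measure_space.
Context d (R : realType) (X : borelMetricType d R).
Variable mu : {measure set X -> \bar R}.

Definition doubling (n : R) := 0 < n /\
  exists2 C : R, 0 < C & forall (x : X) (l r : R), 1 <= l -> 0 < r ->
    (mu (ball x (l * r)) <= (C * l `^ n)%:E * mu (ball x r))%E.

(* ((R r)^n / V(x,r))^(1/p - 1/2), computed in [0, +oo] *)
Definition vol_factor (n p Rd : R) (x : X) (r : R) : \bar R :=
  ((((Rd * r) `^ n)%:E / mu (ball x r)) `^ (p^-1 - 2^-1))%E.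

(* (ST^2_{p,2}) for the operator with spectral decomposition E *)
Definition restriction_type (n : R) (E : set R -> (X -> R[i]) -> (X -> R[i]))
    (p : R) :=
  exists2 C : R, 0 < C & forall (Rd : R), 0 < Rd ->
  forall F : R -> R[i], cmeasurable F -> supp F `<=` `[0, Rd] ->
  forall (x : X) (r : R), Rd^-1 <= r ->
  (opnorm mu (cLnorm mu p%:E) (fun f => fun_sqrt mu E F (restr (ball x r) f))
   <= C%:E * vol_factor n p Rd x r *
      cLnorm lebesgue_measure 2%:E (fun l => F (Rd * l)%R))%E.

End metric_measure_space.

(* Main.v *)
Require Import Defs.
From HB Require Import structures.
From mathcomp Require Import all_boot all_order all_algebra.
From mathcomp Require Import all_classical all_reals all_analysis.
From mathcomp Require Import measurable_realfun ess_sup_inf.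
From mathcomp Require Import complex.
From mathcomp Require finmap.
From mathcomp Require Import ring lra.

(** Put [nu] for the measure [A |-> ||E(A) P_B f||^2] on the plane. The square of the
    norm of [F(sqrt L1, sqrt L2) P_B f] is the integral of
    [|F(sqrt s, sqrt t)|^2] against [nu], and the value exists as soon as this
    integral is finite ([spectral_integral_exists]). So the three estimates
    are upper bounds for [nu], and a finite measure on a product is bounded by
    another one as soon as it is on rectangles ([measure_le_rectangles]). On a
    rectangle, [E(A1 x A2)] is the product of the projections
    [E1(A1) (x) 1] and [1 (x) E2(A2)], which act slice by slice
    ([slice2_contraction]).

    The hypothesis on [L1] is used for indicator functions only. It says that
    the projection of [sqrt L1 / R1] on a subset [Q] of the unit interval maps
    [L^p1], localized in a ball, to [L^2] with norm at most [c |Q|^(1/2)]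
    ([restriction_type_bound]). This bound is transferred to functions
    of two variables by Hoelder's inequality with a weight that depends on the
    first variable ([lift_bound]).

    If both variables are localized, choosing as weight the norms of the slices
    of [(1 (x) E2(A2)) P_B f] and using the bound for [L2] on each slice gives
    [nu(Q1 x Q2) <= c^2 |Q1| |Q2|] in rescaled variables ([mixed_bound]), that
    is, a density at most [c^2] with respect to Lebesgue measure. This
    gives the first estimate.

    If only the first variable is localized, the weight is given by the slices
    of [f] itself, and [nu(Q1 x Q2) <= c^2 |Q1| kappa(Q2)]
    ([partial_bound]), where [kappa] is the measure of [sqrt L2] at a single
    vector of norm at most 1, namely [f] with its slices renormalized. The
    hypothesis on [L2], applied to indicator functions of null sets, makes
    [kappa] absolutely continuous with respect to Lebesgue measure
    ([restriction_type_null]). The integral of [|F|^2] is thus at most [c^2] times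
    the essential supremum in the second variable of the integrals in the
    first one ([partial_multiplier]). This gives the second estimate, and the
    third one follows by exchanging the two factors.

    Doubling and the infinite total mass enter through
    [doubling_ball_neq0]: balls are not null, so the volume factors are finite
    and can be absorbed in the constants [c]. *)

Set Implicit Arguments.
Unset Strict Implicit.
Unset Printing Implicit Defensive.
Import Order.TTheory GRing.Theory Num.Theory.
Import numFieldNormedType.Exports.
Import ComplexField.Normc.
Local Open Scope classical_set_scope.
Local Open Scope ring_scope.
Local Open Scope complex_scope.
Import HBNNSimple.

(** * Complex moduli and measurable complex functions *)

Section complex_modulus.
Context (R : realType).
Implicit Types z w : R[i].

Lemma normc_ge0 z : 0 <= normc z.
Proof. by case: z => a b; rewrite /normc sqrtr_ge0. Qed.

Lemma normc_sqr z : normc z ^+ 2 = complex.Re z ^+ 2 + complex.Im z ^+ 2.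
Proof. by case: z => a b; rewrite /normc sqr_sqrtr ?addr_ge0 ?sqr_ge0. Qed.

Lemma normcR (a : R) : normc a%:C = `|a|.
Proof. by rewrite /normc /= expr0n addr0 sqrtr_sqr. Qed.

Lemma normc_eq0 z : (normc z == 0) = (z == 0).
Proof. by apply/eqP/eqP => [/eq0_normc//|->]; rewrite normc0. Qed.

Lemma normc_indic T (A : set T) x : normc ((\1_A x)%:C : R[i]) = \1_A x.
Proof. by rewrite normcR ger0_norm. Qed.

Lemma normc_sqrD z w :
  normc (z + w) ^+ 2 <= 2 * normc z ^+ 2 + 2 * normc w ^+ 2.
Proof.
rewrite !normc_sqr; case: z => a b; case: w => c e /=; rewrite -subr_ge0.
rewrite (_ : _ - _ = (a - c) ^+ 2 + (b - e) ^+ 2); last by ring.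
by rewrite addr_ge0 ?sqr_ge0.
Qed.

Lemma conjcD z w : (z + w)^*%R = z^*%R + w^*%R.
Proof. exact: rmorphD. Qed.

Lemma conjcM z w : (z * w)^*%R = z^*%R * w^*%R.
Proof. exact: rmorphM. Qed.

Lemma conj_real (a : R) : (a%:C)^*%R = a%:C :> R[i].
Proof. exact: conjc_real. Qed.

Lemma conjc_sum (I : Type) (r : seq I) (F : I -> R[i]) :
  (\sum_(i <- r) F i)^*%R = \sum_(i <- r) (F i)^*%R.
Proof. exact: rmorph_sum. Qed.

End complex_modulus.

Section cmeasurable_theory.
Context d (T : measurableType d) (R : realType).
Implicit Types f g : T -> R[i].

Lemma cmeasurable_cst (c : R[i]) : cmeasurable (fun _ : T => c).
Proof. by split; exact: measurable_cst. Qed.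

Lemma cmeasurableD f g : cmeasurable f -> cmeasurable g ->
  cmeasurable (fun x => f x + g x).
Proof.
move=> [rf jf] [rg jg]; split.
- by under eq_fun => x do rewrite raddfD; exact: measurable_funD.
- rewrite (_ : (fun x => _) =
      (fun x => complex.Im (f x) + complex.Im (g x))).
    exact: measurable_funD.
  by apply/funext => x; case: (f x) (g x) => ? ? [].
Qed.

Lemma cmeasurableM f g : cmeasurable f -> cmeasurable g ->
  cmeasurable (fun x => f x * g x).
Proof.
move=> [rf jf] [rg jg]; split.
- rewrite (_ : (fun x => _) = (fun x => complex.Re (f x) * complex.Re (g x) -
     complex.Im (f x) * complex.Im (g x))).
    by apply: measurable_funB; exact: measurable_funM.
  by apply/funext => x; case: (f x) (g x) => ? ? [].
- rewrite (_ : (fun x => _) = (fun x => complex.Re (f x) * complex.Im (g x) +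
     complex.Im (f x) * complex.Re (g x))).
    by apply: measurable_funD; exact: measurable_funM.
  by apply/funext => x; case: (f x) (g x) => ? ? [].
Qed.

Lemma cmeasurableZ (c : R[i]) f : cmeasurable f ->
  cmeasurable (fun x => c * f x).
Proof. by apply: cmeasurableM; exact: cmeasurable_cst. Qed.

Lemma cmeasurableN f : cmeasurable f -> cmeasurable (fun x => - f x).
Proof.
by move=> /(cmeasurableZ (-1)); under eq_fun do rewrite mulN1r.
Qed.

Lemma cmeasurableB f g : cmeasurable f -> cmeasurable g ->
  cmeasurable (fun x => f x - g x).
Proof. by move=> mf /cmeasurableN; exact: cmeasurableD. Qed.

Lemma cmeasurable_real (h : T -> R) : measurable_fun setT h ->
  cmeasurable (fun x => (h x)%:C).
Proof. by move=> mh; split => //=; exact: measurable_cst. Qed.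

Lemma cmeasurable_indic (A : set T) : measurable A ->
  cmeasurable (fun x => (\1_A x)%:C : R[i]).
Proof. by move=> mA; exact/cmeasurable_real/measurable_indic. Qed.

Lemma cmeasurable_restr (A : set T) f : measurable A -> cmeasurable f ->
  cmeasurable (restr A f).
Proof. by move=> mA; apply: cmeasurableM; exact: cmeasurable_indic. Qed.

Lemma cmeasurable_conj f : cmeasurable f -> cmeasurable (fun x => (f x)^*%R).
Proof.
move=> [rf jf]; split.
- rewrite (_ : (fun x => _) = (fun x => complex.Re (f x)))//.
  by apply/funext => x; case: (f x).
- rewrite (_ : (fun x => _) = (fun x => - complex.Im (f x))).
    exact: measurableT_comp.
  by apply/funext => x; case: (f x).
Qed.

Lemma cmeasurable_sum (I : Type) (r : seq I) (P : pred I) (F : I -> T -> R[i]) :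
  (forall i, P i -> cmeasurable (F i)) ->
  cmeasurable (fun x => \sum_(i <- r | P i) F i x).
Proof.
move=> mF; elim: r => [|i r IH].
  by under eq_fun do rewrite big_nil; exact: cmeasurable_cst.
under eq_fun do rewrite big_cons.
by case Pi : (P i) => //; apply: cmeasurableD => //; exact: mF.
Qed.

Lemma measurable_normc f : cmeasurable f ->
  measurable_fun setT (fun x => normc (f x)).
Proof.
move=> [rf jf].
rewrite (_ : (fun x => _) = (@Num.sqrt R) \o
  (fun x => complex.Re (f x) ^+ 2 + complex.Im (f x) ^+ 2)); last first.
  by apply/funext => x /=; case: (f x).
apply: (@measurableT_comp _ _ _ _ _ _ (@Num.sqrt R)).
  by apply: continuous_measurable_fun; exact: sqrt_continuous.
by apply: measurable_funD; exact: measurable_funX.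
Qed.

Lemma measurable_normc_sqr f : cmeasurable f ->
  measurable_fun setT (fun x => (normc (f x) ^+ 2)%:E : \bar R).
Proof.
by move=> mf; apply/measurable_EFinP/measurable_funX/measurable_normc.
Qed.

Lemma cmeasurable_comp d' (T' : measurableType d') f (h : T' -> T) :
  cmeasurable f -> measurable_fun setT h -> cmeasurable (fun x => f (h x)).
Proof.
move=> [rf jf] mh; split.
- exact: (measurableT_comp rf mh).
- exact: (measurableT_comp jf mh).
Qed.

End cmeasurable_theory.

(** * Square-integrable functions *)

Section energy.
Context d (T : measurableType d) (R : realType).
Implicit Types (mu : {measure set T -> \bar R}) (f g : T -> R[i]).

(** The square of the [L^2] norm. It turns Pythagoras and Fubini into plain
    identities between extended reals, with no square roots. *)
Definition energy mu f : \bar R := (\int[mu]_x (normc (f x) ^+ 2)%:E)%E.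

Lemma energy_ge0 mu f : (0 <= energy mu f)%E.
Proof. by apply: integral_ge0 => x _; rewrite lee_fin sqr_ge0. Qed.
Hint Resolve energy_ge0 : core.

Lemma fine_energy_ge0 mu f : 0 <= fine (energy mu f).
Proof. by rewrite fine_ge0// energy_ge0. Qed.

Lemma cLnorm2_sqr mu f : (cLnorm mu 2%:E f `^ 2 = energy mu f)%E.
Proof.
rewrite /cLnorm poweR_Lnorm ?pnatr_eq0//.
apply: eq_integral => x _ /=.
by rewrite ger0_norm ?normc_ge0// powR_mulrn ?normc_ge0.
Qed.

Lemma cLnorm2E mu f : (cLnorm mu 2%:E f = energy mu f `^ 2^-1)%E.
Proof.
by rewrite -cLnorm2_sqr -poweRrM mulfV ?pnatr_eq0// poweRe1// Lnorm_ge0.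
Qed.

Lemma cLnorm_ge0 mu p f : (0 <= cLnorm mu p f)%E.
Proof. exact: Lnorm_ge0. Qed.

Lemma cLnorm2_lty mu f : (cLnorm mu 2%:E f < +oo)%E = (energy mu f < +oo)%E.
Proof.
apply/idP/idP; rewrite cLnorm2E; last exact: poweR_lty.
by apply: lty_poweRy; rewrite invr_neq0 ?pnatr_eq0.
Qed.

Lemma inL2P mu f : inL2 mu f <-> cmeasurable f /\ (energy mu f < +oo)%E.
Proof. by rewrite /inL2 cLnorm2_lty. Qed.

Lemma inL2_energy mu f : inL2 mu f -> energy mu f \is a fin_num.
Proof. by move=> /inL2P[_ foo]; rewrite ge0_fin_numE. Qed.

Lemma inL2_measurable mu f : inL2 mu f -> cmeasurable f.
Proof. by case. Qed.

(** The weak constant 2 suffices wherever only smallness matters. *)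
Lemma energyD mu f g : cmeasurable f -> cmeasurable g ->
  (energy mu (fun x => f x + g x)%R <= 2%:E * energy mu f + 2%:E * energy mu g)%E.
Proof.
move=> mf mg.
rewrite /energy -!ge0_integralZl_EFin//; first last.
- exact: measurable_normc_sqr.
- by move=> *; rewrite lee_fin sqr_ge0.
- exact: measurable_normc_sqr.
- by move=> *; rewrite lee_fin sqr_ge0.
rewrite -ge0_integralD//; first last.
- by apply: measurable_funeM; exact: measurable_normc_sqr.
- by move=> *; rewrite -EFinM lee_fin mulr_ge0// sqr_ge0.
- by apply: measurable_funeM; exact: measurable_normc_sqr.
- by move=> *; rewrite -EFinM lee_fin mulr_ge0// sqr_ge0.
apply: ge0_le_integral => //.
- by move=> *; rewrite lee_fin sqr_ge0.
- exact/measurable_normc_sqr/cmeasurableD.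
- by apply: emeasurable_funD; apply: measurable_funeM;
    exact: measurable_normc_sqr.
- by move=> x _; rewrite -!EFinM -EFinD lee_fin normc_sqrD.
Qed.

Lemma cLnormD mu (p : R) f g : 1 <= p -> cmeasurable f -> cmeasurable g ->
  (cLnorm mu p%:E (fun x => f x + g x)%R <= cLnorm mu p%:E f + cLnorm mu p%:E g)%E.
Proof.
move=> p1 mf mg.
have := minkowski_EFin mu (measurable_normc mf) (measurable_normc mg) p1.
apply: le_trans.
have p0 : 0 < p by exact: lt_le_trans p1.
rewrite /cLnorm unlock; apply: gt0_ler_poweR => //.
- by rewrite invr_ge0 ltW.
- by rewrite in_itv /= leey andbT integral_ge0// => x _; exact: poweR_ge0.
- by rewrite in_itv /= leey andbT integral_ge0// => x _; exact: poweR_ge0.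
apply: ge0_le_integral => //.
- by move=> x _; exact: poweR_ge0.
- apply: (@measurableT_comp _ _ _ _ _ _ (fun x : \bar R => (x `^ p)%E)).
    exact: measurable_poweR.
  by apply/measurableT_comp => //; apply/measurable_EFinP/measurable_normc/cmeasurableD.
- apply: (@measurableT_comp _ _ _ _ _ _ (fun x : \bar R => (x `^ p)%E)).
    exact: measurable_poweR.
  by apply/measurableT_comp => //; apply/measurable_EFinP/measurable_funD => //;
    exact: measurable_normc.
move=> x _ /=; rewrite !lee_fin; apply: ge0_ler_powR.
- exact: ltW.
- by rewrite nnegrE.
- by rewrite nnegrE.
by rewrite !ger0_norm ?addr_ge0 ?normc_ge0//; exact: le_normcD.
Qed.

Lemma cLnorm_ae_eq mu (p : R) f g : cmeasurable f -> cmeasurable g ->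
  ae_eq_fun mu f g -> cLnorm mu p%:E f = cLnorm mu p%:E g.
Proof.
move=> mf mg fg; rewrite /cLnorm unlock.
have mn h : cmeasurable h ->
    measurable_fun setT (fun x => `| (normc (h x))%:E | `^ p)%E.
  move=> mh; apply: (@measurableT_comp _ _ _ _ _ _ (fun x : \bar R => (x `^ p)%E)).
    exact: measurable_poweR.
  by apply/measurableT_comp => //; apply/measurable_EFinP/measurable_normc.
rewrite (ae_eq_integral (fun x => `| (normc (g x))%:E | `^ p)%E) //; [exact: mn|exact: mn|].
by move: fg; apply: filterS => x -> _.
Qed.

Lemma energy_ae_eq mu f g : cmeasurable f -> cmeasurable g ->
  ae_eq_fun mu f g -> energy mu f = energy mu g.
Proof.
by move=> mf mg fg; rewrite -!cLnorm2_sqr (cLnorm_ae_eq _ mf mg fg).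
Qed.

Lemma energyZ mu (c : R[i]) f : cmeasurable f ->
  energy mu (fun x => c * f x) = ((normc c ^+ 2)%:E * energy mu f)%E.
Proof.
move=> mf; rewrite /energy -ge0_integralZl_EFin ?sqr_ge0//.
- by apply: eq_integral => x _; rewrite normcM exprMn.
- by move=> *; rewrite lee_fin sqr_ge0.
- exact: measurable_normc_sqr.
Qed.

Lemma energyN mu f : energy mu (fun x => - f x) = energy mu f.
Proof. by apply: eq_integral => x _; rewrite normcN. Qed.

Lemma energyC mu f g :
  energy mu (fun x => f x - g x) = energy mu (fun x => g x - f x).
Proof. by rewrite -energyN; congr energy; apply/funext => x; rewrite opprB. Qed.

Lemma energy0 mu : energy mu (fun=> 0) = 0%E.
Proof. by apply: integral0_eq => x _; rewrite normc0 expr0n. Qed.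

Lemma energy_eq0 mu f : cmeasurable f -> energy mu f = 0%E ->
  ae_eq_fun mu f (fun=> 0).
Proof.
move=> mf f0.
have /ae_eq_integral_abs : measurable_fun setT (fun x => (normc (f x) ^+ 2)%:E : \bar R).
  exact: measurable_normc_sqr.
move=> /(_ mu measurableT)[+ _].
have -> : (\int[mu]_x `|(normc (f x) ^+ 2)%:E| = 0)%E.
  by rewrite -[RHS]f0; apply: eq_integral => x _; rewrite gee0_abs// lee_fin sqr_ge0.
move=> /(_ erefl); apply: filterS => x /(_ I) [] /eqP.
by rewrite sqrf_eq0 normc_eq0 => /eqP.
Qed.

Lemma inL2D mu f g : inL2 mu f -> inL2 mu g -> inL2 mu (fun x => f x + g x).
Proof.
move=> /inL2P[mf f2] /inL2P[mg g2]; apply/inL2P; split.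
  exact: cmeasurableD.
apply: (le_lt_trans (energyD mu mf mg)).
by apply: lte_add_pinfty; apply: lte_mul_pinfty.
Qed.

Lemma inL2Z mu (c : R[i]) f : inL2 mu f -> inL2 mu (fun x => c * f x).
Proof.
move=> /inL2P[mf f2]; apply/inL2P; split; first exact: cmeasurableZ.
by rewrite energyZ//; apply: lte_mul_pinfty => //; rewrite lee_fin sqr_ge0.
Qed.

Lemma inL2N mu f : inL2 mu f -> inL2 mu (fun x => - f x).
Proof. by move=> /(inL2Z (-1)); under eq_fun do rewrite mulN1r. Qed.

Lemma inL2B mu f g : inL2 mu f -> inL2 mu g -> inL2 mu (fun x => f x - g x).
Proof. by move=> fL /inL2N; exact: inL2D. Qed.

Lemma inL20 mu : inL2 mu (fun=> 0).
Proof.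
by apply/inL2P; split; [exact: cmeasurable_cst|rewrite energy0].
Qed.

Lemma inL2_sum mu (I : Type) (r : seq I) (F : I -> T -> R[i]) :
  (forall i, inL2 mu (F i)) -> inL2 mu (fun x => \sum_(i <- r) F i x).
Proof.
move=> FL; elim: r => [|i r IH].
  by under eq_fun do rewrite big_nil; exact: inL20.
by under eq_fun do rewrite big_cons; exact: inL2D.
Qed.

Lemma inL2_le mu f g : cmeasurable f -> inL2 mu g ->
  (forall x, normc (f x) <= normc (g x)) -> inL2 mu f.
Proof.
move=> mf /inL2P[mg g2] fg; apply/inL2P; split => //.
apply: le_lt_trans g2; apply: ge0_le_integral => //.
- by move=> *; rewrite lee_fin sqr_ge0.
- exact: measurable_normc_sqr.
- exact: measurable_normc_sqr.
- by move=> x _; rewrite lee_fin lerXn2r// nnegrE normc_ge0.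
Qed.

Lemma normc_restr (A : set T) f x : normc (restr A f x) <= normc (f x).
Proof.
by rewrite /restr normcM normc_indic indicE; case: (x \in A);
  rewrite ?mul1r ?mul0r ?normc_ge0.
Qed.

Lemma inL2_restr mu (A : set T) f : measurable A -> inL2 mu f ->
  inL2 mu (restr A f).
Proof.
move=> mA fL; apply: (inL2_le _ fL); last exact: normc_restr.
by apply: cmeasurable_restr => //; exact: inL2_measurable fL.
Qed.

Lemma energy_indic mu (A : set T) : measurable A ->
  energy mu (fun x => (\1_A x)%:C) = mu A.
Proof.
move=> mA; rewrite -[in RHS](setIT A) -integral_indic//.
apply: eq_integral => x _; rewrite normc_indic indicE.
by case: (x \in A); rewrite /= ?expr1n ?expr0n.
Qed.

Lemma inL2_indic mu (A : set T) : measurable A -> (mu A < +oo)%E ->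
  inL2 mu (fun x => (\1_A x)%:C).
Proof.
by move=> mA Aoo; apply/inL2P; rewrite energy_indic//; split => //;
  exact: cmeasurable_indic.
Qed.

End energy.
#[global] Hint Extern 0 (is_true (_ <= energy _ _)%E) => solve [apply: energy_ge0] : core.

Section L2dot_theory.
Context d (T : measurableType d) (R : realType).
Variable mu : {measure set T -> \bar R}.
Implicit Types f g h : T -> R[i].

Lemma normc_mul_conj (z w : R[i]) : normc (z * w^*%R) <= normc z ^+ 2 + normc w ^+ 2.
Proof.
have -> : normc (z * w^*%R) = normc z * normc w.
  rewrite normcM; congr (_ * _).
  by case: w => a b; rewrite /normc /= sqrrN.
have := sqr_ge0 (normc z - normc w).
have := sqr_ge0 (normc z + normc w).
have := normc_ge0 z; have := normc_ge0 w; nra.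
Qed.

Lemma Re_le_normc (z : R[i]) : `|complex.Re z| <= normc z.
Proof.
by rewrite -ler_sqr ?nnegrE ?normc_ge0// normc_sqr real_normK ?num_real// lerDl sqr_ge0.
Qed.

Lemma Im_le_normc (z : R[i]) : `|complex.Im z| <= normc z.
Proof.
by rewrite -ler_sqr ?nnegrE ?normc_ge0// normc_sqr real_normK ?num_real// lerDr sqr_ge0.
Qed.

Let dom f g x := normc (f x) ^+ 2 + normc (g x) ^+ 2.

Let integrable_dom f g : inL2 mu f -> inL2 mu g ->
  mu.-integrable setT (EFin \o dom f g).
Proof.
move=> /inL2P[mf f2] /inL2P[mg g2]; apply/integrableP; split.
  apply/measurable_EFinP/measurable_funD.
    exact/measurable_funX/measurable_normc.
  exact/measurable_funX/measurable_normc.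
under eq_integral.
  move=> x _; rewrite gee0_abs; last by rewrite lee_fin addr_ge0 ?sqr_ge0.
  rewrite /= EFinD; over.
rewrite ge0_integralD//.
- exact: lte_add_pinfty.
- by move=> *; rewrite lee_fin sqr_ge0.
- exact: measurable_normc_sqr.
- by move=> *; rewrite lee_fin sqr_ge0.
- exact: measurable_normc_sqr.
Qed.

Lemma integrable_Re f g : inL2 mu f -> inL2 mu g ->
  mu.-integrable setT (EFin \o (fun x => complex.Re (f x * (g x)^*%R))).
Proof.
move=> fL gL; apply: (le_integrable measurableT _ _ (integrable_dom fL gL)).
  apply/measurable_EFinP; apply: (cmeasurableM _ _).1.
    exact: inL2_measurable fL.
  exact/cmeasurable_conj/(inL2_measurable gL).
move=> x _ /=; rewrite lee_fin [leRHS]ger0_norm ?addr_ge0 ?sqr_ge0//.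
exact: le_trans (Re_le_normc _) (normc_mul_conj _ _).
Qed.

Lemma integrable_Im f g : inL2 mu f -> inL2 mu g ->
  mu.-integrable setT (EFin \o (fun x => complex.Im (f x * (g x)^*%R))).
Proof.
move=> fL gL; apply: (le_integrable measurableT _ _ (integrable_dom fL gL)).
  apply/measurable_EFinP; apply: (cmeasurableM _ _).2.
    exact: inL2_measurable fL.
  exact/cmeasurable_conj/(inL2_measurable gL).
move=> x _ /=; rewrite lee_fin [leRHS]ger0_norm ?addr_ge0 ?sqr_ge0//.
exact: le_trans (Im_le_normc _) (normc_mul_conj _ _).
Qed.

Lemma L2dotDl f g h : inL2 mu f -> inL2 mu g -> inL2 mu h ->
  L2dot mu (fun x => f x + g x) h = L2dot mu f h + L2dot mu g h.
Proof.
move=> fL gL hL; rewrite /L2dot.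
have -> : (fun x => complex.Re ((f x + g x) * (h x)^*%R)) =
    (fun x => complex.Re (f x * (h x)^*%R) + complex.Re (g x * (h x)^*%R)).
  by apply/funext => x; rewrite mulrDl; case: (f x * _) (g x * _) => ? ? [].
have -> : (fun x => complex.Im ((f x + g x) * (h x)^*%R)) =
    (fun x => complex.Im (f x * (h x)^*%R) + complex.Im (g x * (h x)^*%R)).
  by apply/funext => x; rewrite mulrDl; case: (f x * _) (g x * _) => ? ? [].
rewrite !RintegralD//; exact: integrable_Re || exact: integrable_Im.
Qed.

Lemma L2dotZl (c : R[i]) f h : inL2 mu f -> inL2 mu h ->
  L2dot mu (fun x => c * f x) h = c * L2dot mu f h.
Proof.
move=> fL hL; rewrite /L2dot.
pose z x := f x * (h x)^*%R.
have iR (a : R) : mu.-integrable setT (EFin \o (fun x => a * complex.Re (z x))).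
  exact: (integrableZl measurableT a (integrable_Re fL hL)).
have iI (a : R) : mu.-integrable setT (EFin \o (fun x => a * complex.Im (z x))).
  exact: (integrableZl measurableT a (integrable_Im fL hL)).
case: c => a b.
have -> : (fun x => complex.Re ((a +i* b) * f x * (h x)^*%R)) =
    (fun x => a * complex.Re (z x) - b * complex.Im (z x)).
  by apply/funext => x; rewrite -mulrA -/(z x); case: (z x).
have -> : (fun x => complex.Im ((a +i* b) * f x * (h x)^*%R)) =
    (fun x => a * complex.Im (z x) + b * complex.Re (z x)).
  by apply/funext => x; rewrite -mulrA -/(z x); case: (z x).
rewrite RintegralB// RintegralD// !RintegralZl//;
  exact: integrable_Re || exact: integrable_Im.
Qed.

Lemma L2dotC f g : inL2 mu f -> inL2 mu g -> L2dot mu g f = (L2dot mu f g)^*%R.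
Proof.
move=> fL gL; rewrite /L2dot.
have -> : (fun x => complex.Re (g x * (f x)^*%R)) = (fun x => complex.Re (f x * (g x)^*%R)).
  by apply/funext => x; case: (f x) (g x) => a b [c e] /=; ring.
have -> : (fun x => complex.Im (g x * (f x)^*%R)) =
    (fun x => -1 * complex.Im (f x * (g x)^*%R)).
  by apply/funext => x; case: (f x) (g x) => a b [c e] /=; ring.
by rewrite RintegralZl//; [rewrite mulN1r|exact: integrable_Im].
Qed.

Lemma L2dot_self f : inL2 mu f -> L2dot mu f f = (fine (energy mu f))%:C.
Proof.
move=> fL; rewrite /L2dot.
have -> : (fun x => complex.Re (f x * (f x)^*%R)) = (fun x => normc (f x) ^+ 2).
  by apply/funext => x; rewrite normc_sqr; case: (f x) => a b /=; ring.
have -> : (fun x => complex.Im (f x * (f x)^*%R)) = (fun=> 0).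
  by apply/funext => x; case: (f x) => a b /=; ring.
by congr (_ +i* _); rewrite /Rintegral integral0.
Qed.

Lemma L2dot_ae f g h : inL2 mu f -> inL2 mu g -> inL2 mu h ->
  ae_eq_fun mu f g -> L2dot mu f h = L2dot mu g h.
Proof.
move=> fL gL hL fg; rewrite /L2dot; congr (_ +i* _); rewrite /Rintegral.
- congr fine; apply: ae_eq_integral => //.
  + exact: measurable_int (integrable_Re fL hL).
  + exact: measurable_int (integrable_Re gL hL).
  + by move: fg; apply: filterS => x -> _.
- congr fine; apply: ae_eq_integral => //.
  + exact: measurable_int (integrable_Im fL hL).
  + exact: measurable_int (integrable_Im gL hL).
  + by move: fg; apply: filterS => x -> _.
Qed.

Lemma L2dot_suml (I : Type) (r : seq I) (c : I -> R[i]) (F : I -> T -> R[i]) h :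
  (forall i, inL2 mu (F i)) -> inL2 mu h ->
  L2dot mu (fun x => \sum_(i <- r) c i * F i x) h =
  \sum_(i <- r) c i * L2dot mu (F i) h.
Proof.
move=> FL hL; elim: r => [|i r IH].
  rewrite big_nil; under [X in L2dot _ X]eq_fun do rewrite big_nil.
  have := L2dotZl 0 (inL20 mu) hL.
  by under [X in L2dot _ X]eq_fun do rewrite mul0r; rewrite mul0r.
rewrite big_cons; under [X in L2dot _ X]eq_fun do rewrite big_cons.
rewrite L2dotDl//; [|exact: inL2Z|by apply: inL2_sum => j; exact: inL2Z].
by rewrite L2dotZl// IH.
Qed.

Lemma L2dot_sumr (I : Type) (r : seq I) (c : I -> R[i]) (F : I -> T -> R[i]) h :
  (forall i, inL2 mu (F i)) -> inL2 mu h ->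
  L2dot mu h (fun x => \sum_(i <- r) c i * F i x) =
  \sum_(i <- r) (c i)^*%R * L2dot mu h (F i).
Proof.
move=> FL hL; rewrite L2dotC//; last by apply: inL2_sum => i; exact: inL2Z.
rewrite L2dot_suml// conjc_sum; apply: eq_bigr => i _.
by rewrite conjcM -L2dotC.
Qed.

(** Expanding the square expresses the norm of a combination through the Gram
    matrix of its terms; [spectral_isometry] compares two such matrices. *)
Lemma energy_combination (I : Type) (r : seq I) (c : I -> R[i])
    (F : I -> T -> R[i]) : (forall i, inL2 mu (F i)) ->
  (fine (energy mu (fun x => \sum_(i <- r) c i * F i x)))%:C =
  \sum_(i <- r) \sum_(j <- r) c i * (c j)^*%R * L2dot mu (F i) (F j).
Proof.
move=> FL; have SL : inL2 mu (fun x => \sum_(i <- r) c i * F i x).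
  by apply: inL2_sum => i; exact: inL2Z.
rewrite -L2dot_self// L2dot_suml//; apply: eq_bigr => i _.
by rewrite L2dot_sumr// big_distrr; apply: eq_bigr => j _ /=; rewrite mulrA.
Qed.

(** The weak constant 2 suffices wherever only smallness matters. *)
Lemma energyD_dot f g : inL2 mu f -> inL2 mu g ->
  (fine (energy mu (fun x => f x + g x)))%:C =
  (fine (energy mu f))%:C + L2dot mu f g + (L2dot mu f g)^*%R +
  (fine (energy mu g))%:C.
Proof.
move=> fL gL; have fgL := inL2D fL gL.
rewrite -!L2dot_self// L2dotDl// (L2dotC fgL fL) (L2dotC fgL gL) !L2dotDl//.
by rewrite !conjcD -!L2dotC// !addrA.
Qed.

End L2dot_theory.

Section energy_more.
Context d (T : measurableType d) (R : realType).
Implicit Types (mu : {measure set T -> \bar R}) (f g : T -> R[i]).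

Lemma cLnorm2_lt mu f (e : R) : 0 <= e ->
  (cLnorm mu 2%:E f < e%:E)%E = (energy mu f < (e ^+ 2)%:E)%E.
Proof.
move=> e0; apply/idP/idP => h.
- have ffin : cLnorm mu 2%:E f \is a fin_num.
    by rewrite ge0_fin_numE ?cLnorm_ge0//; exact: lt_trans h (ltry _).
  rewrite -cLnorm2_sqr -(fineK ffin) poweR_EFin lte_fin powR_mulrn; last first.
    by rewrite fine_ge0// cLnorm_ge0.
  rewrite ltrXn2r// ?nnegrE ?fine_ge0 ?cLnorm_ge0//.
  by rewrite -lte_fin fineK.
- have ffin : energy mu f \is a fin_num.
    by rewrite ge0_fin_numE ?energy_ge0//; exact: lt_trans h (ltry _).
  have f0 : 0 <= fine (energy mu f) by exact: fine_energy_ge0.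
  rewrite cLnorm2E -(fineK ffin) poweR_EFin lte_fin powR12_sqrt//.
  rewrite -[ltRHS](ger0_norm e0) -sqrtr_sqr ltr_sqrt; last first.
    by rewrite -lte_fin; apply: le_lt_trans h.
  by rewrite -lte_fin fineK.
Qed.

Lemma cLnorm2_cvg0 mu (u : nat -> T -> R[i]) :
  (fun n => cLnorm mu 2%:E (u n)) @ \oo --> 0%E <->
  (fun n => energy mu (u n)) @ \oo --> 0%E.
Proof.
split.
- move=> u0; have -> : (fun n => energy mu (u n)) =
      (fun n => cLnorm mu 2%:E (u n) * cLnorm mu 2%:E (u n))%E.
    apply/funext => n; rewrite -cLnorm2_sqr.
    have [uoo|] := eqVneq (cLnorm mu 2%:E (u n)) +oo%E.
      by rewrite uoo poweRyr ?pnatr_eq0// mulyy.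
    rewrite -ltey => uoo.
    have ufin : cLnorm mu 2%:E (u n) \is a fin_num.
      by rewrite ge0_fin_numE ?cLnorm_ge0.
    rewrite -(fineK ufin) poweR_EFin powR_mulrn ?fine_ge0 ?cLnorm_ge0//.
  have := cvgeM _ u0 u0; rewrite mule0; apply.
  by rewrite mule_def_fin.
- move=> u0; apply/fine_cvgP; split.
    have /fine_cvgP[ufin _] := u0.
    apply: filterS ufin => n un; rewrite ge0_fin_numE ?cLnorm_ge0// cLnorm2_lty.
    by rewrite -ge0_fin_numE ?energy_ge0.
  apply/cvgrPdist_lt => e e0; have /fine_cvgP[ufin] := u0.
  move/cvgrPdist_lt => /(_ (e ^+ 2)) ; rewrite exprn_gt0// => /(_ isT).
  apply: filterS2 ufin => n un; rewrite /= !sub0r !normrN.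
  rewrite ger0_norm ?fine_energy_ge0// -lte_fin fineK// => h.
  rewrite ger0_norm; last by rewrite fine_ge0// cLnorm_ge0.
  have := h; rewrite -cLnorm2_lt ?ltW// => h'.
  rewrite -lte_fin fineK// ge0_fin_numE ?cLnorm_ge0//.
  exact: lt_trans h' (ltry _).
Qed.

Lemma cvge0_near_lt (u : nat -> \bar R) (e : R) :
  u @ \oo --> 0%E -> 0 < e -> \forall n \near \oo, (u n < e%:E)%E.
Proof.
move=> /fine_cvgP[ufin] /cvgrPdist_lt u0 e0.
apply: filterS2 ufin (u0 e e0) => n un; rewrite /= sub0r normrN => hn.
by rewrite -(fineK un) lte_fin (le_lt_trans (ler_norm _)).
Qed.

End energy_more.

(** * The measure of a vector under a spectral decomposition *)

Section spectral_theory.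
Context d (T : measurableType d) (R : realType).
Variable mu : {measure set T -> \bar R}.
Context d' (S : measurableType d').
Variable E : set S -> (T -> R[i]) -> (T -> R[i]).
Hypothesis specE : spectral_decomposition mu E.
Implicit Types (A B : set S) (f g : T -> R[i]).

Let EL := sd_L2 specE.

Lemma spectral_dot A B f g : measurable A -> measurable B ->
  inL2 mu f -> inL2 mu g ->
  L2dot mu (E A f) (E B g) = L2dot mu (E (A `&` B) f) g.
Proof.
move=> mA mB fL gL.
rewrite -(sd_sym specE mB (EL mA fL) gL) setIC; apply: L2dot_ae => //.
- by apply: EL => //; exact: EL.
- by apply: EL => //; exact: measurableI.
- by have := sd_mul specE mB mA fL; apply: filterS => x ->.
Qed.

Lemma spectral_energy_dot A f : measurable A -> inL2 mu f ->
  (fine (energy mu (E A f)))%:C = L2dot mu (E A f) f.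
Proof.
by move=> mA fL; rewrite -L2dot_self ?spectral_dot ?setIid//; exact: EL.
Qed.

(** [E A f] is orthogonal to [E B f - E A f], because [E A] is symmetric and
    [E A (E B f) = E A f]. *)
Lemma spectral_pythagoras A B f : measurable A -> measurable B -> inL2 mu f ->
  A `<=` B ->
  energy mu (E B f) =
  (energy mu (E A f) + energy mu (fun x => (E B f x - E A f x)%R))%E.
Proof.
move=> mA mB fL AB.
have AL := EL mA fL; have BL := EL mB fL; have BAL := inL2B BL AL.
have Dot : L2dot mu (fun x => E B f x - E A f x) (E A f) = 0.
  under [X in L2dot _ X]eq_fun do rewrite -mulN1r.
  rewrite L2dotDl//; last exact: inL2Z.
  by rewrite L2dotZl// !spectral_dot// setIid setIidr// mulN1r subrr.
have := energyD_dot BAL AL.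
rewrite Dot conjC0 !addr0 -raddfD /=.
under [X in energy mu X]eq_fun do rewrite subrK.
move=> /(congr1 (@complex.Re R)) /= h.
rewrite -[LHS](fineK (inL2_energy BL)) h EFinD !fineK ?inL2_energy//.
by rewrite addeC.
Qed.

Lemma spectral_contraction A f : measurable A -> inL2 mu f ->
  (energy mu (E A f) <= energy mu f)%E.
Proof.
move=> mA fL; have -> : energy mu f = energy mu (E setT f).
  apply: energy_ae_eq; first exact: inL2_measurable fL.
    by apply: inL2_measurable; exact: EL.
  by have := sd_setT specE fL; apply: filterS.
by rewrite (spectral_pythagoras mA measurableT fL)// leeDl ?energy_ge0.
Qed.

(** In the additivity axiom for the empty union, the error after [n] terms is
    [(1 - n) E set0 f]; it cannot tend to 0 unless [E set0 f] vanishes. *)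
Lemma spectral_set0 f : inL2 mu f -> energy mu (E set0 f) = 0%E.
Proof.
move=> fL; have EL0 := EL measurable0 fL.
have := sd_sigma_additive specE (A := fun=> set0) (fun=> measurable0).
move=> /(_ f (@trivIset_set0 _ _ _) fL) /cLnorm2_cvg0 h.
apply/eqP; rewrite eq_le energy_ge0 andbT.
apply: (cvge_to_ge h); exists 2%N => // n /= n2.
rewrite bigcup0//.
have -> : (fun x => E set0 f x - \sum_(k < n) E set0 f x) =
    (fun x => (1 - n%:R) * E set0 f x).
  by apply/funext => x; rewrite sumr_const card_ord mulrBl mul1r mulr_natl.
rewrite energyZ; last exact: inL2_measurable EL0.
rewrite -[leLHS]mul1e.
apply: lee_wpmul2r; first exact: energy_ge0.
rewrite lee_fin.
rewrite (_ : 1 - n%:R = - (n.-1%:R)%:C); last first.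
  case: n n2 => // n _.
  by rewrite /= -natr1 opprD addrCA subrr addr0 rmorph_nat.
rewrite normcN normcR ger0_norm// expr_ge1// ler1n.
by case: n n2 => // -[].
Qed.

Lemma spectral_disjoint A B f : measurable A -> measurable B -> inL2 mu f ->
  A `&` B = set0 -> L2dot mu (E A f) (E B f) = 0.
Proof.
move=> mA mB fL AB; rewrite spectral_dot// AB.
by rewrite -spectral_energy_dot// spectral_set0.
Qed.

Section spectral_measure.
Variable f : T -> R[i].
Hypothesis fL : inL2 mu f.

Definition spectral_measure A : \bar R := energy mu (E A f).

Let nu0 : spectral_measure set0 = 0%E.
Proof. exact: spectral_set0. Qed.

Let nu_ge0 A : (0 <= spectral_measure A)%E.
Proof. exact: energy_ge0. Qed.

Let nu_sigma_additive : semi_sigma_additive spectral_measure.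
Proof.
move=> F mF tF mUF; rewrite /spectral_measure.
pose S_ n x := \sum_(k < n) E (F k) f x.
have FL k := EL (mF k) fL; have UL := EL mUF fL.
have SL n : inL2 mu (S_ n) by apply: inL2_sum => i; exact: FL.
have Dot n : L2dot mu (E (\bigcup_k F k) f) (S_ n) =
    (fine (\sum_(0 <= k < n) energy mu (E (F k) f))%E)%:C.
  have -> : S_ n = (fun x => \sum_(k < n) 1 * E (F k) f x).
    by apply/funext => x; apply: eq_bigr => k _; rewrite mul1r.
  rewrite L2dot_sumr// big_mkord -sum_fine; last by move=> i _; exact: inL2_energy.
  rewrite raddf_sum; apply: eq_bigr => k _.
  rewrite conjC1 mul1r spectral_dot// setIC setIidl; last exact: bigcup_sup.
  by rewrite -spectral_energy_dot.
have Self n : energy mu (S_ n) = (\sum_(0 <= k < n) energy mu (E (F k) f))%E.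
  have h : (fine (energy mu (S_ n)))%:C =
      (fine (\sum_(0 <= k < n) energy mu (E (F k) f))%E)%:C.
    have -> : S_ n = (fun x => \sum_(k < n) 1 * E (F k) f x).
      by apply/funext => x; apply: eq_bigr => k _; rewrite mul1r.
    rewrite energy_combination// big_mkord -sum_fine; last by move=> i _; exact: inL2_energy.
    rewrite raddf_sum; apply: eq_bigr => k _.
    rewrite (bigD1 k)//= conjC1 !mul1r big1 ?addr0.
      by rewrite L2dot_self.
    move=> j jk; rewrite spectral_disjoint ?mulr0//.
    have /trivIsetP := tF; apply => //.
    by apply: contra jk => /eqP kj; apply/eqP/val_inj.
  rewrite -[LHS]fineK ?inL2_energy//; move: h => /(congr1 (@complex.Re R)) /= ->.
  rewrite fineK//; apply/sum_fin_numP => i _ _; exact: inL2_energy.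
have Pyth n : energy mu (E (\bigcup_k F k) f) =
   (energy mu (fun x => (E (\bigcup_k F k) f x - S_ n x)%R) + energy mu (S_ n))%E.
  have rL := inL2B UL (SL n).
  have := energyD_dot rL (SL n).
  have -> : L2dot mu (fun x => E (\bigcup_k F k) f x - S_ n x) (S_ n) = 0.
    under [X in L2dot _ X]eq_fun do rewrite -mulN1r.
    rewrite L2dotDl//; last exact: inL2Z.
    by rewrite L2dotZl// Dot L2dot_self// Self mulN1r subrr.
  rewrite conjC0 !addr0 -raddfD /=.
  under [X in energy mu X]eq_fun do rewrite subrK.
  move=> /(congr1 (@complex.Re R)) /= h.
  by rewrite -[LHS](fineK (inL2_energy UL)) h EFinD !fineK ?inL2_energy.
have := sd_sigma_additive specE mF tF fL => /cLnorm2_cvg0 h.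
have -> : (fun n => \sum_(0 <= i < n) energy mu (E (F i) f))%E =
   (fun n => energy mu (E (\bigcup_k F k) f) -
     energy mu (fun x => (E (\bigcup_k F k) f x - S_ n x)%R))%E.
  apply/funext => n; rewrite (Pyth n) -Self [X in _ = (X - _)%E]addeC addeK//.
  by apply: inL2_energy; exact: inL2B.
rewrite -[X in _ --> X]sube0; apply: cvgeB => //.
- by apply: fin_num_adde_defl; rewrite oppe0.
- exact: cvg_cst.
Qed.

HB.instance Definition _ := isMeasure.Build _ _ _ spectral_measure
  nu0 nu_ge0 nu_sigma_additive.

Let nu_finite : fin_num_fun spectral_measure.
Proof. by move=> A mA; apply: inL2_energy; exact: EL. Qed.

HB.instance Definition _ := Measure_isFinite.Build _ _ _ spectral_measure
  nu_finite.

Definition spectral_finite_measure : {finite_measure set S -> \bar R} :=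
  spectral_measure.

End spectral_measure.

Lemma dot_indic (nu : {measure set S -> \bar R}) A B :
  measurable A -> measurable B ->
  L2dot nu (fun s => (\1_A s)%:C) (fun s => (\1_B s)%:C) =
  (fine (nu (A `&` B)))%:C.
Proof.
move=> mA mB; rewrite /L2dot.
have AB s : (\1_A s)%:C * ((\1_B s)%:C : R[i])^*%R = (\1_(A `&` B) s)%:C.
  by rewrite indicI /= rmorphM /=; congr (_ * _); exact: conj_real.
under eq_Rintegral do rewrite AB.
under [X in _ +i* X]eq_Rintegral do rewrite AB.
rewrite /Rintegral /= integral_indic//; last exact: measurableI.
by rewrite setIT integral0.
Qed.

(** The Gram matrices of the vectors [E (A i) f] and of the indicators of the
    [A i] in [L^2(nu)] are both given by [nu (A i `&` A j)]. *)
Lemma spectral_isometry f (nu : {measure set S -> \bar R}) (I : Type) (r : seq I)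
    (c : I -> R[i]) (A : I -> set S) :
  inL2 mu f -> spectral_distribution mu E f nu -> (forall i, measurable (A i)) ->
  energy mu (fun x => \sum_(i <- r) c i * E (A i) f x) =
  energy nu (fun s => \sum_(i <- r) c i * (\1_(A i) s)%:C).
Proof.
move=> fL nuE mA.
have nuA B : measurable B -> nu B = energy mu (E B f).
  by move=> mB; rewrite nuE// cLnorm2_sqr.
have FL i : inL2 mu (E (A i) f) by exact: EL.
have GL i : inL2 nu (fun s => (\1_(A i) s)%:C).
  apply: inL2_indic => //; rewrite nuA//.
  by have /inL2P[] := FL i.
have := energy_combination r c FL.
have dotE i j : L2dot mu (E (A i) f) (E (A j) f) =
    L2dot nu (fun s => (\1_(A i) s)%:C) (fun s => (\1_(A j) s)%:C).
  have mAA : measurable (A i `&` A j) by exact: measurableI.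
  by rewrite spectral_dot// -spectral_energy_dot// dot_indic// nuA.
under eq_bigr do under eq_bigr do rewrite dotE.
rewrite -energy_combination// => /(congr1 (@complex.Re R)) /= h.
rewrite -[LHS]fineK ?inL2_energy ?h ?fineK ?inL2_energy//.
- by apply: inL2_sum => i; exact: inL2Z.
- by apply: inL2_sum => i; exact: inL2Z.
Qed.

(** Both [g] and [E A f] are limits of the same combinations of projections: the
    isometry turns closeness of the step functions to the indicator of [A] into
    closeness of the images to [E A f]. This is how an estimate for
    multipliers is read back as an estimate for projections. *)
Lemma spectral_integral_indic A f g : measurable A ->
  spectral_integral mu E (fun s => (\1_A s)%:C) f g ->
  energy mu g = energy mu (E A f).
Proof.
move=> mA [fL gL [nu nuE approx]].
have AL := EL mA fL.
apply: energy_ae_eq; [exact: inL2_measurable gL|exact: inL2_measurable AL|].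
have BL := inL2B gL AL.
suff /(energy_eq0 (inL2_measurable BL)) : energy mu (fun x => g x - E A f x) = 0%E.
  by apply: filterS => x /eqP; rewrite subr_eq0 => /eqP.
apply/eqP; rewrite eq_le energy_ge0 andbT.
suff small (e : R) : 0 < e -> (energy mu (fun x => (g x - E A f x)%R) <= e%:E)%E.
  by apply/lee_addgt0Pr => e e0; rewrite add0e small.
move=> e0.
have e4 : 0 < Num.sqrt (e / 4) by rewrite sqrtr_gt0 divr_gt0.
have [n [c [B [mB]]]] := approx _ e4.
rewrite !cLnorm2_lt ?sqrtr_ge0// sqr_sqrtr ?divr_ge0 ?(ltW e0)// => hnu hmu.
pose h x := \sum_(i < n) c i * E (B i) f x.
have hL : inL2 mu h by apply: inL2_sum => i; apply: inL2Z; exact: EL.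
(* [1_A] minus the approximating step function, as one combination *)
pose c' (i : option 'I_n) := if i is Some j then - c j else 1.
pose B' (i : option 'I_n) := if i is Some j then B j else A.
have mB' i : measurable (B' i) by case: i.
have := spectral_isometry (None :: map Some (index_enum 'I_n)) c' fL nuE mB'.
under [X in energy mu X]eq_fun do
  (rewrite big_cons big_map /= mul1r; under eq_bigr do rewrite mulNr; rewrite sumrN).
under [X in energy nu X]eq_fun do
  (rewrite big_cons big_map /= mul1r; under eq_bigr do rewrite mulNr; rewrite sumrN).
rewrite -/h => iso.
have -> : (fun x => g x - E A f x) = (fun x => (g x - h x) + - (E A f x - h x)).
  by apply/funext => x; rewrite opprB addrA subrK.
apply: le_trans (energyD _ _ _) _.
- by apply: inL2_measurable; exact: inL2B gL hL.
- by apply/cmeasurableN/inL2_measurable; exact: inL2B AL hL.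
rewrite energyN iso.
apply: (@le_trans _ _ (2%:E * (e / 4)%:E + 2%:E * (e / 4)%:E)%E).
  by apply: leeD; apply: lee_wpmul2l => //; exact: ltW.
rewrite -!EFinM -EFinD lee_fin (_ : 2 * (e / 4) + 2 * (e / 4) = e)//.
by field.
Qed.

End spectral_theory.

(** * Density of step functions *)

Section L2_span.
Context d (T : measurableType d) (R : realType).
Variable mu : {measure set T -> \bar R}.
Implicit Types (G : set (set T)) (f g : T -> R[i]) (A : set T).

Definition step_fun (n : nat) (c : 'I_n -> R[i]) (A : 'I_n -> set T) : T -> R[i] :=
  fun x => \sum_(i < n) c i * (\1_(A i) x)%:C.

(** Closure in [L^2] of the linear span of the indicators of the members of
    [G]. *)
Definition L2_span G f := forall e : R, 0 < e ->
  exists n (c : 'I_n -> R[i]) (A : 'I_n -> set T),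
    (forall i, G (A i)) /\ (energy mu (fun x => (f x - step_fun c A x)%R) < e%:E)%E.

Lemma cmeasurable_step n (c : 'I_n -> R[i]) (A : 'I_n -> set T) :
  (forall i, measurable (A i)) -> cmeasurable (step_fun c A).
Proof.
move=> mA; apply: cmeasurable_sum => i _; apply: cmeasurableZ.
exact: cmeasurable_indic.
Qed.

(** The weak constant 2 suffices wherever only smallness matters. *)
Lemma energyD_lt f g (e : R) : cmeasurable f -> cmeasurable g ->
  (energy mu f < (e / 4)%:E)%E -> (energy mu g < (e / 4)%:E)%E ->
  (energy mu (fun x => f x + g x)%R < e%:E)%E.
Proof.
move=> mf mg fe ge; apply: le_lt_trans (energyD mu mf mg) _.
have -> : e = 2 * (e / 4) + 2 * (e / 4) by field.
have ffin : energy mu f \is a fin_num.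
  by rewrite ge0_fin_numE ?energy_ge0//; apply: lt_trans fe (ltry _).
have gfin : energy mu g \is a fin_num.
  by rewrite ge0_fin_numE ?energy_ge0//; apply: lt_trans ge (ltry _).
move: fe ge; rewrite -(fineK ffin) -(fineK gfin) -!EFinM -EFinD !lte_fin.
by move=> fe ge; apply: ltrD; rewrite ltr_pM2l.
Qed.

Lemma L2_span0 G : L2_span G (fun=> 0).
Proof.
move=> e e0; exists 0%N, (fun=> 0), (fun=> set0); split; first by case.
rewrite (_ : (fun _ => _) = (fun=> 0)) ?energy0 ?lte_fin//.
by apply/funext => x; rewrite /step_fun big_ord0 subr0.
Qed.

Lemma L2_span_indic G A : G A -> L2_span G (fun x => (\1_A x)%:C).
Proof.
move=> GA e e0; exists 1%N, (fun=> 1), (fun=> A); split => //.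
rewrite (_ : (fun x => _ - _) = (fun=> 0)) ?energy0 ?lte_fin//.
by apply/funext => x; rewrite /step_fun big_ord1 mul1r subrr.
Qed.

Lemma L2_spanZ G (a : R[i]) f : G `<=` measurable -> cmeasurable f ->
  L2_span G f -> L2_span G (fun x => a * f x).
Proof.
move=> GM mf sf e e0.
have a1 : 0 < normc a ^+ 2 + 1 by rewrite ltr_pwDr// sqr_ge0.
have [n [c [A [GA cA]]]] := sf _ (divr_gt0 e0 a1).
exists n, (fun i => a * c i), A; split => //.
rewrite (_ : (fun x => _) = (fun x => a * (f x - step_fun c A x))); last first.
  apply/funext => x; rewrite mulrBr /step_fun mulr_sumr; congr (_ - _).
  by apply: eq_bigr => i _; rewrite mulrA.
rewrite energyZ; last first.
  by apply: cmeasurableB => //; apply: cmeasurable_step => i; exact: GM.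
apply: (@le_lt_trans _ _ ((normc a ^+ 2 + 1)%:E *
    energy mu (fun x => f x - step_fun c A x)%R)%E).
  by apply: lee_wpmul2r; [exact: energy_ge0|rewrite lee_fin lerDl].
by rewrite -lte_pdivlMl// -EFinM mulrC.
Qed.

Lemma L2_spanD G f g : G `<=` measurable -> cmeasurable f -> cmeasurable g ->
  L2_span G f -> L2_span G g -> L2_span G (fun x => f x + g x).
Proof.
move=> GM mf mg sf sg e e0.
have e4 : 0 < e / 4 by rewrite divr_gt0.
have [n [c [A [GA cA]]]] := sf _ e4.
have [m [b [B [GB bB]]]] := sg _ e4.
exists (n + m)%N, (fun i => match fintype.split i with inl j => c j | inr j => b j end),
  (fun i => match fintype.split i with inl j => A j | inr j => B j end); split.
  by move=> i; case: fintype.split.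
rewrite (_ : (fun x => _) =
    (fun x => (f x - step_fun c A x) + (g x - step_fun b B x))); last first.
  apply/funext => x; rewrite /step_fun big_split_ord /=.
  under [X in _ - (X + _)]eq_bigr do rewrite (unsplitK (inl _)).
  under [X in _ - (_ + X)]eq_bigr do rewrite (unsplitK (inr _)).
  by rewrite opprD addrACA.
apply: energyD_lt => //; apply: cmeasurableB => //; apply: cmeasurable_step => i;
  exact: GM.
Qed.

Lemma L2_span_sum G (I : Type) (r : seq I) (F : I -> T -> R[i]) :
  G `<=` measurable ->
  (forall i, cmeasurable (F i)) -> (forall i, L2_span G (F i)) ->
  L2_span G (fun x => \sum_(i <- r) F i x).
Proof.
move=> GM mF sF; elim: r => [|i r IH].
  by under eq_fun do rewrite big_nil; exact: L2_span0.
under eq_fun do rewrite big_cons; apply: L2_spanD => //.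
exact: cmeasurable_sum.
Qed.

Lemma L2_span_lim G f : G `<=` measurable -> cmeasurable f ->
  (forall e : R, 0 < e -> exists g,
    [/\ cmeasurable g, L2_span G g & (energy mu (fun x => f x - g x)%R < e%:E)%E]) ->
  L2_span G f.
Proof.
move=> GM mf lf e e0.
have e4 : 0 < e / 4 by rewrite divr_gt0.
have [g [mg sg fg]] := lf _ e4.
have [n [c [A [GA cA]]]] := sg _ e4.
exists n, c, A; split => //.
rewrite (_ : (fun x => _) = (fun x => (f x - g x) + (g x - step_fun c A x))).
  apply: energyD_lt => //; apply: cmeasurableB => //.
  by apply: cmeasurable_step => i; exact: GM.
by apply/funext => x; rewrite addrA subrK.
Qed.

Lemma L2_span_trans G H f : G `<=` measurable -> H `<=` measurable ->
  (forall A, G A -> L2_span H (fun x => (\1_A x)%:C)) ->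
  cmeasurable f -> L2_span G f -> L2_span H f.
Proof.
move=> GM HM GH mf sf; apply: L2_span_lim => // e e0.
have [n [c [A [GA cA]]]] := sf _ e0; exists (step_fun c A); split => //.
  by apply: cmeasurable_step => i; exact: GM.
apply: L2_span_sum => // i.
  by apply/cmeasurableZ/cmeasurable_indic/GM.
apply: L2_spanZ => //; first exact/cmeasurable_indic/GM.
exact: GH.
Qed.

Definition finite_measurable : set (set T) :=
  [set A | measurable A /\ (mu A < +oo)%E].

Let fmM : finite_measurable `<=` measurable. Proof. by move=> A []. Qed.

Let nneg_span (h : T -> R) : measurable_fun setT h -> (forall x, 0 <= h x) ->
  (energy mu (fun x => (h x)%:C) < +oo)%E ->
  L2_span finite_measurable (fun x => (h x)%:C).
Proof.
move=> mh h0 hoo.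
have mEh : measurable_fun setT (EFin \o h) by exact/measurable_EFinP.
pose g := nnsfun_approx measurableT mEh.
have gh n x : g n x <= h x.
  by rewrite -lee_fin nnsfun_approxE; apply: le_approx => // t _; rewrite lee_fin.
have gc x : g n x @[n --> \oo] --> h x.
  have /fine_cvgP[_] := @cvg_nnsfun_approx _ _ _ _ measurableT _ mEh
    (fun t _ => h0 t) x I.
  exact.
have mhg n : measurable_fun setT (fun x => ((h x - g n x) ^+ 2)%:E : \bar R).
  by apply/measurable_EFinP/measurable_funX/measurable_funB.
have normR (a : R) : normc (a%:C : R[i]) ^+ 2 = a ^+ 2.
  by rewrite normcR real_normK ?num_real.
have ih : mu.-integrable setT (fun x => (h x ^+ 2)%:E).
  apply/integrableP; split; first exact/measurable_EFinP/measurable_funX.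
  apply: le_lt_trans hoo; rewrite le_eqVlt; apply/orP; left; apply/eqP.
  by apply: eq_integral => x _; rewrite normR gee0_abs// lee_fin sqr_ge0.
have cvg0 : (\int[mu]_x ((h x - g n x) ^+ 2)%:E)%E @[n --> \oo] --> 0%E.
  have [] := @dominated_convergence _ _ _ mu setT measurableT
    (fun n x => ((h x - g n x) ^+ 2)%:E) (cst 0%E) (fun x => (h x ^+ 2)%:E)
    mhg (measurable_cst _) _ ih.
  - apply: aeW => x _; apply/fine_cvgP; split; first exact: nearW.
    rewrite -[X in _ --> X](expr0n R 2) /=.
    apply: (@continuous_cvg _ _ _ _ _ (fun n => h x - g n x) (fun y => y ^+ 2)).
      exact: exprn_continuous.
    by rewrite -[X in _ --> X](subrr (h x)); apply: cvgB => //; exact: cvg_cst.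
  - apply: aeW => x n _; rewrite gee0_abs ?lee_fin ?sqr_ge0//.
    have gn0 : 0 <= g n x by [].
    rewrite ler_sqr ?nnegrE ?subr_ge0 ?h0 ?gh//.
    by rewrite lerBlDr lerDl.
  - by move=> _ _; rewrite integral0.
apply: L2_span_lim => // e e0.
have [n _ /(_ n (leqnn n)) gn] : \forall n \near \oo,
    (\int[mu]_x ((h x - g n x) ^+ 2)%:E < e%:E)%E.
  exact: cvge0_near_lt cvg0 e0.
exists (fun x => (g n x)%:C); split.
- exact: cmeasurable_real.
- rewrite (_ : (fun x => _) = (fun x => \sum_(y <- finmap.enum_fset (fset_set (range (g n))))
      y%:C * (\1_((g n) @^-1` [set y]) x)%:C)); last first.
    apply/funext => x; rewrite [in LHS](fimfunE (g n) x) fsbig_finite//=.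
    by rewrite rmorph_sum; apply: eq_bigr => y _; rewrite rmorphM.
  have mpre y : measurable ((g n) @^-1` [set y]).
    by rewrite -[X in measurable X]setTI; exact: measurable_funP.
  apply: L2_span_sum => // y.
    exact/cmeasurableZ/cmeasurable_indic.
  (* the level set of 0 may have infinite measure, but its coefficient is 0 *)
  have [->|y0] := eqVneq y 0.
    by under eq_fun do rewrite mul0r; exact: L2_span0.
  apply: L2_spanZ => //; first exact: cmeasurable_indic.
  apply: L2_span_indic; split => //.
  have hL : inL2 mu (fun x => (h x)%:C).
    by apply/inL2P; split => //; exact: cmeasurable_real.
  have : inL2 mu (fun x => y%:C * (\1_((g n) @^-1` [set y]) x)%:C).
    apply: (inL2_le _ hL); first exact/cmeasurableZ/cmeasurable_indic.
    move=> x; rewrite normcM normc_indic !normcR indicE (ger0_norm (h0 x)).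
    have [|_] := boolP (x \in _); last by rewrite mulr0.
    by move=> /set_mem /= <-; rewrite mulr1 ger0_norm ?gh.
  move=> /inL2P[_]; rewrite energyZ ?energy_indic//; last exact: cmeasurable_indic.
  rewrite normR !ltey; apply: contra => /eqP ->.
  by rewrite gt0_muley// lte_fin exprn_even_gt0.
- by under [X in (X < _)%E]eq_integral do rewrite -rmorphB normR.
Qed.

Lemma inL2_span f : inL2 mu f -> L2_span finite_measurable f.
Proof.
move=> fL; have [mRe mIm] := inL2_measurable fL.
have part (h : T -> R) : measurable_fun setT h ->
    (forall x, `|h x| <= normc (f x)) ->
    L2_span finite_measurable (fun x => (h x)%:C).
  move=> mh hf.
  pose hp x := (`|h x| + h x) / 2; pose hm x := (`|h x| - h x) / 2.
  have mn : measurable_fun setT (fun x => `|h x|) by exact: measurableT_comp.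
  have mp : measurable_fun setT hp.
    by apply: measurable_funM => //; exact: measurable_funD.
  have mm : measurable_fun setT hm.
    by apply: measurable_funM => //; exact: measurable_funB.
  have hp0 x : 0 <= hp x <= `|h x|.
    rewrite /hp; have := ler_norm (h x); have := ler_norm (- h x).
    by rewrite normrN => ? ?; apply/andP; split; lra.
  have hm0 x : 0 <= hm x <= `|h x|.
    rewrite /hm; have := ler_norm (h x); have := ler_norm (- h x).
    by rewrite normrN => ? ?; apply/andP; split; lra.
  have hE : (fun x => (h x)%:C) = (fun x => (hp x)%:C + (-1) * (hm x)%:C).
    apply/funext => x; rewrite mulN1r -rmorphB; congr (_ %:C).
    by rewrite /hp /hm; field.
  have bounded (k : T -> R) : measurable_fun setT k ->
      (forall x, 0 <= k x <= `|h x|) -> L2_span finite_measurable (fun x => (k x)%:C).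
    move=> mk k0; apply: nneg_span => //; first by move=> x; case/andP: (k0 x).
    have /inL2P[] // : inL2 mu (fun x => (k x)%:C).
    apply: (inL2_le _ fL); first exact: cmeasurable_real.
    move=> x; rewrite normcR; case/andP: (k0 x) => kx kh.
    by rewrite ger0_norm// (le_trans kh).
  rewrite hE; apply: L2_spanD => //.
  - exact/cmeasurableZ/cmeasurable_real.
  - exact: bounded.
  - by apply: L2_spanZ => //; exact: bounded.
have -> : f = (fun x => (complex.Re (f x))%:C + 'i%C * (complex.Im (f x))%:C).
  by apply/funext => x; exact: complexE.
apply: L2_spanD => //.
- exact/cmeasurableZ/cmeasurable_real.
- by apply: part => // x; exact: Re_le_normc.
- apply: L2_spanZ => //.
  by apply: part => // x; exact: Im_le_normc.
Qed.

End L2_span.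

(** * Completeness of the space of square-integrable functions *)

Section geometric.
Context (R : realType).

(** Adding and subtracting twice the remaining geometric tail makes the sequence
    monotone, which gives both the limit and the rate. *)
Lemma geometric_cvg (a : nat -> R) (K : R) : 0 <= K ->
  (forall n, `|a n.+1 - a n| <= K * 2^-1 ^+ n) ->
  exists l, a @ \oo --> l /\ forall n, `|l - a n| <= 2 * K * 2^-1 ^+ n.
Proof.
move=> K0 aK.
have half n : 2^-1 ^+ n.+1 = 2^-1 ^+ n / 2 :> R by rewrite exprSr.
pose b n := a n + 2 * K * 2^-1 ^+ n; pose c n := a n - 2 * K * 2^-1 ^+ n.
have bN : nonincreasing_seq b.
  apply/nonincreasing_seqP => n; rewrite /b half.
  have := aK n; rewrite ler_norml => /andP[_]; lra.
have cN : nondecreasing_seq c.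
  apply/nondecreasing_seqP => n; rewrite /c half.
  have := aK n; rewrite ler_norml => /andP[]; lra.
have pow0 : (fun n => 2 * K * 2^-1 ^+ n) @ \oo --> (0 : R).
  rewrite -(mulr0 (2 * K)); apply: cvgMr; apply: cvg_expr.
  by rewrite ger0_norm// invf_lt1// ltr1n.
have cb n : c n <= b n.
  have : 0 <= 2 * K * 2^-1 ^+ n by rewrite !mulr_ge0// exprn_ge0// invr_ge0.
  rewrite /c /b; lra.
have bcvg : cvgn b.
  apply: nonincreasing_is_cvgn => //; exists (c 0%N) => _ [n _ <-].
  by apply: le_trans (cb n); exact: cN.
pose l := limn b.
have bl : b @ \oo --> l by [].
have al : a @ \oo --> l.
  rewrite -(subr0 l) (_ : a = (fun n => b n - 2 * K * 2^-1 ^+ n)).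
    exact: cvgB.
  by apply/funext => n; rewrite /b addrK.
have cl : c @ \oo --> l.
  by rewrite -(subr0 l); apply: cvgB.
exists l; split => // n.
have lb : l <= b n by exact: nonincreasing_cvgn_ge.
have lc : c n <= l.
  rewrite -(cvg_lim _ cl)//; apply: nondecreasing_cvgn_le => //.
  by apply/cvg_ex; exists l.
by rewrite ler_norml; move: lb lc; rewrite /b /c; lra.
Qed.

End geometric.

Section riesz_fischer.
Context d (T : measurableType d) (R : realType).
Variable mu : {measure set T -> \bar R}.

(** The function [G], the sum of [4^n |u_(n+1) - u_n|^2], is integrable, hence
    finite almost everywhere; there the increments are at most
    [sqrt G * 2^-n], so the sequence converges pointwise with the error
    bound [8 * 4^-n * G], which can be integrated. *)
Lemma riesz_fischer (u : nat -> T -> R[i]) :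
  (forall n, inL2 mu (u n)) ->
  (forall n, (energy mu (fun x => (u n.+1 x - u n x)%R) <= ((16^-1) ^+ n)%:E)%E) ->
  exists g, inL2 mu g /\ (fun n => energy mu (fun x => g x - u n x)) @ \oo --> 0%E.
Proof.
move=> uL ufast.
pose D n x : \bar R := ((4 ^+ n)%:E * (normc (u n.+1 x - u n x) ^+ 2)%:E)%E.
have D0 n x : (0 <= D n x)%E by rewrite /D -EFinM lee_fin mulr_ge0 ?sqr_ge0 ?exprn_ge0.
have muu n : cmeasurable (fun x => u n.+1 x - u n x).
  by apply: inL2_measurable; exact: inL2B.
have mD n : measurable_fun setT (D n).
  by apply: measurable_funeM; exact: measurable_normc_sqr.
pose G x := (\sum_(n <oo) D n x)%E.
have mG : measurable_fun setT G by exact: ge0_emeasurable_sum.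
have G0 x : (0 <= G x)%E by exact: nneseries_ge0.
have Goo : (\int[mu]_x G x < +oo)%E.
  rewrite integral_nneseries//.
  apply: (@le_lt_trans _ _ (\sum_(n <oo) ((1 / 4 ^+ n)%:E : \bar R))%E).
    apply: lee_nneseries => [n _ _|n _]; first by apply: integral_ge0 => x _; exact: D0.
    rewrite ge0_integralZl_EFin//; last 2 first.
    - by move=> x _; rewrite lee_fin sqr_ge0.
    - exact: measurable_normc_sqr.
    apply: le_trans (lee_wpmul2l _ (ufast n)) _; first by rewrite lee_fin exprn_ge0.
    rewrite -EFinM lee_fin -exprMn (_ : 4 * 16^-1 = 4^-1); last by field.
    by rewrite exprVn mul1r.
  apply: (@le_lt_trans _ _ (\sum_(n <oo) ((2 / (2 ^ (n + 1))%:R)%:E : \bar R))%E).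
    apply: lee_nneseries => [n _ _|n _]; first by rewrite lee_fin divr_ge0 ?exprn_ge0.
    rewrite lee_fin.
    rewrite addn1 expnS natrM invfM mulrA divff// !mul1r natrX.
    rewrite lef_pV2 ?posrE ?exprn_gt0//.
    by apply: lerXn2r; rewrite ?nnegrE//; lra.
  by rewrite (cvg_lim _ (@cvg_geometric_eseries_half R 2 0))// ltry.
have iG : mu.-integrable setT G.
  apply/integrableP; split => //.
  by under eq_integral do rewrite gee0_abs//.
pose K := [set x | (G x < +oo)%E].
have mK : measurable K.
  by rewrite /K -[X in measurable X]setTI; apply: emeasurable_fun_infty_o.
pose v n := restr K (u n).
have vE n x : K x -> v n x = u n x by move=> Kx; rewrite /v /restr indicE mem_set// mul1r.
have v0 n x : ~ K x -> v n x = 0 by move=> Kx; rewrite /v /restr indicE memNset// mul0r.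
pose S x := Num.sqrt (fine (G x)).
have S0 x : 0 <= S x by exact: sqrtr_ge0.
have vfast x n : normc (v n.+1 x - v n x) <= S x * 2^-1 ^+ n.
  have [Kx|Kx] := pselect (K x); last first.
    by rewrite !v0// subrr normc0 mulr_ge0// exprn_ge0// invr_ge0.
  have Gfin : G x \is a fin_num by rewrite ge0_fin_numE.
  rewrite !vE// -ler_sqr ?nnegrE ?normc_ge0 ?mulr_ge0 ?exprn_ge0 ?invr_ge0//.
  rewrite exprMn sqr_sqrtr ?fine_ge0// -exprM mulnC exprM (_ : 2^-1 ^+ 2 = 4^-1 :> R).
    rewrite exprVn ler_pdivlMr ?exprn_gt0// mulrC -lee_fin fineK// EFinM.
    apply: (@le_trans _ _ (\sum_(0 <= i < n.+1) D i x)%E).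
      by rewrite big_nat_recr//= leeDr// sume_ge0.
    exact: nneseries_lim_ge.
  by rewrite exprVn -natrX.
have mv n : cmeasurable (v n).
  by apply: cmeasurable_restr => //; exact: inL2_measurable.
have cvgRe x : exists l, (fun n => complex.Re (v n x)) @ \oo --> l /\
    forall n, `|l - complex.Re (v n x)| <= 2 * S x * 2^-1 ^+ n.
  apply: geometric_cvg => // n; apply: le_trans (vfast x n).
  apply: le_trans (Re_le_normc _).
  by case: (v n.+1 x) (v n x) => ? ? [].
have cvgIm x : exists l, (fun n => complex.Im (v n x)) @ \oo --> l /\
    forall n, `|l - complex.Im (v n x)| <= 2 * S x * 2^-1 ^+ n.
  apply: geometric_cvg => // n; apply: le_trans (vfast x n).
  apply: le_trans (Im_le_normc _).
  by case: (v n.+1 x) (v n x) => ? ? [].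
pose g x := sval (cid (cvgRe x)) +i* sval (cid (cvgIm x)).
have mg : cmeasurable g.
  split; rewrite /g /=.
  - apply: (@measurable_fun_cvg _ _ _ _ (fun n x => complex.Re (v n x))).
      by move=> n; exact: (mv n).1.
    by move=> x _; case: cid => /= l [].
  - apply: (@measurable_fun_cvg _ _ _ _ (fun n x => complex.Im (v n x))).
      by move=> n; exact: (mv n).2.
    by move=> x _; case: cid => /= l [].
have gv n x : K x -> normc (g x - v n x) ^+ 2 <= 8 * 4^-1 ^+ n * fine (G x).
  move=> Kx; rewrite normc_sqr.
  have -> : complex.Re (g x - v n x) = sval (cid (cvgRe x)) - complex.Re (v n x).
    by rewrite /g; case: (v n x).
  have -> : complex.Im (g x - v n x) = sval (cid (cvgIm x)) - complex.Im (v n x).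
    by rewrite /g; case: (v n x).
  have -> : 8 * 4^-1 ^+ n * fine (G x) =
      (2 * S x * 2^-1 ^+ n) ^+ 2 + (2 * S x * 2^-1 ^+ n) ^+ 2.
    rewrite !exprMn sqr_sqrtr ?fine_ge0// -exprM mulnC exprM.
    rewrite (_ : 2^-1 ^+ 2 = 4^-1 :> R); last by rewrite exprVn -natrX.
    by ring.
  have bound (a : R) (b : R) : `|a| <= b -> a ^+ 2 <= b ^+ 2.
    move=> ab; rewrite -(real_normK (num_real a)).
    by rewrite ler_sqr// nnegrE (le_trans _ ab).
  by apply: lerD; apply: bound; case: cid => l /= [].
have Kae : \forall x \ae mu, K x.
  have := integrable_ae measurableT iG; apply: filterS => x /(_ I).
  by rewrite ge0_fin_numE.
have mun n : cmeasurable (u n) by exact: inL2_measurable.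
have gun n : (energy mu (fun x => (g x - u n x)%R) <=
    (8 * 4^-1 ^+ n)%:E * \int[mu]_x G x)%E.
  have c0 : 0 <= 8 * 4^-1 ^+ n :> R by rewrite mulr_ge0// exprn_ge0// invr_ge0.
  rewrite -ge0_integralZl_EFin//.
  apply: ae_ge0_le_integral => //.
  - by move=> x _; rewrite lee_fin sqr_ge0.
  - by apply: measurable_normc_sqr; exact: cmeasurableB.
  - by move=> x _; apply: mule_ge0.
  - exact: measurable_funeM.
  - move: Kae; apply: filterS => x Kx _.
    have Gfin : G x \is a fin_num by rewrite ge0_fin_numE.
    by rewrite -(fineK Gfin) -EFinM lee_fin -(vE n x Kx) gv.
have gu0 : (fun n => energy mu (fun x => g x - u n x)) @ \oo --> 0%E.
  apply: (@squeeze_cvge _ _ _ _ (cst 0%E) _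
    (fun n => (8 * 4^-1 ^+ n)%:E * \int[mu]_x G x)%E).
  - by apply: nearW => n; rewrite gun energy_ge0.
  - exact: cvg_cst.
  - have IG : (\int[mu]_x G x \is a fin_num)%E.
      by rewrite ge0_fin_numE// integral_ge0.
    rewrite -(fineK IG).
    under eq_fun do rewrite -EFinM.
    apply: cvg_EFin; first exact: nearW.
    rewrite -[X in _ --> X](mul0r (fine (\int[mu]_x G x)%E)).
    apply: cvgMl; rewrite -[X in _ --> X](mulr0 8); apply: cvgMr.
    by apply: cvg_expr; rewrite ger0_norm ?invr_ge0// invf_lt1// ltr1n.
exists g; split => //.
have [n _ /(_ n (leqnn n)) gn] := cvge0_near_lt gu0 ltr01.
rewrite (_ : g = (fun x => (g x - u n x) + u n x)); last first.
  by apply/funext => x; rewrite subrK.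
apply: inL2D => //; apply/inL2P; split; first exact: cmeasurableB.
by apply: lt_trans gn (ltry _).
Qed.

End riesz_fischer.

(** * Existence of spectral integrals *)

Lemma le_cLnorm2_energy (R : realType) d d' (T : measurableType d) (T' : measurableType d')
    (mu : {measure set T -> \bar R}) (mu' : {measure set T' -> \bar R})
    (f : T -> R[i]) (g : T' -> R[i]) :
  (cLnorm mu 2%:E f <= cLnorm mu' 2%:E g)%E -> (energy mu f <= energy mu' g)%E.
Proof.
rewrite -!cLnorm2_sqr => fg; apply: gt0_ler_poweR => //.
- by rewrite in_itv /= leey cLnorm_ge0.
- by rewrite in_itv /= leey cLnorm_ge0.
Qed.

Section spectral_integral_existence.
Context d (T : measurableType d) (R : realType).
Variable mu : {measure set T -> \bar R}.
Context d' (S : measurableType d').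
Variable E : set S -> (T -> R[i]) -> (T -> R[i]).
Hypothesis specE : spectral_decomposition mu E.

Definition spectral_step (f : T -> R[i]) n (c : 'I_n -> R[i]) (A : 'I_n -> set S) :
  T -> R[i] := fun x => \sum_(i < n) c i * E (A i) f x.

(** The Gram matrices of the vectors [E (A i) f] and of the indicators of the
    [A i] in [L^2(nu)] are both given by [nu (A i `&` A j)]. *)
Lemma spectral_isometryB f (nu : {measure set S -> \bar R})
    n (c : 'I_n -> R[i]) (A : 'I_n -> set S) m (b : 'I_m -> R[i]) (B : 'I_m -> set S) :
  inL2 mu f -> spectral_distribution mu E f nu ->
  (forall i, measurable (A i)) -> (forall i, measurable (B i)) ->
  energy mu (fun x => spectral_step f c A x - spectral_step f b B x) =
  energy nu (fun s => step_fun c A s - step_fun b B s).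
Proof.
move=> fL nuE mA mB.
pose c' (i : 'I_n + 'I_m) := match i with inl j => c j | inr j => - b j end.
pose A' (i : 'I_n + 'I_m) := match i with inl j => A j | inr j => B j end.
have mA' i : measurable (A' i) by case: i.
have := spectral_isometry specE (map inl (index_enum 'I_n) ++ map inr (index_enum 'I_m))
  c' fL nuE mA'.
under [X in energy mu X]eq_fun do
  (rewrite big_cat !big_map /=; under [X in _ + X]eq_bigr do rewrite mulNr; rewrite sumrN).
under [X in energy nu X]eq_fun do
  (rewrite big_cat !big_map /=; under [X in _ + X]eq_bigr do rewrite mulNr; rewrite sumrN).
by [].
Qed.

(** The Gram matrices of the vectors [E (A i) f] and of the indicators of the
    [A i] in [L^2(nu)] are both given by [nu (A i `&` A j)]. *)
Lemma spectral_isometry_step f (nu : {measure set S -> \bar R})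
    n (c : 'I_n -> R[i]) (A : 'I_n -> set S) :
  inL2 mu f -> spectral_distribution mu E f nu -> (forall i, measurable (A i)) ->
  energy mu (spectral_step f c A) = energy nu (step_fun c A).
Proof. by move=> fL nuE mA; exact: spectral_isometry. Qed.

Lemma spectral_measureP f (fL : inL2 mu f) :
  spectral_distribution mu E f (spectral_finite_measure specE fL).
Proof. by move=> A mA; rewrite cLnorm2_sqr. Qed.

(** Take step functions converging fast to [phi] in [L^2(nu)]. Their images are
    Cauchy by the isometry, and [riesz_fischer] provides the value. An
    operator norm counts a vector outside of the domain as [+oo], so existence
    is a part of every upper bound. *)
Lemma spectral_integral_exists f (fL : inL2 mu f) (phi : S -> R[i]) :
  inL2 (spectral_finite_measure specE fL) phi ->
  exists g, spectral_integral mu E phi f g /\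
    (energy mu g <= energy (spectral_finite_measure specE fL) phi)%E.
Proof.
set nu := spectral_finite_measure specE fL => phiL.
have mphi := inL2_measurable phiL.
have nuP : spectral_distribution mu E f nu by exact: spectral_measureP.
(* the division by 4 pays for the constant 2 of [energyD], twice *)
pose delta (k : nat) : R := 16^-1 ^+ k / 4.
have delta0 k : 0 < delta k by rewrite divr_gt0// exprn_gt0.
have /choice[F FP] : forall k, exists p : {n : nat & (('I_n -> R[i]) * ('I_n -> set S))%type},
    (forall i, measurable ((projT2 p).2 i)) /\
    (energy nu (fun s => (phi s - step_fun (projT2 p).1 (projT2 p).2 s)%R) < (delta k)%:E)%E.
  move=> k; have [n [c [A [mA h]]]] := inL2_span phiL (delta0 k).
  by exists (existT _ n (c, A)); split => //= i; case: (mA i).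
pose s k := step_fun (projT2 (F k)).1 (projT2 (F k)).2.
pose u k := spectral_step f (projT2 (F k)).1 (projT2 (F k)).2.
have ms k : cmeasurable (s k) by apply: cmeasurable_step => i; exact: (FP k).1.
have sphi k : (energy nu (fun x => (phi x - s k x)%R) < (delta k)%:E)%E by exact: (FP k).2.
have uL k : inL2 mu (u k).
  by apply: inL2_sum => i; apply: inL2Z; apply: (sd_L2 specE) => //; exact: (FP k).1.
have ufast k : (energy mu (fun x => (u k.+1 x - u k x)%R) <= (16^-1 ^+ k)%:E)%E.
  rewrite (spectral_isometryB _ _ fL nuP) ; [|exact: (FP _).1|exact: (FP _).1].
  apply: ltW; rewrite -/(s k) -/(s k.+1).
  rewrite (_ : (fun x => _) = (fun x => (phi x - s k x) + - (phi x - s k.+1 x))).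
    apply: energyD_lt.
    - exact: cmeasurableB.
    - by apply: cmeasurableN; exact: cmeasurableB.
    - exact: sphi.
    - rewrite energyN; apply: lt_le_trans (sphi _) _.
      rewrite lee_fin ler_pM2r ?invr_gt0// exprS ler_piMl ?exprn_ge0//.
      by rewrite invf_le1//; lra.
  by apply/funext => x; rewrite opprD opprK addrACA subrr add0r addrC.
have [g [gL gu]] := riesz_fischer uL ufast.
have delta_cvg : (fun k => delta k) @ \oo --> 0.
  rewrite -[X in _ --> X](mul0r 4^-1); apply: cvgMl.
  by apply: cvg_expr; rewrite ger0_norm ?invr_ge0// invf_lt1//; lra.
have close (e : R) : 0 < e -> exists k,
   (cLnorm nu 2%:E (fun x => (phi x - s k x)%R) < e%:E)%E /\
   (cLnorm mu 2%:E (fun x => (g x - u k x)%R) < e%:E)%E.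
  move=> e0; have e20 : 0 < e ^+ 2 by rewrite exprn_gt0.
  have de : \forall k \near \oo, delta k < e ^+ 2.
    move/cvgrPdist_lt : delta_cvg => /(_ _ e20).
    apply: filterS => k; rewrite sub0r normrN; exact: le_lt_trans (ler_norm _).
  have [k _ /(_ k (leqnn k))[h1 h2]] := filterI (cvge0_near_lt gu e20) de.
  exists k; rewrite !cLnorm2_lt; [|exact: ltW|exact: ltW]; split => //.
  by apply: lt_le_trans (sphi k) _; rewrite lee_fin ltW.
exists g; split.
  split => //; exists nu => // e e0; have [k [h1 h2]] := close e e0.
  exists (projT1 (F k)), (projT2 (F k)).1, (projT2 (F k)).2; split => //.
  exact: (FP k).1.
apply: le_cLnorm2_energy; apply/lee_addgt0Pr => e e0.
have e20 : 0 < e / 2 by rewrite divr_gt0.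
have [k [h1 h2]] := close _ e20.
have uE : cLnorm mu 2%:E (u k) = cLnorm nu 2%:E (s k).
  by rewrite !cLnorm2E (spectral_isometry_step _ fL nuP)//; exact: (FP k).1.
rewrite (_ : g = (fun x => (g x - u k x) + u k x)); last first.
  by apply/funext => x; rewrite subrK.
have l12 : 1 <= 2 :> R by rewrite ler1n.
apply: le_trans (cLnormD _ l12 _ _) _.
- exact: (inL2_measurable (inL2B gL (uL k))).
- exact: (inL2_measurable (uL k)).
rewrite uE (_ : s k = (fun x => phi x + - (phi x - s k x))); last first.
  by apply/funext => x; rewrite opprB addrCA subrr addr0.
apply: (@le_trans _ _ ((e / 2)%:E + (cLnorm nu 2%:E phi + (e / 2)%:E))%E).
  apply: leeD; first exact: ltW.
  apply: le_trans (cLnormD _ l12 _ _) _ => //.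
    by apply: cmeasurableN; exact: cmeasurableB.
  apply: leeD => //; apply: ltW.
  by rewrite cLnorm2E energyN -cLnorm2E.
by rewrite addeCA -EFinD -splitr.
Qed.

End spectral_integral_existence.

(** * Comparison of measures through rectangles *)

Section measure_comparison.
Context d1 d2 (T1 : measurableType d1) (T2 : measurableType d2) (R : realType).

(** A finite union of rectangles, presented as the sets that depend only on the
    cells of one finite measurable partition of each factor. In this form
    Boolean operations act on the condition [P] alone, once the two partitions
    are refined. *)
Definition grid (C : set (T1 * T2)) := exists (I J : finType) (f : T1 -> I)
  (g : T2 -> J) (P : I -> J -> bool),
  [/\ forall i, measurable (f @^-1` [set i]), forall j, measurable (g @^-1` [set j])
    & C = [set z | P (f z.1) (g z.2)]].

Let grid2 (op : bool -> bool -> bool) (A B : set (T1 * T2)) : grid A -> grid B ->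
  exists2 C, grid C & forall z, C z <-> op `[< A z >] `[< B z >].
Proof.
move=> [I [J [f [g [P [mf mg ->]]]]]] [I' [J' [f' [g' [P' [mf' mg' ->]]]]]].
exists [set z | op (P (f z.1) (g z.2)) (P' (f' z.1) (g' z.2))]; last first.
  by move=> z /=; rewrite !asboolb.
exists (I * I')%type, (J * J')%type, (fun x => (f x, f' x)), (fun x => (g x, g' x)),
  (fun i j => op (P i.1 j.1) (P' i.2 j.2)); split => //.
- move=> [i i']; rewrite (_ : _ @^-1` _ = f @^-1` [set i] `&` f' @^-1` [set i']).
    exact: measurableI.
  by apply/seteqP; split => x /= [-> ->].
- move=> [i i']; rewrite (_ : _ @^-1` _ = g @^-1` [set i] `&` g' @^-1` [set i']).
    exact: measurableI.
  by apply/seteqP; split => x /= [-> ->].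
Qed.

Lemma grid_setring : setring grid.
Proof.
split.
- exists unit, unit, (fun=> tt), (fun=> tt), (fun _ _ => false); split => //.
  + by move=> i; rewrite (_ : _ @^-1` _ = setT)//; apply/seteqP; split => // x _; case: i.
  + by move=> i; rewrite (_ : _ @^-1` _ = setT)//; apply/seteqP; split => // x _; case: i.
  + by apply/seteqP; split.
- move=> A B gA gB; have [C gC CE] := grid2 orb gA gB.
  rewrite (_ : A `|` B = C)//; apply/seteqP; split => z.
    by move=> ABz; apply/CE; apply/orP; case: ABz => ?; [left|right]; exact/asboolP.
  by move=> /CE/orP[/asboolP|/asboolP]; [left|right].
- move=> A B gA gB; have [C gC CE] := grid2 (fun a b => a && ~~ b) gA gB.
  rewrite (_ : A `\` B = C)//; apply/seteqP; split => z.
    by move=> [Az Bz]; apply/CE; rewrite asboolT//= asboolF.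
  by move=> /CE/andP[/asboolP ? /asboolPn].
Qed.

Lemma grid_rectangle A B : measurable A -> measurable B -> grid (A `*` B).
Proof.
move=> mA mB; exists bool, bool, (fun x => x \in A), (fun x => x \in B), andb; split.
- move=> [].
    rewrite (_ : _ @^-1` _ = A)//; apply/seteqP; split => x /=; first exact: set_mem.
    exact: mem_set.
  rewrite (_ : _ @^-1` _ = ~` A); first exact: measurableC.
  apply/seteqP; split => x /=; last exact: memNset.
  by move=> + Ax; rewrite mem_set.
- move=> [].
    rewrite (_ : _ @^-1` _ = B)//; apply/seteqP; split => x /=; first exact: set_mem.
    exact: mem_set.
  rewrite (_ : _ @^-1` _ = ~` B); first exact: measurableC.
  apply/seteqP; split => x /=; last exact: memNset.
  by move=> + Ax; rewrite mem_set.
- apply/seteqP; split => z /=; first by move=> [za zb]; rewrite !mem_set.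
  by move=> /andP[/set_mem ? /set_mem ?].
Qed.

Lemma measurable_grid : @measurable _ (T1 * T2)%type `<=` <<sr grid >>.
Proof.
rewrite measurable_prod_measurableType; apply: smallest_sub.
  have [s0 sD sU] := smallest_sigma_ring grid; split => // A gA.
  apply: sD => //; apply: sub_gen_smallest.
  by rewrite -setXTT; exact: grid_rectangle.
by move=> _ [A mA] [B mB] <-; apply: sub_gen_smallest; exact: grid_rectangle.
Qed.

Variables nu m : {measure set (T1 * T2)%type -> \bar R}.
Hypotheses (nu_fin : (nu setT < +oo)%E) (m_fin : (m setT < +oo)%E).
Hypothesis num : forall A B, measurable A -> measurable B ->
  (nu (A `*` B) <= m (A `*` B))%E.

Let grid_le C : grid C -> measurable C /\ (nu C <= m C)%E.
Proof.
move=> [I [J [f [g [P [mf mg ->]]]]]].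
pose D := [set` [pred p : I * J | P p.1 p.2]].
pose F (p : I * J) := f @^-1` [set p.1] `*` g @^-1` [set p.2].
have -> : [set z | P (f z.1) (g z.2)] = \bigcup_(p in D) F p.
  apply/seteqP; split => z /=.
    by move=> Pz; exists (f z.1, g z.2).
  by move=> [[i j]] /= Pij [/= -> ->].
have fD : finite_set D by exact: finite_finpred.
have mF p : measurable (F p) by apply: measurableX; [exact: mf|exact: mg].
have tF : trivIset D F.
  move=> [i j] [i' j'] _ _ [z [[/= fi gj] [/= fi' gj']]].
  by rewrite -fi -gj fi' gj'.
split; first by apply: fin_bigcup_measurable => // p _; exact: mF.
rewrite !measure_fin_bigcup//; apply: lee_fsum => // p _.
by apply: num; [exact: mf|exact: mg].
Qed.

(** Grids are finite disjoint unions of rectangles, so the inequality holds for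
    them; it passes to monotone limits because both measures are finite, and
    the grids form a ring that generates the product sigma-algebra. *)
Lemma measure_le_rectangles C : measurable C -> (nu C <= m C)%E.
Proof.
move=> mC.
have mono : monotone [set C | measurable C /\ (nu C <= m C)%E].
  split.
  - move=> F Fnd FG; have mU : measurable (\bigcup_n F n).
      by apply: bigcupT_measurable => n; case: (FG n).
    split => //.
    have hnu := nondecreasing_cvg_mu (mu := nu) (fun n => (FG n).1) mU Fnd.
    have hm := nondecreasing_cvg_mu (mu := m) (fun n => (FG n).1) mU Fnd.
    by apply: (lee_cvg_to hnu hm); apply: nearW => n; exact: (FG n).2.
  - move=> F Fni FG; have mU : measurable (\bigcap_n F n).
      by apply: bigcapT_measurable => n; case: (FG n).
    split => //.
    have F0 (mm : {measure set (T1 * T2)%type -> \bar R}) :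
        (mm setT < +oo)%E -> (mm (F 0%N) < +oo)%E.
      by apply: le_lt_trans; apply: le_measure => //; rewrite inE//; exact: (FG 0%N).1.
    have hnu := nonincreasing_cvg_mu (F0 nu nu_fin) (fun n => (FG n).1) mU Fni.
    have hm := nonincreasing_cvg_mu (F0 m m_fin) (fun n => (FG n).1) mU Fni.
    by apply: (lee_cvg_to hnu hm); apply: nearW => n; exact: (FG n).2.
by have [] := monotone_setring_sub_g_sigma_ring mono grid_setring grid_le
  (measurable_grid mC).
Qed.

End measure_comparison.

Lemma ae_and d (T : measurableType d) (R : realType)
    (mu : {measure set T -> \bar R}) (P Q : T -> Prop) :
  {ae mu, forall x, P x} -> {ae mu, forall x, Q x} ->
  {ae mu, forall x, P x /\ Q x}.
Proof. by apply: filterS2. Qed.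

Lemma indic_in (R : realType) (T : Type) (A : set T) x : A x -> \1_A x = 1 :> R.
Proof. by move=> Ax; rewrite indicE mem_set. Qed.

Lemma indic_out (R : realType) (T : Type) (A : set T) x : ~ A x -> \1_A x = 0 :> R.
Proof. by move=> Ax; rewrite indicE memNset. Qed.

(** * Contractions acting slicewise on a product *)

Section L2_span_sets.
Context d (T : measurableType d) (R : realType).
Variable mu : {measure set T -> \bar R}.
Implicit Types (G : set (set T)) (A B : set T).

Lemma energy_indicD A B : measurable A -> measurable B -> B `<=` A ->
  energy mu (fun x => (\1_A x)%:C - (\1_B x)%:C) = mu (A `\` B).
Proof.
move=> mA mB BA; rewrite -energy_indic; last exact: measurableD.
congr energy; apply/funext => x; rewrite -rmorphB; congr (_%:C); rewrite !indicE.
have [xB|xB] := boolP (x \in B).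
  rewrite (mem_set (BA _ (set_mem xB))) subrr memNset//.
  by move=> [_]; apply; exact: set_mem.
suff -> : (x \in A `\` B) = (x \in A) by rewrite subr0.
apply/idP/idP => [/set_mem [xA _]|/set_mem xA]; first exact: mem_set.
by apply: mem_set; split => // /mem_set; exact/negP.
Qed.

(** Continuity of the finite measure [mu] from above, applied to [C `\` F n]. *)
Lemma L2_span_nondecreasing G (F : nat -> set T) C : G `<=` measurable ->
  measurable C -> (mu C < +oo)%E -> (forall n, measurable (F n)) ->
  (forall n, F n `<=` C) -> {homo F : n m / (n <= m)%N >-> n `<=` m} ->
  C `<=` \bigcup_n F n ->
  (forall n, L2_span mu G (fun x => (\1_(F n) x)%:C)) ->
  L2_span mu G (fun x => (\1_C x)%:C).
Proof.
move=> GM mC Coo mF FC Fnd CF sF; apply: L2_span_lim => //.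
  exact: cmeasurable_indic.
move=> e e0.
have D0 : mu (C `\` F n) @[n --> \oo] --> 0%E.
  have -> : 0%E = mu (\bigcap_n (C `\` F n)).
    rewrite -(measure0 mu); congr (mu _); apply/esym/seteqP; split => // x xn.
    have [n _ Fnx] : (\bigcup_n F n) x by apply: CF; case: (xn 0%N I).
    by have [] := xn n I.
  apply: nonincreasing_cvg_mu.
  - apply: le_lt_trans Coo; apply: le_measure => //.
    + by apply: mem_set; exact: measurableD.
    + exact: mem_set.
  - by move=> n; exact: measurableD.
  - by apply: bigcapT_measurable => n; exact: measurableD.
  - by move=> n m nm; apply/subsetPset; apply: setDS; exact: Fnd.
have [n _ /(_ n (leqnn n)) hn] := cvge0_near_lt D0 e0.
exists (fun x => (\1_(F n) x)%:C); split => //; first exact: cmeasurable_indic.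
by rewrite energy_indicD.
Qed.

End L2_span_sets.

Section rectangles.
Context d1 d2 (T1 : measurableType d1) (T2 : measurableType d2) (R : realType).
Variables (mu1 : {sigma_finite_measure set T1 -> \bar R})
          (mu2 : {sigma_finite_measure set T2 -> \bar R}).
Local Notation mu := (mu1 \x mu2)%E.

Definition finite_rectangle : set (set (T1 * T2)) := [set C | exists A B,
  [/\ measurable A, (mu1 A < +oo)%E, measurable B, (mu2 B < +oo)%E & C = A `*` B]].

Lemma finite_rectangle_measurable : finite_rectangle `<=` measurable.
Proof. by move=> _ [A [B [mA _ mB _ ->]]]; exact: measurableX. Qed.

Lemma finite_rectangle_lty C : finite_rectangle C -> (mu C < +oo)%E.
Proof.
move=> [A [B [mA A1 mB B1 ->]]].
by rewrite product_measure1E// lte_mul_pinfty// ge0_fin_numE.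
Qed.

Let rM := finite_rectangle_measurable.

Let box_span (K1 : set T1) (K2 : set T2) (C : set (T1 * T2)) :
  measurable K1 -> (mu1 K1 < +oo)%E -> measurable K2 -> (mu2 K2 < +oo)%E ->
  measurable C ->
  L2_span mu finite_rectangle (fun z => (\1_(C `&` (K1 `*` K2)) z)%:C).
Proof.
move=> mK1 K1oo mK2 K2oo.
have mK : measurable (K1 `*` K2) by exact: measurableX.
have Koo : (mu (K1 `*` K2) < +oo)%E.
  rewrite product_measure1E// lte_mul_pinfty// ge0_fin_numE//.
pose H := [set C : set (T1 * T2) | measurable C /\
  L2_span mu finite_rectangle (fun z => (\1_(C `&` (K1 `*` K2)) z)%:C)].
pose G := [set A `*` B | A in @measurable _ T1 & B in @measurable _ T2].
have subI C' : measurable C' -> (mu (C' `&` (K1 `*` K2)) < +oo)%E.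
  move=> mC'; apply: le_lt_trans Koo; apply: le_measure => //.
  - by apply: mem_set; exact: measurableI.
  - exact: mem_set.
have rectI A B : measurable A -> measurable B ->
    L2_span mu finite_rectangle (fun z => (\1_((A `*` B) `&` (K1 `*` K2)) z)%:C).
  move=> mA mB; apply: L2_span_indic; exists (A `&` K1), (B `&` K2); split => //.
  - exact: measurableI.
  - by apply: le_lt_trans K1oo; apply: le_measure => //; apply: mem_set => //; exact: measurableI.
  - exact: measurableI.
  - by apply: le_lt_trans K2oo; apply: le_measure => //; apply: mem_set => //; exact: measurableI.
  - by rewrite setXI.
suff HH : @measurable _ (T1 * T2)%type `<=` H by move=> /HH[].
rewrite measurable_prod_measurableType; apply: lambda_system_subset => //.
- move=> _ _ [A1 mA1] [B1 mB1] <- [A2 mA2] [B2 mB2] <-.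
  exists (A1 `&` A2); first exact: measurableI.
  by exists (B1 `&` B2); [exact: measurableI|rewrite setXI].
- split => //.
  + split => //; rewrite -setXTT; exact: rectI.
  + move=> A B BA [mA sA] [mB sB]; split; first exact: measurableD.
    rewrite (_ : (fun z => _) = (fun z => (\1_(A `&` (K1 `*` K2)) z)%:C +
       (-1) * (\1_(B `&` (K1 `*` K2)) z)%:C)); last first.
      apply/funext => z; rewrite mulN1r -rmorphB; congr (_ %:C).
      have [Kz|Kz] := pselect ((K1 `*` K2) z); last first.
        by rewrite !indic_out ?subrr// => -[].
      have [Bz|Bz] := pselect (B z).
        have Az := BA _ Bz.
        rewrite (@indic_in R _ (A `&` _) z (conj Az Kz)).
        rewrite (@indic_in R _ (B `&` _) z (conj Bz Kz)) subrr.
        by rewrite indic_out// => -[[]].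
      rewrite [X in _ - X]indic_out ?subr0; last by case.
      have [Az|Az] := pselect (A z); last by rewrite !indic_out// => -[] // [].
      by rewrite !indic_in.
    have mI C' : measurable C' ->
        cmeasurable (fun z => (\1_(C' `&` (K1 `*` K2)) z)%:C : R[i]).
      by move=> mC'; apply: cmeasurable_indic; exact: measurableI.
    apply: L2_spanD => //.
    * exact: mI.
    * by apply: cmeasurableZ; exact: mI.
    * by apply: L2_spanZ => //; exact: mI.
  + move=> F Fnd HF; have mU : measurable (\bigcup_n F n).
      by apply: bigcupT_measurable => n; case: (HF n).
    split => //; apply: (@L2_span_nondecreasing _ _ _ _ _ (fun n => F n `&` (K1 `*` K2))) => //.
    * exact: measurableI.
    * exact: subI.
    * by move=> n; apply: measurableI => //; case: (HF n).
    * by move=> n; apply: setSI; exact: bigcup_sup.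
    * by move=> n m nm; apply: setSI; apply/subsetPset; exact: Fnd.
    * by rewrite setI_bigcupl.
    * by move=> n; case: (HF n).
- move=> _ [A mA] [B mB] <-; split; first exact: measurableX.
  exact: rectI.
Qed.

(** Inside a fixed box of finite measure the sets whose indicator lies in the
    span form a lambda-system that contains the rectangles; boxes exhaust the
    product by sigma-finiteness. *)
Lemma inL2_span_rectangles h : inL2 mu h -> L2_span mu finite_rectangle h.
Proof.
move=> hL; apply: (L2_span_trans (G := finite_measurable mu)) => //.
- by move=> A [].
- move=> C [mC Coo].
  have /sigma_finiteP[F [FT Fnd Foo]] := sigma_finiteT mu1.
  have /sigma_finiteP[G [GT Gnd Goo]] := sigma_finiteT mu2.
  apply: (@L2_span_nondecreasing _ _ _ _ _ (fun n => C `&` (F n `*` G n))) => //.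
  + move=> n; apply: measurableI => //; apply: measurableX; first exact: (Foo n).1.
    exact: (Goo n).1.
  + move=> n m nm; apply: setIS => -[x y] [/= Fx Gy]; split => /=.
      by have /subsetPset := Fnd _ _ nm; apply.
    by have /subsetPset := Gnd _ _ nm; apply.
  + move=> [x y] Cxy.
    have [n _ Fx] : (\bigcup_n F n) x by rewrite -FT.
    have [m _ Gy] : (\bigcup_n G n) y by rewrite -GT.
    exists (maxn n m) => //; split => //; split => /=.
      by have /subsetPset := Fnd _ _ (leq_maxl n m); apply.
    by have /subsetPset := Gnd _ _ (leq_maxr n m); apply.
  + move=> n; apply: box_span => //; [exact: (Foo n).1|exact: (Foo n).2|
      exact: (Goo n).1|exact: (Goo n).2].
- exact: inL2_measurable hL.
- exact: inL2_span.
Qed.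

End rectangles.

Section contractions.
Context d (T : measurableType d) (R : realType).
Variable mu : {measure set T -> \bar R}.

(** What is kept of a spectral projection once symmetry has given the norm bound.
    The class is stable under exchanging the two factors of a product. *)
Record L2_contraction (P : (T -> R[i]) -> (T -> R[i])) : Prop := {
  contr_L2 : forall f, inL2 mu f -> inL2 mu (P f);
  contr_linear : forall (a : R[i]) f g, inL2 mu f -> inL2 mu g ->
    ae_eq_fun mu (P (fun x => a * f x + g x)) (fun x => a * P f x + P g x);
  contr_le : forall f, inL2 mu f -> (energy mu (P f) <= energy mu f)%E
}.

Variable P : (T -> R[i]) -> (T -> R[i]).
Hypothesis cP : L2_contraction P.

Lemma contr_sum (I : Type) (r : seq I) (c : I -> R[i]) (F : I -> T -> R[i]) :
  (forall i, inL2 mu (F i)) ->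
  ae_eq_fun mu (P (fun x => \sum_(i <- r) c i * F i x))
    (fun x => \sum_(i <- r) c i * P (F i) x).
Proof.
move=> FL; elim: r => [|i r IH].
  have PL := contr_L2 cP (inL20 mu).
  under [X in ae_eq_fun mu (P X)]eq_fun do rewrite big_nil.
  under [X in ae_eq_fun mu _ X]eq_fun do rewrite big_nil.
  apply: energy_eq0; first exact: inL2_measurable PL.
  apply/eqP; rewrite eq_le energy_ge0 andbT.
  by have := contr_le cP (inL20 mu); rewrite energy0.
under [X in ae_eq_fun mu (P X)]eq_fun do rewrite big_cons.
under [X in ae_eq_fun mu _ X]eq_fun do rewrite big_cons.
have SL : inL2 mu (fun x => \sum_(j <- r) c j * F j x).
  by apply: inL2_sum => j; exact: inL2Z.
have := contr_linear cP (c i) (FL i) SL.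
by apply: filterS2 IH => x -> ->.
Qed.

Lemma contr_dist f g : inL2 mu f -> inL2 mu g ->
  (energy mu (fun x => (P f x - P g x)%R) <= energy mu (fun x => (f x - g x)%R))%E.
Proof.
move=> fL gL; rewrite energyC [leRHS]energyC.
have PfL := contr_L2 cP fL; have PgL := contr_L2 cP gL.
have fgL := inL2B gL fL.
apply: le_trans (contr_le cP fgL).
rewrite le_eqVlt; apply/orP; left; apply/eqP/energy_ae_eq.
- exact: (inL2_measurable (inL2B PgL PfL)).
- exact: (inL2_measurable (contr_L2 cP fgL)).
have := contr_linear cP (-1) fL gL; apply: filterS => x.
have -> : (fun x => -1 * f x + g x) = (fun x => g x - f x).
  by apply/funext => y; rewrite mulN1r addrC.
by move=> ->; rewrite mulN1r addrC.
Qed.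

Lemma contr_ae f g : inL2 mu f -> inL2 mu g -> ae_eq_fun mu f g ->
  ae_eq_fun mu (P f) (P g).
Proof.
move=> fL gL fg.
have PfL := contr_L2 cP fL; have PgL := contr_L2 cP gL.
have h : energy mu (fun x => f x - g x) = 0%E.
  rewrite -(energy0 mu); apply: energy_ae_eq.
  - exact: (inL2_measurable (inL2B fL gL)).
  - exact: cmeasurable_cst.
  - by move: fg; apply: filterS => x ->; rewrite subrr.
have := contr_dist fL gL; rewrite h => h'.
have /energy_eq0 : energy mu (fun x => P f x - P g x) = 0%E.
  by apply/eqP; rewrite eq_le h' energy_ge0.
move=> /(_ (inL2_measurable (inL2B PfL PgL))).
by apply: filterS => x /eqP; rewrite subr_eq0 => /eqP.
Qed.

End contractions.

Lemma spectral_L2_contraction d (T : measurableType d) (R : realType)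
    (mu : {measure set T -> \bar R}) d' (S : measurableType d')
    (E : set S -> (T -> R[i]) -> (T -> R[i])) (A : set S) :
  spectral_decomposition mu E -> measurable A -> L2_contraction mu (E A).
Proof.
move=> specE mA; split.
- by move=> f; exact: (sd_L2 specE).
- by move=> a f g; exact: (sd_linear specE).
- by move=> f; exact: spectral_contraction.
Qed.

Section slices.
Context d1 d2 (T1 : measurableType d1) (T2 : measurableType d2) (R : realType).
Variables (mu1 : {sigma_finite_measure set T1 -> \bar R})
          (mu2 : {sigma_finite_measure set T2 -> \bar R}).
Local Notation mu := (mu1 \x mu2)%E.
Implicit Types h : T1 * T2 -> R[i].

Lemma cmeasurable_slice2 h x : cmeasurable h -> cmeasurable (fun y => h (x, y)).
Proof. by move=> [mr mi]; split; [exact: (measurable_fun_pair2 x mr)|exact: (measurable_fun_pair2 x mi)]. Qed.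

Lemma cmeasurable_slice1 h y : cmeasurable h -> cmeasurable (fun x => h (x, y)).
Proof. by move=> [mr mi]; split; [exact: (measurable_fun_pair1 y mr)|exact: (measurable_fun_pair1 y mi)]. Qed.

Lemma energy_fubini1 h : cmeasurable h ->
  energy mu h = (\int[mu1]_x energy mu2 (fun y => h (x, y)))%E.
Proof.
move=> mh; rewrite /energy fubini_tonelli1//; first exact: measurable_normc_sqr.
by move=> z; rewrite lee_fin sqr_ge0.
Qed.

Lemma energy_fubini2 h : cmeasurable h ->
  energy mu h = (\int[mu2]_y energy mu1 (fun x => h (x, y)))%E.
Proof.
move=> mh; rewrite /energy fubini_tonelli2//; first exact: measurable_normc_sqr.
by move=> z; rewrite lee_fin sqr_ge0.
Qed.

Lemma measurable_energy_slice2 h : cmeasurable h ->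
  measurable_fun setT (fun x => energy mu2 (fun y => h (x, y))).
Proof.
move=> mh; apply: (@measurable_fun_fubini_tonelli_F _ _ _ _ _ mu2
  (fun z => (normc (h z) ^+ 2)%:E)) => //.
  exact: measurable_normc_sqr.
by move=> z; rewrite lee_fin sqr_ge0.
Qed.

Lemma measurable_energy_slice1 h : cmeasurable h ->
  measurable_fun setT (fun y => energy mu1 (fun x => h (x, y))).
Proof.
move=> mh; apply: (@measurable_fun_fubini_tonelli_G _ _ _ _ _ mu1
  (fun z => (normc (h z) ^+ 2)%:E)) => //.
  exact: measurable_normc_sqr.
by move=> z; rewrite lee_fin sqr_ge0.
Qed.

Lemma inL2_slice2 h : inL2 mu h -> {ae mu1, forall x, inL2 mu2 (fun y => h (x, y))}.
Proof.
move=> /inL2P[mh hoo].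
have : mu1.-integrable setT (fun x => energy mu2 (fun y => h (x, y))).
  apply/integrableP; split; first exact: measurable_energy_slice2.
  by under eq_integral do rewrite gee0_abs ?energy_ge0//; rewrite -energy_fubini1.
move=> /(integrable_ae measurableT); apply: filterS => x /(_ I) hx.
apply/inL2P; split; first exact: cmeasurable_slice2.
by rewrite -ge0_fin_numE ?energy_ge0.
Qed.

Lemma ae_slice2 (Q : T1 * T2 -> Prop) : {ae mu, forall z, Q z} ->
  {ae mu1, forall x, {ae mu2, forall y, Q (x, y)}}.
Proof.
move=> [N [mN N0 NQ]].
have mx : measurable_fun setT (fun x => mu2 (xsection N x)).
  exact: measurable_fun_xsection.
have : (\int[mu1]_x `|mu2 (xsection N x)|)%E = 0%E.
  by rewrite -N0; apply: eq_integral => x _; rewrite gee0_abs.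
move=> /(ae_eq_integral_abs mu1 measurableT mx); apply: filterS => x /(_ I) Nx.
exists (xsection N x); split => //; first exact: measurable_xsection.
by move=> y Qy; rewrite /xsection /= inE; apply: NQ.
Qed.

(** The infimum of a sequence of such majorants has integral 0. *)
Lemma ae_small (U : T1 -> \bar R) :
  (forall e : R, 0 < e -> exists W : T1 -> \bar R,
    [/\ measurable_fun setT W, forall x, (0 <= W x)%E,
        (\int[mu1]_x W x <= e%:E)%E & {ae mu1, forall x, (U x <= W x)%E}]) ->
  {ae mu1, forall x, (U x <= 0)%E}.
Proof.
move=> H.
have /choice[W HW] : forall k : nat, exists W : T1 -> \bar R,
    [/\ measurable_fun setT W, forall x, (0 <= W x)%E,
        (\int[mu1]_x W x <= (k.+1%:R^-1)%:E)%E & {ae mu1, forall x, (U x <= W x)%E}].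
  by move=> k; apply: H; rewrite invr_gt0.
pose V x := einfs (fun k => W k x) 0.
have mV : measurable_fun setT V.
  by apply: (measurable_fun_einfs (f := W)) => k; case: (HW k).
have VW k x : (V x <= W k x)%E by apply: ereal_inf_lbound; exists k.
have V0 x : (0 <= V x)%E.
  by apply: le_ereal_inf_tmp => _ [k _ <-]; case: (HW k).
have IV : (\int[mu1]_x V x = 0)%E.
  apply/eqP; rewrite eq_le integral_ge0// andbT; apply/lee_addgt0Pr => e e0.
  rewrite add0e.
  have [k _ /(_ k (leqnn k)) ke] := near_infty_natSinv_lt (PosNum e0).
  apply: (@le_trans _ _ ((k.+1%:R^-1)%:E)); last by rewrite lee_fin ltW.
  have [mW W0 Wk _] := HW k; apply: le_trans Wk.
  by apply: ge0_le_integral.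
have : (\int[mu1]_x `|V x|)%E = 0%E.
  by rewrite -IV; apply: eq_integral => x _; rewrite gee0_abs.
move=> /(ae_eq_integral_abs mu1 measurableT mV).
have UW : \forall x \ae mu1, forall k, (U x <= W k x)%E.
  by apply/ae_foralln => k; case: (HW k).
apply: filterS2 UW => x Ux /(_ I) /= Vx; rewrite -Vx.
by apply: le_ereal_inf_tmp => _ [k _ <-].
Qed.

Variables (P : (T1 * T2 -> R[i]) -> (T1 * T2 -> R[i]))
          (p : (T2 -> R[i]) -> (T2 -> R[i])).
Hypotheses (cP : L2_contraction mu P) (cp : L2_contraction mu2 p).
Hypothesis Pp : forall A B, measurable A -> (mu1 A < +oo)%E ->
  measurable B -> (mu2 B < +oo)%E ->
  ae_eq_fun mu (P (fun z => (\1_(A `*` B) z)%:C))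
    (fun z => (\1_A z.1)%:C * p (fun y => (\1_B y)%:C) z.2).

Let slice_step n (c : 'I_n -> R[i]) (C : 'I_n -> set (T1 * T2)) :
  (forall i, finite_rectangle mu1 mu2 (C i)) ->
  {ae mu1, forall x, ae_eq_fun mu2 (fun y => P (step_fun c C) (x, y))
    (p (fun y => step_fun c C (x, y)))}.
Proof.
move=> rC.
have /choice[AB HAB] : forall i, exists AB : set T1 * set T2,
  [/\ measurable AB.1, (mu1 AB.1 < +oo)%E, measurable AB.2, (mu2 AB.2 < +oo)%E &
      C i = AB.1 `*` AB.2].
  by move=> i; have [A [B H]] := rC i; exists (A, B).
have CL i : inL2 mu (fun z => (\1_(C i) z)%:C).
  apply: inL2_indic; first exact: finite_rectangle_measurable (rC i).
  exact: finite_rectangle_lty (rC i).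
have BL i : inL2 mu2 (fun y => (\1_(AB i).2 y)%:C).
  by have [mA A1 mB B1 _] := HAB i; exact: inL2_indic.
have h1 := contr_sum cP (index_enum 'I_n) c CL.
have h2 : {ae mu, forall z, forall i, P (fun z => (\1_(C i) z)%:C) z =
    (\1_(AB i).1 z.1)%:C * p (fun y => (\1_(AB i).2 y)%:C) z.2}.
  apply: filter_forall => i.
  by have [mA A1 mB B1 ->] := HAB i; exact: Pp.
have := ae_slice2 (ae_and h1 h2).
apply: filterS => x h.
have := contr_sum cp (index_enum 'I_n) (fun i => c i * (\1_(AB i).1 x)%:C) BL.
apply: filterS2 h => y [Ps1 Ps2] h3.
rewrite /step_fun Ps1.
have -> : (fun y => \sum_(i < n) c i * (\1_(C i) (x, y))%:C) =
    (fun y => \sum_(i < n) c i * (\1_(AB i).1 x)%:C * (\1_(AB i).2 y)%:C).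
  apply/funext => y'; apply: eq_bigr => i _; rewrite -mulrA; congr (_ * _).
  have [mA A1 mB B1 ->] := HAB i; rewrite -rmorphM; congr (_%:C).
  by rewrite !indicE in_setX /=; case: (x \in _); rewrite ?mul1r ?mul0r.
by rewrite h3; apply: eq_bigr => i _; rewrite Ps2 mulrA.
Qed.

(** The operator [P] stands for the tensor product of the identity with [p]. On step
    functions over rectangles it acts on each slice as [p] by linearity. For
    general [h] the defect on the slice at [x] is controlled, after
    approximation of [h] by a step function, by two slice energies of small
    integral, and [ae_small] applies. *)
Lemma slice2_contraction h : inL2 mu h ->
  {ae mu1, forall x, ae_eq_fun mu2 (fun y => P h (x, y)) (p (fun y => h (x, y)))}.
Proof.
move=> hL; have PhL := contr_L2 cP hL.
have hx := inL2_slice2 hL; have Phx := inL2_slice2 PhL.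
pose U x := energy mu2 (fun y => P h (x, y) - p (fun y => h (x, y)) y).
have U0 : {ae mu1, forall x, (U x <= 0)%E}.
  apply: ae_small => e e0.
  have e4 : 0 < e / 4 by rewrite divr_gt0.
  have [n [c [C [rC sC]]]] := inL2_span_rectangles hL e4.
  set s := step_fun c C in sC.
  have sL : inL2 mu s.
    apply: inL2_sum => i; apply: inL2Z.
    apply: inL2_indic; first exact: finite_rectangle_measurable (rC i).
    exact: finite_rectangle_lty (rC i).
  have PsL := contr_L2 cP sL.
  have dL := inL2B hL sL; have PdL := inL2B PhL PsL.
  have md := measurable_energy_slice2 (inL2_measurable dL).
  have mPd := measurable_energy_slice2 (inL2_measurable PdL).
  exists (fun x => 2%:E * energy mu2 (fun y => P h (x, y) - P s (x, y))%R +
     2%:E * energy mu2 (fun y => h (x, y) - s (x, y))%R)%E; split.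
  - by apply: emeasurable_funD; apply: measurable_funeM.
  - by move=> x; rewrite adde_ge0// mule_ge0// energy_ge0.
  - rewrite ge0_integralD//; first last.
    + exact: measurable_funeM.
    + by move=> x _; rewrite mule_ge0// energy_ge0.
    + exact: measurable_funeM.
    + by move=> x _; rewrite mule_ge0// energy_ge0.
    rewrite !ge0_integralZl_EFin//.
    rewrite -(energy_fubini1 (inL2_measurable dL)) -(energy_fubini1 (inL2_measurable PdL)).
    have Pd := le_lt_trans (contr_dist cP hL sL) sC.
    apply: (@le_trans _ _ (2%:E * (e / 4)%:E + 2%:E * (e / 4)%:E)%E).
      by apply: leeD; apply: lee_wpmul2l => //; exact: ltW.
    rewrite -!EFinM -EFinD lee_fin (_ : 2 * (e / 4) + 2 * (e / 4) = e)//.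
    by field.
  - have sx := inL2_slice2 sL; have Psx := inL2_slice2 PsL.
    have hsx := ae_and hx sx.
    have Phsx := ae_and Phx Psx.
    have := slice_step c rC.
    apply: filterS2 (ae_and hsx Phsx) => x [[hxL sxL] [PhxL PsxL]] psx.
    have phL := contr_L2 cp hxL; have psL := contr_L2 cp sxL.
    have -> : U x = energy mu2 (fun y => (P h (x, y) - P s (x, y)) +
        (p (fun y => s (x, y)) y - p (fun y => h (x, y)) y)).
      apply: energy_ae_eq.
      + exact: (inL2_measurable (inL2B PhxL phL)).
      + exact: (inL2_measurable (inL2D (inL2B PhxL PsxL) (inL2B psL phL))).
      + by move: psx; apply: filterS => y ->; rewrite addrA subrK.
    apply: le_trans (energyD _ _ _) _.
    + exact: (inL2_measurable (inL2B PhxL PsxL)).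
    + exact: (inL2_measurable (inL2B psL phL)).
    apply: leeD => //; apply: lee_wpmul2l => //.
    by rewrite [leRHS]energyC; exact: contr_dist.
have hPhx := ae_and hx Phx.
apply: filterS2 hPhx U0 => x [hxL PhxL] Ux.
have phL := contr_L2 cp hxL.
have /energy_eq0 : U x = 0%E by apply/eqP; rewrite eq_le Ux energy_ge0.
move=> /(_ (inL2_measurable (inL2B PhxL phL))).
by apply: filterS => y /eqP; rewrite subr_eq0 => /eqP.
Qed.

End slices.

Section swap.
Context d1 d2 (T1 : measurableType d1) (T2 : measurableType d2) (R : realType).
Variables (mu1 : {sigma_finite_measure set T1 -> \bar R})
          (mu2 : {sigma_finite_measure set T2 -> \bar R}).

Definition swap_fun (f : T1 * T2 -> R[i]) : T2 * T1 -> R[i] := fun z => f (z.2, z.1).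

Lemma cmeasurable_swap f : cmeasurable f -> cmeasurable (swap_fun f).
Proof.
move=> mf; apply: (cmeasurable_comp (h := fun z : T2 * T1 => (z.2, z.1))) => //.
by apply: measurable_fun_pair; [exact: measurable_snd|exact: measurable_fst].
Qed.

Lemma energy_swap f : cmeasurable f ->
  energy (mu2 \x mu1)%E (swap_fun f) = energy (mu1 \x mu2)%E f.
Proof.
move=> mf; rewrite energy_fubini1; last exact: cmeasurable_swap.
by rewrite energy_fubini2.
Qed.

Lemma inL2_swap f : inL2 (mu1 \x mu2)%E f -> inL2 (mu2 \x mu1)%E (swap_fun f).
Proof.
move=> /inL2P[mf foo]; apply/inL2P; split; first exact: cmeasurable_swap.
by rewrite energy_swap.
Qed.

Lemma ae_swap (Q : T1 * T2 -> Prop) : {ae (mu1 \x mu2)%E, forall z, Q z} ->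
  {ae (mu2 \x mu1)%E, forall z, Q (z.2, z.1)}.
Proof.
move=> [N [mN N0 NQ]].
have ms : measurable_fun setT (fun z : T2 * T1 => (z.2, z.1)).
  by apply: measurable_fun_pair; [exact: measurable_snd|exact: measurable_fst].
have mN' : measurable ((fun z : T2 * T1 => (z.2, z.1)) @^-1` N).
  by rewrite -[X in measurable X]setTI; exact: ms.
exists ((fun z : T2 * T1 => (z.2, z.1)) @^-1` N); split => //; last first.
  by move=> z /=; exact: NQ.
rewrite -[LHS](energy_indic (mu2 \x mu1)%E mN') -[RHS]N0.
rewrite -[RHS](energy_indic (mu1 \x mu2)%E mN) -[RHS]energy_swap//.
exact: cmeasurable_indic.
Qed.

End swap.

Section slice1.
Context d1 d2 (T1 : measurableType d1) (T2 : measurableType d2) (R : realType).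
Variables (mu1 : {sigma_finite_measure set T1 -> \bar R})
          (mu2 : {sigma_finite_measure set T2 -> \bar R}).
Local Notation mu := (mu1 \x mu2)%E.

Definition swap_op (P : (T1 * T2 -> R[i]) -> (T1 * T2 -> R[i])) :
  (T2 * T1 -> R[i]) -> (T2 * T1 -> R[i]) := fun f => swap_fun (P (swap_fun f)).

Lemma swap_contraction P : L2_contraction mu P ->
  L2_contraction (mu2 \x mu1)%E (swap_op P).
Proof.
move=> cP; split.
- by move=> f fL; apply: inL2_swap; apply: (contr_L2 cP); exact: inL2_swap.
- move=> a f g fL gL.
  exact: (ae_swap (contr_linear cP a (inL2_swap fL) (inL2_swap gL))).
- move=> f fL; have sfL := inL2_swap fL.
  rewrite /swap_op energy_swap; last exact: inL2_measurable (contr_L2 cP sfL).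
  apply: le_trans (contr_le cP sfL) _.
  by rewrite energy_swap//; exact: inL2_measurable fL.
Qed.

Lemma slice1_contraction (P : (T1 * T2 -> R[i]) -> (T1 * T2 -> R[i]))
    (p : (T1 -> R[i]) -> (T1 -> R[i])) :
  L2_contraction mu P -> L2_contraction mu1 p ->
  (forall A B, measurable A -> (mu1 A < +oo)%E -> measurable B -> (mu2 B < +oo)%E ->
    ae_eq_fun mu (P (fun z => (\1_(A `*` B) z)%:C))
      (fun z => p (fun x => (\1_A x)%:C) z.1 * (\1_B z.2)%:C)) ->
  forall h, inL2 mu h ->
  {ae mu2, forall y, ae_eq_fun mu1 (fun x => P h (x, y)) (p (fun x => h (x, y)))}.
Proof.
move=> cP cp Pp h hL.
suff Pp' B A : measurable B -> (mu2 B < +oo)%E -> measurable A -> (mu1 A < +oo)%E ->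
    ae_eq_fun (mu2 \x mu1)%E (swap_op P (fun z => (\1_(B `*` A) z)%:C))
      (fun z => (\1_B z.1)%:C * p (fun x => (\1_A x)%:C) z.2).
  have := slice2_contraction (swap_contraction cP) cp Pp' (inL2_swap hL).
  have -> : swap_op P (swap_fun h) = swap_fun (P h).
    by congr (swap_fun (P _)); apply/funext => -[].
  by [].
move=> mB B1 mA A1; have := ae_swap (Pp A B mA A1 mB B1).
apply: filterS => -[y x] /= h1.
rewrite mulrC -h1 /swap_op /swap_fun; congr (P _ _); apply/funext => -[x' y'] /=.
by rewrite !indicE !in_setX /= andbC.
Qed.

End slice1.

(** * Lifting a one-parameter bound to the product *)

Section weighted_hoelder.
Context d (T : measurableType d) (R : realType).
Variable mu : {measure set T -> \bar R}.

(** Hoelder's inequality with exponents [2/p] and [2/(2-p)] for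
    [|u|^p = (|u|^p W^(p(p-2)/2)) * W^(p(2-p)/2)]. *)
Lemma weighted_hoelder (p : R) (u : T -> R[i]) (W : T -> R) :
  1 <= p < 2 -> cmeasurable u -> measurable_fun setT W -> (forall x, 0 <= W x) ->
  (forall x, W x = 0 -> u x = 0) ->
  (cLnorm mu p%:E u `^ 2 <= (\int[mu]_x (W x `^ p)%:E) `^ ((2 - p) / p) *
    \int[mu]_x (normc (u x) ^+ 2 * W x `^ (p - 2))%:E)%E.
Proof.
move=> /andP[p1 p2] mu_ mW W0 Wu.
have p0 : 0 < p by exact: lt_le_trans p1.
have q0 : 0 < 2 - p by rewrite subr_gt0.
have pN0 : p != 0 by rewrite gt_eqF.
have qN0 : 2 - p != 0 by rewrite gt_eqF.
have mn := measurable_normc mu_.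
have mpow (h : T -> R) (r : R) : measurable_fun setT h ->
    measurable_fun setT (fun x => h x `^ r).
  by move=> mh; apply: (@measurableT_comp _ _ _ _ _ _ (@powR R ^~ r)).
pose f x := normc (u x) `^ p * W x `^ (p * (p - 2) / 2).
pose g x := W x `^ (p * (2 - p) / 2).
have mf : measurable_fun setT f by apply: measurable_funM; exact: mpow.
have mg : measurable_fun setT g by exact: mpow.
have P0 : 0 < 2 / p by rewrite divr_gt0.
have Q0 : 0 < 2 / (2 - p) by rewrite divr_gt0.
have PQ : (2 / p)^-1 + (2 / (2 - p))^-1 = 1 by field; rewrite pN0 qN0.
have := hoelder mu mf mg P0 Q0 PQ.
have f0 x : 0 <= f x by rewrite mulr_ge0 ?powR_ge0.
have g0 x : 0 <= g x by rewrite powR_ge0.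
rewrite Lnorm1.
have -> : (\int[mu]_x `|(EFin \o (f \* g)%R) x|)%E = (cLnorm mu p%:E u `^ p)%E.
  rewrite /cLnorm poweR_Lnorm//; apply: eq_integral => x _ /=.
  rewrite (ger0_norm (mulr_ge0 (f0 x) (g0 x))) ger0_norm ?normc_ge0//.
  apply: congr1; rewrite /f /g; have [Wx|Wx] := eqVneq (W x) 0.
    by rewrite Wu// normc0 powR0// !mul0r.
  rewrite -(mulrA (normc (u x) `^ p)).
  rewrite -powRD; last by rewrite Wx implybT.
  by rewrite (_ : p * (p - 2) / 2 + p * (2 - p) / 2 = 0) ?powRr0 ?mulr1//; field.
have -> : Lnorm mu (2 / p)%:E (EFin \o f) =
    ((\int[mu]_x (normc (u x) ^+ 2 * W x `^ (p - 2))%:E) `^ (p / 2))%E.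
  rewrite unlock (_ : (2 / p)^-1 = p / 2); last by field.
  congr (_ `^ _)%E; apply: eq_integral => x _ /=.
  rewrite ger0_norm//; apply: congr1.
  rewrite /f powRM ?powR_ge0// -!powRrM (_ : p * (2 / p) = 2); last by field.
  rewrite powR_mulrn ?normc_ge0//; congr (_ * _ `^ _); by field.
have -> : Lnorm mu (2 / (2 - p))%:E (EFin \o g) =
    ((\int[mu]_x (W x `^ p)%:E) `^ ((2 - p) / 2))%E.
  rewrite unlock (_ : (2 / (2 - p))^-1 = (2 - p) / 2); last by field.
  congr (_ `^ _)%E; apply: eq_integral => x _ /=.
  rewrite ger0_norm//; apply: congr1.
  by rewrite /g -powRrM; congr (_ `^ _); field.
set A := (\int[mu]_x (normc _ ^+ 2 * _)%:E)%E.
set M := (\int[mu]_x (W x `^ p)%:E)%E.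
have A0 : (0 <= A)%E.
  by apply: integral_ge0 => x _; rewrite lee_fin mulr_ge0 ?sqr_ge0 ?powR_ge0.
have M0 : (0 <= M)%E by apply: integral_ge0 => x _; rewrite lee_fin powR_ge0.
move=> H.
have := @gt0_ler_poweR _ (2 / p) (ltW P0) _ _ _ _ H.
rewrite !in_itv /= !leey !andbT poweR_ge0 mule_ge0 ?poweR_ge0// => /(_ isT isT).
rewrite poweRM ?poweR_ge0// -!poweRrM.
rewrite (_ : p * (2 / p) = 2); last by field.
rewrite (_ : p / 2 * (2 / p) = 1); last by field.
rewrite (_ : (2 - p) / 2 * (2 / p) = (2 - p) / p); last by field.
by rewrite poweRe1// muleC.
Qed.

End weighted_hoelder.

Section lift_bound.
Context d1 d2 (T1 : measurableType d1) (T2 : measurableType d2) (R : realType).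
Variables (mu1 : {sigma_finite_measure set T1 -> \bar R})
          (mu2 : {sigma_finite_measure set T2 -> \bar R}).
Local Notation mu := (mu1 \x mu2)%E.

(** The bound by [c] of [E P_B] from [L^p] to [L^2], on the common domain of the
    two norms. *)
Definition restriction_bound d (T : measurableType d)
    (m : {measure set T -> \bar R}) (p : R) (B : set T)
    (E : (T -> R[i]) -> (T -> R[i])) (c : R) :=
  forall u, inL2 m u -> (cLnorm m p%:E u < +oo)%E ->
    (cLnorm m 2%:E (E (restr B u)) <= c%:E * cLnorm m p%:E u)%E.

Variables (P : (T1 * T2 -> R[i]) -> (T1 * T2 -> R[i]))
          (p1 : (T1 -> R[i]) -> (T1 -> R[i])).
Hypotheses (cP : L2_contraction mu P) (cp1 : L2_contraction mu1 p1).
Hypothesis sP : forall h, inL2 mu h ->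
  {ae mu2, forall y, ae_eq_fun mu1 (fun x => P h (x, y)) (p1 (fun x => h (x, y)))}.

(** A bound from [L^p] to [L^2] in the first variable, applied for fixed second
    variable and integrated, leaves the [L^2] norm in [y] of the [L^p] norm in
    [x], in the order that Minkowski's inequality needs to exchange. Hoelder's
    inequality against a weight [W] of the first variable does this and is more
    flexible: with [W x] the norm of [g (x, _)] the right-hand side is the square
    of the mixed norm of [g], and other choices of [W] give [partial_bound]. *)
Lemma lift_bound (p c : R) (B : set T1) (g : T1 * T2 -> R[i]) (W : T1 -> R) :
  1 <= p < 2 -> 0 <= c -> measurable B -> restriction_bound mu1 p B p1 c ->
  inL2 mu g -> measurable_fun setT W -> (forall x, 0 <= W x) ->
  {ae mu1, forall x, ~ (B x /\ 0 < W x) -> energy mu2 (fun y => g (x, y)) = 0%E} ->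
  let M := (\int[mu1]_x (W x `^ p)%:E)%E in
  let A := (\int[mu1]_x ((W x `^ (p - 2))%:E * energy mu2 (fun y => (g (x, y))%R)))%E in
  (M < +oo)%E -> (A < +oo)%E ->
  (energy mu (P g) <= (c ^+ 2)%:E * (M `^ ((2 - p) / p) * A))%E.
Proof.
move=> p12 c0 mB Hp gL mW W0 gW M A Moo Aoo.
have mg := inL2_measurable gL.
pose K := B `&` [set x | 0 < W x].
have mK : measurable K.
  apply: measurableI => //; rewrite -[X in measurable X]setTI.
  have -> : [set x | 0 < W x] = W @^-1` `]0, +oo[%classic.
    by apply/seteqP; split => x /=; rewrite in_itv /= andbT.
  by apply: mW => //; exact: measurable_itv.
have mKT : measurable (K `*` [set: T2]) by exact: measurableX.
(* equal to [g] almost everywhere, and vanishing wherever the weight does *)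
pose g1 := restr (K `*` [set: T2]) g.
have g1L : inL2 mu g1 by exact: inL2_restr.
have mg1 := inL2_measurable g1L.
have g1E x y : K x -> g1 (x, y) = g (x, y).
  by move=> Kx; rewrite /g1 /restr indic_in ?mul1r.
have g10 x y : ~ K x -> g1 (x, y) = 0.
  by move=> Kx; rewrite /g1 /restr indic_out ?mul0r// => -[].
have gg1 : ae_eq_fun mu g g1.
  have mgg1 := cmeasurableB mg mg1.
  have /energy_eq0 : energy mu (fun z => g z - g1 z) = 0%E.
    rewrite energy_fubini1//; apply: etrans (integral0 mu1 setT).
    apply: ae_eq_integral => //.
      exact: (measurable_energy_slice2 mu2 mgg1).
    move: gW; apply: filterS => x gWx _.
    have [Kx|Kx] := pselect (K x).
      under [X in energy _ X]eq_fun do rewrite g1E// subrr.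
      exact: energy0.
    by under [X in energy _ X]eq_fun do rewrite g10// subr0; exact: gWx.
  by move=> /(_ mgg1); apply: filterS => z /eqP; rewrite subr_eq0 => /eqP.
have -> : energy mu (P g) = energy mu (P g1).
  apply: energy_ae_eq.
  - exact: inL2_measurable (contr_L2 cP gL).
  - exact: inL2_measurable (contr_L2 cP g1L).
  - exact: contr_ae.
have mPg1 := inL2_measurable (contr_L2 cP g1L).
rewrite energy_fubini2//.
have mWpow (r : R) : measurable_fun setT (fun x => W x `^ r).
  by apply: (@measurableT_comp _ _ _ _ _ _ (@powR R ^~ r)).
pose k z : \bar R := (normc (g1 z) ^+ 2 * W z.1 `^ (p - 2))%:E.
have k0 z : (0 <= k z)%E by rewrite lee_fin mulr_ge0 ?sqr_ge0 ?powR_ge0.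
have mk : measurable_fun setT k.
  apply/measurable_EFinP/measurable_funM.
    exact/measurable_funX/measurable_normc.
  exact: (measurableT_comp (mWpow (p - 2)) measurable_fst).
have M0 : (0 <= M)%E by apply: integral_ge0 => x _; rewrite lee_fin powR_ge0.
have Mr0 : (0 <= M `^ ((2 - p) / p))%E by exact: poweR_ge0.
have IkA : (\int[mu2]_y \int[mu1]_x k (x, y) <= A)%E.
  rewrite -fubini_tonelli2// fubini_tonelli1//; apply: ge0_le_integral => //.
  - by move=> x _; apply: integral_ge0.
  - exact: measurable_fun_fubini_tonelli_F.
  - apply: emeasurable_funM; first exact/measurable_EFinP.
    exact: measurable_energy_slice2.
  - move=> x _; rewrite /fubini_F /k.
    rewrite -ge0_integralZl_EFin ?powR_ge0//; last 2 first.
    + by move=> y _; rewrite lee_fin sqr_ge0.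
    + by apply: measurable_normc_sqr; exact: cmeasurable_slice2.
    apply: ge0_le_integral => //.
    + by move=> y _; exact: (k0 (x, y)).
    + by have := measurable_fun_pair2 x mk.
    + by apply: measurable_funeM; apply: measurable_normc_sqr; exact: cmeasurable_slice2.
    + move=> y _; rewrite -EFinM lee_fin mulrC ler_wpM2l ?powR_ge0//.
      by rewrite lerXn2r ?nnegrE ?normc_ge0//; exact: normc_restr.
have mIk : measurable_fun setT (fun y => \int[mu1]_x k (x, y))%E.
  exact: (@measurable_fun_fubini_tonelli_G _ _ _ _ _ mu1 k).
have Ikfin : {ae mu2, forall y, (\int[mu1]_x k (x, y) < +oo)%E}.
  have : mu2.-integrable setT (fun y => \int[mu1]_x k (x, y))%E.
    apply/integrableP; split => //.
    under eq_integral do rewrite gee0_abs ?integral_ge0//.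
    exact: le_lt_trans IkA Aoo.
  move=> /(integrable_ae measurableT); apply: filterS => y /(_ I).
  by rewrite ge0_fin_numE// integral_ge0.
have Mfin : (M `^ ((2 - p) / p))%E \is a fin_num.
  by apply: fin_num_poweR; rewrite ge0_fin_numE.
have bound : {ae mu2, forall y, (energy mu1 (fun x => P g1 (x, y)) <=
    ((c ^+ 2)%:E * M `^ ((2 - p) / p)) * \int[mu1]_x k (x, y))%E}.
  have ss : {ae mu2, forall y, inL2 mu1 (fun x => g1 (x, y))}.
    have := inL2_slice2 (inL2_swap g1L).
    by apply: filterS => y.
  have PsL : {ae mu2, forall y, inL2 mu1 (fun x => P g1 (x, y))}.
    have := inL2_slice2 (inL2_swap (contr_L2 cP g1L)).
    by apply: filterS => y.
  apply: filterS2 (ae_and (ae_and ss PsL) (sP g1L)) Ikfin => y [[uL PuL] Pu] Iy.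
  set u := fun x => g1 (x, y) in uL Pu Iy *.
  have uB : restr B u = u.
    apply/funext => x; rewrite /restr.
    have [Bx|Bx] := pselect (B x); first by rewrite indic_in ?mul1r.
    by rewrite indic_out// mul0r /u g10// => -[].
  have Wu x : W x = 0 -> u x = 0.
    by move=> Wx; rewrite /u g10// => -[_ /=]; rewrite Wx ltxx.
  have := weighted_hoelder mu1 p12 (inL2_measurable uL) mW W0 Wu.
  rewrite -/M => H.
  have uoo : (cLnorm mu1 p%:E u < +oo)%E.
    apply: (@lty_poweRy _ _ 2); first by rewrite pnatr_eq0.
    apply: le_lt_trans H _; apply: lte_mul_pinfty => //.
  have := Hp u uL uoo; rewrite uB => Hu.
  have -> : energy mu1 (fun x => P g1 (x, y)) = energy mu1 (p1 u).
    apply: energy_ae_eq => //.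
    - exact: inL2_measurable PuL.
    - exact: inL2_measurable (contr_L2 cp1 uL).
  rewrite -cLnorm2_sqr.
  have := @gt0_ler_poweR _ 2 _ _ _ _ _ Hu.
  rewrite !in_itv /= !leey !andbT cLnorm_ge0 mule_ge0 ?cLnorm_ge0 ?lee_fin//.
  move=> /(_ (ler0n _ _) isT isT) => H2; apply: le_trans H2 _.
  rewrite poweRM ?cLnorm_ge0 ?lee_fin// poweR_EFin powR_mulrn// -muleA.
  by apply: lee_wpmul2l => //; rewrite lee_fin sqr_ge0.
have c20 : (0 <= (c ^+ 2)%:E * M `^ ((2 - p) / p))%E by rewrite mule_ge0// lee_fin sqr_ge0.
apply: (@le_trans _ _ (\int[mu2]_y (((c ^+ 2)%:E * M `^ ((2 - p) / p)) *
    \int[mu1]_x k (x, y)))%E).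
  apply: ae_ge0_le_integral => //.
  - exact: (measurable_energy_slice1 mu1 mPg1).
  - by move=> y _; rewrite mule_ge0// integral_ge0.
  - exact: measurable_funeM.
  - by move: bound; apply: filterS.
rewrite ge0_integralZl//; last by move=> y _; exact: integral_ge0.
by rewrite muleA; apply: lee_wpmul2l.
Qed.

End lift_bound.

(** * Mixed norms and spectral projections of rectangles *)

Lemma cLnormE d (T : measurableType d) (R : realType) (mu : {measure set T -> \bar R})
    (p : R) (f : T -> R[i]) :
  cLnorm mu p%:E f = ((\int[mu]_x (normc (f x) `^ p)%:E) `^ p^-1)%E.
Proof.
rewrite /cLnorm unlock; congr (_ `^ _)%E; apply: eq_integral => x _ /=.
by rewrite ger0_norm ?normc_ge0.
Qed.

Lemma contrZ d (T : measurableType d) (R : realType) (mu : {measure set T -> \bar R})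
    (P : (T -> R[i]) -> (T -> R[i])) (cP : L2_contraction mu P) (a : R[i]) f :
  inL2 mu f -> ae_eq_fun mu (P (fun x => a * f x)) (fun x => a * P f x).
Proof.
move=> fL; have := contr_sum cP [:: tt] (fun=> a) (fun=> fL).
under [X in ae_eq_fun mu (P X)]eq_fun do rewrite big_seq1.
by under [X in ae_eq_fun mu _ X]eq_fun do rewrite big_seq1.
Qed.

Section rectangle_bounds.
Context d1 d2 (T1 : measurableType d1) (T2 : measurableType d2) (R : realType).
Variables (mu1 : {sigma_finite_measure set T1 -> \bar R})
          (mu2 : {sigma_finite_measure set T2 -> \bar R}).
Local Notation mu := (mu1 \x mu2)%E.

Let V (q : R) (f : T1 * T2 -> R[i]) x := cLnorm mu2 q%:E (fun y => f (x, y)).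

Let V0 q f x : (0 <= V q f x)%E. Proof. exact: cLnorm_ge0. Qed.

Let mV q f : cmeasurable f -> measurable_fun setT (V q f).
Proof.
move=> mf; have -> : V q f =
    (fun x => (\int[mu2]_y (normc (f (x, y)) `^ q)%:E) `^ q^-1)%E.
  by apply/funext => x; rewrite /V cLnormE.
apply: (@measurableT_comp _ _ _ _ _ _ (fun x : \bar R => (x `^ q^-1)%E)).
  exact: measurable_poweR.
apply: (@measurable_fun_fubini_tonelli_F _ _ _ _ _ mu2
  (fun z => (normc (f z) `^ q)%:E)).
  apply/measurable_EFinP; apply: (@measurableT_comp _ _ _ _ _ _ (@powR R ^~ q)) => //.
  exact: measurable_normc.
by move=> z; rewrite lee_fin powR_ge0.
Qed.

Let int_V (q1 q : R) f : 0 < q1 -> (mixnorm12 mu1 mu2 q1%:E q%:E f <= 1)%E ->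
  (\int[mu1]_x (V q f x `^ q1) <= 1)%E.
Proof.
move=> q0 f1; have qN0 : q1 != 0 by rewrite gt_eqF.
have -> : (\int[mu1]_x (V q f x `^ q1) = mixnorm12 mu1 mu2 q1%:E q%:E f `^ q1)%E.
  rewrite /mixnorm12 poweR_Lnorm//; apply: eq_integral => x _.
  by rewrite gee0_abs// V0.
rewrite -(poweR1r q1); apply: gt0_ler_poweR (ltW q0) _ _ _ _ f1.
- by rewrite in_itv /= leey andbT; exact: Lnorm_ge0.
- by rewrite in_itv /= leey andbT lee01.
Qed.

Let Vpow_fin (q1 q : R) f : 0 < q1 -> cmeasurable f ->
  (mixnorm12 mu1 mu2 q1%:E q%:E f <= 1)%E ->
  {ae mu1, forall x, (V q f x < +oo)%E}.
Proof.
move=> q0 mf f1.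
have : mu1.-integrable setT (fun x => V q f x `^ q1)%E.
  apply/integrableP; split.
    apply: (@measurableT_comp _ _ _ _ _ _ (fun x : \bar R => (x `^ q1)%E)).
      exact: measurable_poweR.
    exact: mV.
  under eq_integral do rewrite gee0_abs ?poweR_ge0//.
  exact: le_lt_trans (int_V q0 f1) (ltry _).
move=> /(integrable_ae measurableT); apply: filterS => x /(_ I).
rewrite ge0_fin_numE ?poweR_ge0//; apply: lty_poweRy.
by rewrite gt_eqF.
Qed.

Let slice_restr (B1 : set T1) (B2 : set T2) (f : T1 * T2 -> R[i]) x :
  (fun y => restr (B1 `*` B2) f (x, y)) =
  if x \in B1 then restr B2 (fun y => f (x, y)) else (fun=> 0 : R[i]).
Proof.
apply/funext => y; rewrite /restr !indicE in_setX /=.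
by case: ifPn => //; rewrite mul0r.
Qed.

(** The multiple of each slice of [f] whose energy is the [q]-th power of its
    norm. The function obtained has energy at most 1 when the mixed norm of [f]
    is at most 1, and as its factor depends on the first variable only, it
    commutes with operators acting on the second one. *)
Definition normalize (q : R) (f : T1 * T2 -> R[i]) (z : T1 * T2) : R[i] :=
  (Num.sqrt (fine (energy mu2 (fun y => f (z.1, y)))) `^ ((q - 2) / 2))%:C * f z.

Let W (f : T1 * T2 -> R[i]) x := Num.sqrt (fine (energy mu2 (fun y => f (x, y)))).

Let W0 f x : 0 <= W f x. Proof. exact: sqrtr_ge0. Qed.

Let mW f : cmeasurable f -> measurable_fun setT (W f).
Proof.
move=> mf; apply: (@measurableT_comp _ _ _ _ _ _ (@Num.sqrt R)).
  by apply: continuous_measurable_fun; exact: sqrt_continuous.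
apply: (@measurableT_comp _ _ _ _ _ _ (@fine R)) => //.
exact: (measurable_energy_slice2 mu2 mf).
Qed.

Let mWq f (r : R) : cmeasurable f -> measurable_fun setT (fun x => W f x `^ r).
Proof.
by move=> mf; apply: (@measurableT_comp _ _ _ _ _ _ (@powR R ^~ r)) => //; exact: mW.
Qed.

Let W_sqr f x : inL2 mu2 (fun y => f (x, y)) ->
  energy mu2 (fun y => f (x, y)) = ((W f x) ^+ 2)%:E.
Proof.
move=> fL; rewrite sqr_sqrtr ?fine_ge0 ?energy_ge0// fineK//; exact: inL2_energy.
Qed.

Let VW f x : inL2 mu2 (fun y => f (x, y)) -> V 2 f x = (W f x)%:E.
Proof.
move=> fL; rewrite /V cLnorm2E W_sqr// poweR_EFin powR12_sqrt ?sqr_ge0//.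
by rewrite sqrtr_sqr ger0_norm.
Qed.

Let int_W (q : R) f : 0 < q -> inL2 mu f -> (mixnorm12 mu1 mu2 q%:E 2%:E f <= 1)%E ->
  (\int[mu1]_x (W f x `^ q)%:E <= 1)%E.
Proof.
move=> q0 fL f1; apply: le_trans (int_V q0 f1); apply: ae_ge0_le_integral => //.
- by move=> x _; rewrite lee_fin powR_ge0.
- by apply/measurable_EFinP; apply: mWq; exact: inL2_measurable fL.
- by move=> x _; exact: poweR_ge0.
- apply: (@measurableT_comp _ _ _ _ _ _ (fun x : \bar R => (x `^ q)%E)).
    exact: measurable_poweR.
  by apply: mV; exact: inL2_measurable fL.
- have := inL2_slice2 fL; apply: filterS => x fx _.
  by rewrite VW.
Qed.

Let W_weight (q : R) f x :
  (W f x `^ ((q - 2) / 2)) ^+ 2 = W f x `^ (q - 2).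
Proof.
rewrite -powR_mulrn ?powR_ge0// -powRrM; congr (_ `^ _); by field.
Qed.

Let W_weightM (q : R) f x : 1 <= q < 2 ->
  W f x `^ (q - 2) * W f x ^+ 2 = W f x `^ q.
Proof.
move=> /andP[q1 q2]; have [->|Wx] := eqVneq (W f x) 0.
  by rewrite expr0n mulr0 powR0// gt_eqF// (lt_le_trans _ q1).
by rewrite -powR_mulrn// -powRD ?subrK// Wx implybT.
Qed.

Let cmeasurable_normalize (q : R) f : cmeasurable f -> cmeasurable (normalize q f).
Proof.
move=> mf; apply: cmeasurableM => //; apply: cmeasurable_real.
exact: (measurableT_comp (mWq ((q - 2) / 2) mf) measurable_fst).
Qed.

Lemma energy_normalize (q : R) f : 1 <= q < 2 -> inL2 mu f ->
  (mixnorm12 mu1 mu2 q%:E 2%:E f <= 1)%E -> (energy mu (normalize q f) <= 1)%E.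
Proof.
move=> q12 fL f1; have /andP[q1 q2] := q12.
have q0 : 0 < q by exact: lt_le_trans q1.
have mf := inL2_measurable fL.
rewrite energy_fubini1; last exact: cmeasurable_normalize.
apply: le_trans (int_W q0 fL f1); apply: ae_ge0_le_integral => //.
- exact: (measurable_energy_slice2 mu2 (cmeasurable_normalize q mf)).
- by move=> x _; rewrite lee_fin powR_ge0.
- by apply/measurable_EFinP; exact: mWq.
- have := inL2_slice2 fL; apply: filterS => x fx _.
  have -> : (fun y => normalize q f (x, y)) =
      (fun y => (W f x `^ ((q - 2) / 2))%:C * f (x, y)) by [].
  rewrite energyZ; last exact: inL2_measurable fx.
  by rewrite W_sqr// normcR ger0_norm ?powR_ge0// -EFinM W_weight// W_weightM.
Qed.

Lemma inL2_normalize (q : R) f : 1 <= q < 2 -> inL2 mu f ->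
  (mixnorm12 mu1 mu2 q%:E 2%:E f <= 1)%E -> inL2 mu (normalize q f).
Proof.
move=> q12 fL f1; apply/inL2P; split.
  by apply: cmeasurable_normalize; exact: inL2_measurable fL.
exact: le_lt_trans (energy_normalize q12 fL f1) (ltry _).
Qed.

Section bounds.
Variables (P1 P2 : (T1 * T2 -> R[i]) -> (T1 * T2 -> R[i]))
          (p1 : (T1 -> R[i]) -> (T1 -> R[i])) (p2 : (T2 -> R[i]) -> (T2 -> R[i])).
Hypotheses (cP1 : L2_contraction mu P1) (cp1 : L2_contraction mu1 p1).
Hypotheses (cP2 : L2_contraction mu P2) (cp2 : L2_contraction mu2 p2).
Hypothesis sP1 : forall h, inL2 mu h ->
  {ae mu2, forall y, ae_eq_fun mu1 (fun x => P1 h (x, y)) (p1 (fun x => h (x, y)))}.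
Hypothesis sP2 : forall h, inL2 mu h ->
  {ae mu1, forall x, ae_eq_fun mu2 (fun y => P2 h (x, y)) (p2 (fun y => h (x, y)))}.

Let energy_slice_P2 h : inL2 mu h -> {ae mu1, forall x,
  [/\ inL2 mu2 (fun y => h (x, y)), inL2 mu2 (fun y => P2 h (x, y)) &
   energy mu2 (fun y => P2 h (x, y)) = energy mu2 (p2 (fun y => h (x, y)))]}.
Proof.
move=> hL; have hx := inL2_slice2 hL; have Phx := inL2_slice2 (contr_L2 cP2 hL).
apply: filterS2 (ae_and hx Phx) (sP2 hL) => x [hxL PhxL] hE; split => //.
apply: energy_ae_eq => //; first exact: inL2_measurable PhxL.
exact: inL2_measurable (contr_L2 cp2 hxL).
Qed.

Let p20 : energy mu2 (p2 (fun=> 0)) = 0%E.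
Proof.
apply/eqP; rewrite eq_le energy_ge0 andbT -(energy0 mu2).
by apply: contr_le => //; exact: inL20.
Qed.

(** [lift_bound] with [W x] the norm of the slice at [x] of
    [P2 (restr (B1 `*` B2) f)]. The bound for [p2] compares [W] with the
    slicewise [L^q2] norm of [f], and the two integrals of [lift_bound] become
    equal. *)
Lemma mixed_bound (q1 q2 c1 c2 : R) (B1 : set T1) (B2 : set T2) f :
  1 <= q1 < 2 -> 0 <= c1 -> 0 <= c2 ->
  measurable B1 -> measurable B2 ->
  restriction_bound mu1 q1 B1 p1 c1 -> restriction_bound mu2 q2 B2 p2 c2 ->
  inL2 mu f -> (mixnorm12 mu1 mu2 q1%:E q2%:E f <= 1)%E ->
  (energy mu (P1 (P2 (restr (B1 `*` B2) f))) <= ((c1 * c2) ^+ 2)%:E)%E.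
Proof.
move=> q12 c10 c20 mB1 mB2 H1 H2 fL f1.
have /andP[q11 q1lt] := q12.
have q0 : 0 < q1 by exact: lt_le_trans q11.
have mf := inL2_measurable fL.
have mB : measurable (B1 `*` B2) by exact: measurableX.
have g0L : inL2 mu (restr (B1 `*` B2) f) by exact: inL2_restr.
set g0 := restr (B1 `*` B2) f in g0L *.
set g := P2 g0; have gL : inL2 mu g by exact: contr_L2.
pose G x := energy mu2 (fun y => g (x, y)).
have mG : measurable_fun setT G by exact: (measurable_energy_slice2 mu2 (inL2_measurable gL)).
have mg := inL2_measurable gL.
have key : {ae mu1, forall x, [/\ G x \is a fin_num, (~ B1 x -> G x = 0%E),
    (V q2 f x < +oo)%E & W g x <= c2 * fine (V q2 f x)]}.
  have h1 := Vpow_fin q0 mf f1.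
  apply: filterS2 (ae_and h1 (energy_slice_P2 g0L)) (inL2_slice2 fL).
  move=> x [Voo [g0x gx gE]] fx.
  have Gfin : G x \is a fin_num by exact: inL2_energy.
  have out : ~ B1 x -> G x = 0%E.
    by move=> Bx; rewrite /G gE /g0 slice_restr memNset.
  split => //; have [Bx|Bx] := pselect (B1 x); last first.
    by rewrite /W -/(G x) out// sqrtr0 mulr_ge0// fine_ge0.
  have := H2 _ fx Voo.
  have -> : cLnorm mu2 2%:E (p2 (restr B2 (fun y => f (x, y)))) = (W g x)%:E.
    rewrite cLnorm2E (_ : energy _ _ = G x); last first.
      by rewrite /G gE /g0 slice_restr mem_set.
    by rewrite -(fineK Gfin) poweR_EFin powR12_sqrt// fine_ge0// energy_ge0.
  have Vfin : V q2 f x \is a fin_num by rewrite ge0_fin_numE.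
  by rewrite -/(V q2 f x) -{1}(fineK Vfin) -EFinM lee_fin.
pose M := (\int[mu1]_x (W g x `^ q1)%:E)%E.
have M0 : (0 <= M)%E by apply: integral_ge0 => x _; rewrite lee_fin powR_ge0.
have Mc : (M <= (c2 `^ q1)%:E)%E.
  apply: (@le_trans _ _ (\int[mu1]_x ((c2 `^ q1)%:E * V q2 f x `^ q1))%E).
    apply: ae_ge0_le_integral => //.
    - by move=> x _; rewrite lee_fin powR_ge0.
    - by apply/measurable_EFinP; exact: mWq.
    - by move=> x _; rewrite mule_ge0 ?lee_fin ?powR_ge0 ?poweR_ge0.
    - apply: measurable_funeM.
      apply: (@measurableT_comp _ _ _ _ _ _ (fun x : \bar R => (x `^ q1)%E)).
        exact: measurable_poweR.
      exact: mV.
    - move: key; apply: filterS => x [_ _ Voo Wle] _.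
      have Vfin : V q2 f x \is a fin_num by rewrite ge0_fin_numE.
      rewrite -(fineK Vfin) poweR_EFin -EFinM lee_fin -powRM ?fine_ge0//.
      by apply: ge0_ler_powR; rewrite ?nnegrE ?mulr_ge0 ?fine_ge0// ltW.
  rewrite ge0_integralZl_EFin ?powR_ge0//; last 2 first.
  - by move=> x _; exact: poweR_ge0.
  - apply: (@measurableT_comp _ _ _ _ _ _ (fun x : \bar R => (x `^ q1)%E)).
      exact: measurable_poweR.
    exact: mV.
  rewrite -[leRHS]mule1; apply: lee_wpmul2l; first by rewrite lee_fin powR_ge0.
  exact: int_V.
have Mfin : M \is a fin_num by rewrite ge0_fin_numE// (le_lt_trans Mc (ltry _)).
have AM : (\int[mu1]_x ((W g x `^ (q1 - 2))%:E * G x) = M)%E.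
  apply: ae_eq_integral => //.
  - by apply: emeasurable_funM => //; by apply/measurable_EFinP; exact: mWq.
  - by apply/measurable_EFinP; exact: mWq.
  move: key; apply: filterS => x [Gfin _ _ _] _.
  rewrite -(fineK Gfin) -EFinM; apply: congr1.
  have -> : fine (G x) = W g x ^+ 2 by rewrite sqr_sqrtr// fine_ge0// energy_ge0.
  have [->|Wx] := eqVneq (W g x) 0.
    by rewrite expr0n mulr0 powR0// gt_eqF.
  by rewrite -powR_mulrn// -powRD ?subrK// Wx implybT.
have := lift_bound cP1 cp1 sP1 q12 c10 mB1 H1 gL (mW mg) (W0 g).
rewrite -/M AM => /(_ _ _ _) H.
apply: le_trans (H _ _ _) _.
- move: key; apply: filterS => x [Gfin out _ _] BW.
  have [Bx|Bx] := pselect (B1 x); last exact: out.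
  have : ~ 0 < W g x by move=> Wx; apply: BW.
  move=> /negP; rewrite -leNgt => Wx.
  have /eqP : W g x = 0 by apply/eqP; rewrite eq_le Wx W0.
  rewrite sqrtr_eq0 => Gx; apply/eqP; rewrite eq_le energy_ge0 andbT.
  by rewrite -/(G x) -(fineK Gfin) lee_fin.
- by rewrite -ge0_fin_numE.
- by rewrite -ge0_fin_numE.
have Mr : fine M <= c2 `^ q1 by rewrite -lee_fin fineK.
have fM0 : 0 <= fine M by exact: fine_ge0.
rewrite -(fineK Mfin) poweR_EFin -!EFinM lee_fin exprMn.
apply: ler_wpM2l; first exact: sqr_ge0.
apply: (@le_trans _ _ ((c2 `^ q1) `^ ((2 - q1) / q1) * c2 `^ q1)).
  apply: ler_pM => //; first exact: powR_ge0.
  apply: ge0_ler_powR; rewrite ?nnegrE ?powR_ge0//.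
  by apply: divr_ge0; rewrite ?subr_ge0; exact: ltW.
rewrite -powRrM mulrCA divff ?gt_eqF// mulr1 -powRD; last first.
  by rewrite subrK pnatr_eq0.
by rewrite subrK powR_mulrn.
Qed.

(** [lift_bound] with [W x] the norm of the slice of [f] at [x]. The weighted
    energy of [P2 f] is then the energy of [P2 (normalize q f)]. The right-hand
    side stays exact in [P2], so that it is a measure when [P2] runs
    through spectral projections. *)
Lemma partial_bound (q c : R) (B : set T1) f :
  1 <= q < 2 -> 0 <= c -> measurable B -> restriction_bound mu1 q B p1 c ->
  inL2 mu f -> (mixnorm12 mu1 mu2 q%:E 2%:E f <= 1)%E ->
  (energy mu (P1 (P2 (restr (B `*` setT) f))) <=
     (c ^+ 2)%:E * energy mu (P2 (normalize q f)))%E.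
Proof.
move=> q12 c0 mB H1 fL f1.
have /andP[q11 q1lt] := q12.
have q0 : 0 < q by exact: lt_le_trans q11.
have mf := inL2_measurable fL.
have mBT : measurable (B `*` [set: T2]) by exact: measurableX.
have g0L : inL2 mu (restr (B `*` setT) f) by exact: inL2_restr.
set g0 := restr (B `*` setT) f in g0L *.
set g := P2 g0; have gL : inL2 mu g by exact: contr_L2.
pose G x := energy mu2 (fun y => g (x, y)).
have mG : measurable_fun setT G by exact: (measurable_energy_slice2 mu2 (inL2_measurable gL)).
have hL := inL2_normalize q12 fL f1.
set h := normalize q f in hL *.
have PhL := contr_L2 cP2 hL.
have GE : {ae mu1, forall x, [/\ G x \is a fin_num, (~ B x -> G x = 0%E),
    (B x -> G x <= energy mu2 (fun y => f (x, y)))%E &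
    ((W f x `^ (q - 2))%:E * G x <= energy mu2 (fun y => P2 h (x, y)))%E /\
    inL2 mu2 (fun y => f (x, y))]}.
  apply: filterS2 (ae_and (energy_slice_P2 hL) (energy_slice_P2 g0L)) (inL2_slice2 fL).
  move=> x [[hx Phx PhE] [g0x gx gE]] fx.
  have Gfin : G x \is a fin_num by exact: inL2_energy.
  have mpf := inL2_measurable (contr_L2 cp2 fx).
  have out : ~ B x -> G x = 0%E.
    by move=> Bx; rewrite /G gE /g0 slice_restr memNset.
  have inn : B x -> G x = energy mu2 (p2 (fun y => f (x, y))).
    move=> Bx; rewrite /G gE /g0 slice_restr mem_set//; congr (energy _ (p2 _)).
    by apply/funext => y; rewrite /restr indic_in// mul1r.
  have phE : energy mu2 (fun y => P2 h (x, y)) =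
      ((W f x `^ (q - 2))%:E * energy mu2 (p2 (fun y => f (x, y))))%E.
    have ph := contrZ cp2 ((W f x `^ ((q - 2) / 2))%:C) fx.
    rewrite PhE; transitivity (energy mu2
        (fun y => (W f x `^ ((q - 2) / 2))%:C * p2 (fun y => f (x, y)) y)).
      apply: energy_ae_eq ph => //; last exact: cmeasurableZ.
      exact: inL2_measurable (contr_L2 cp2 (inL2Z _ fx)).
    by rewrite energyZ// normcR ger0_norm ?powR_ge0// W_weight.
  split => //.
  - by move=> /inn ->; exact: (contr_le cp2).
  - split => //; have [Bx|Bx] := pselect (B x); first by rewrite phE inn.
    by rewrite out// mule0 energy_ge0.
have M1 := int_W q0 fL f1.
have A1 : (\int[mu1]_x ((W f x `^ (q - 2))%:E * G x) <= energy mu (P2 h))%E.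
  rewrite (energy_fubini1 _ _ (inL2_measurable PhL)).
  apply: ae_ge0_le_integral => //.
  - by move=> x _; rewrite mule_ge0 ?lee_fin ?powR_ge0 ?energy_ge0.
  - by apply: emeasurable_funM => //; apply/measurable_EFinP; exact: mWq.
  - exact: (measurable_energy_slice2 mu2 (inL2_measurable PhL)).
  - by move: GE; apply: filterS => x [_ _ _ []].
have := lift_bound cP1 cp1 sP1 q12 c0 mB H1 gL (mW mf) (W0 f).
move=> H; apply: le_trans (H _ _ _) _.
- move: GE; apply: filterS => x [Gfin out inn [_ fx]] BW.
  have [Bx|Bx] := pselect (B x); last exact: out.
  have : ~ 0 < W f x by move=> Wx; apply: BW.
  move=> /negP; rewrite -leNgt => Wx.
  have /eqP Wx0 : W f x == 0 by rewrite eq_le Wx W0.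
  apply/eqP; rewrite eq_le energy_ge0 andbT; apply: le_trans (inn Bx) _.
  by rewrite W_sqr// Wx0 expr0n.
- exact: le_lt_trans M1 (ltry _).
- by apply: le_lt_trans A1 _; have /inL2P[] := PhL.
apply: lee_wpmul2l; first by rewrite lee_fin sqr_ge0.
apply: le_trans A1; rewrite -[leRHS]mul1e; apply: lee_wpmul2r.
  by apply: integral_ge0 => x _; rewrite mule_ge0 ?lee_fin ?powR_ge0 ?energy_ge0.
have M0 : (0 <= \int[mu1]_x (W f x `^ q)%:E)%E.
  by apply: integral_ge0 => x _; rewrite lee_fin powR_ge0.
rewrite -(poweR1r ((2 - q) / q)); apply: gt0_ler_poweR M1.
- by apply: divr_ge0; rewrite ?subr_ge0; exact: ltW.
- by rewrite in_itv /= leey andbT.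
- by rewrite in_itv /= leey andbT lee01.
Qed.

End bounds.

End rectangle_bounds.

(** * Balls of a doubling space *)

Section ball.
Context d (R : realType) (X : borelMetricType d R).
Variable mu : {measure set X -> \bar R}.

Lemma ball_open_metric (x : X) (r : R) : open (ball x r).
Proof.
rewrite openE => y xy; apply/nbhs_ballP.
have xyr : mdist x y < r by move: xy; rewrite ballEmdist.
exists (r - mdist x y); first by rewrite /= subr_gt0.
move=> z; rewrite !ballEmdist /= => yz.
by apply: le_lt_trans (metric_triangle x y z) _; rewrite -ltrBrDl.
Qed.

Lemma measurable_ball (x : X) (r : R) : measurable (ball x r).
Proof.
rewrite measurable_borelE; apply: sub_sigma_algebra.
exact: ball_open_metric.
Qed.

Lemma ball_bigcup (x : X) : \bigcup_k ball x k.+1%:R = setT :> set X.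
Proof.
apply/seteqP; split => // y _.
exists (Num.truncn (mdist x y)) => //; rewrite ballEmdist /=.
exact: truncnS_gt.
Qed.

(** By doubling, a null ball makes all balls with the same center null, and they
    cover the space. *)
Lemma doubling_ball_neq0 (n : R) (x : X) (r : R) : doubling mu n ->
  mu setT = +oo%E -> 0 < r -> mu (ball x r) != 0%E.
Proof.
move=> [n0 [C C0 dC]] muT r0; apply/eqP => xr0.
have : mu.-negligible (\bigcup_k ball x k.+1%:R).
  apply: negligible_bigcup => k; apply/negligibleP; first exact: measurable_ball.
  have km : 0 < k.+1%:R :> R by [].
  apply/eqP; rewrite -measure_le0.
  have := dC x (Num.max 1 (k.+1%:R / r)) r.
  rewrite le_max lexx xr0 mule0 => /(_ isT r0); apply: le_trans.
  apply: le_measure; rewrite ?inE; [exact: measurable_ball..|].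
  by apply: le_ball; rewrite -ler_pdivrMr// le_max lexx orbT.
rewrite ball_bigcup => /negligibleP => /(_ measurableT) muT0.
by have : (+oo = 0 :> \bar R)%E by rewrite -muT; exact: muT0.
Qed.

Lemma vol_factor_fin (n p Rd : R) (x : X) (r : R) : doubling mu n ->
  mu setT = +oo%E -> 0 < r -> exists2 k : R, 0 <= k & vol_factor mu n p Rd x r = k%:E.
Proof.
move=> dbl muT r0; rewrite /vol_factor.
have b0 := doubling_ball_neq0 x dbl muT r0.
have [y y0 ->] : exists2 y : R, 0 <= y & (((Rd * r) `^ n)%:E / mu (ball x r))%E = y%:E.
  have bge : (0 <= mu (ball x r))%E by exact: measure_ge0.
  case: (mu (ball x r)) b0 bge => [v|_ _|]//.
  - rewrite eqe lee_fin => v0 vge; exists ((Rd * r) `^ n / v).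
      by rewrite divr_ge0// powR_ge0.
    by rewrite inver (negbTE v0).
  - by exists 0 => //; rewrite invey mule0.
by exists (y `^ (p^-1 - 2^-1)); rewrite ?powR_ge0// poweR_EFin.
Qed.

End ball.

(** * Restriction estimates for spectral projections *)

Section scaling.
Context {R : realType}.

Lemma lebesgue_measure_scale (k : R) (A : set R) : 0 < k -> measurable A ->
  lebesgue_measure A = (k%:E * lebesgue_measure ((fun x => (k * x)%R) @^-1` A))%E.
Proof.
move=> k0 mA.
have mk : measurable_fun setT (fun x : measurableTypeR R => k * x : measurableTypeR R).
  exact: mulrl_measurable.
pose m0 := mscale (NngNum (ltW k0)) (pushforward lebesgue_measure
  (fun x : measurableTypeR R => k * x : measurableTypeR R)).
pose m : {measure set (measurableTypeR R) -> \bar R} := m0 mk.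
have mE B : m B = (k%:E * lebesgue_measure ((fun x => (k * x)%R) @^-1` B))%E by [].
rewrite -mE; apply: (lebesgue_measure_unique (mu := m)) => // _ [[a b] _ <-].
pose I : set R := `](a / k), (b / k)]%classic.
have -> : m `]a, b]%classic = (k%:E * lebesgue_measure I)%E.
  rewrite mE; congr (_ * lebesgue_measure _)%E; apply/seteqP; split => x /=;
  by rewrite /I /= !in_itv /= ltr_pdivrMr// ler_pdivlMr// (mulrC x).
rewrite /I !lebesgue_measure_itv /= !lte_fin ltr_pM2r ?invr_gt0//.
case: ifPn => _; last by rewrite mule0.
by rewrite -!EFinB -EFinM -mulrBl mulrC divfK// gt_eqF.
Qed.

Lemma measurable_sqrt_div (k : R) (Q : set R) : measurable Q ->
  measurable [set t | Q (Num.sqrt t / k)].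
Proof.
move=> mQ; rewrite -[X in measurable X]setTI.
apply: (measurable_funM _ _ measurableT mQ) => //.
by apply: continuous_measurable_fun; exact: sqrt_continuous.
Qed.

End scaling.

Lemma cLnormZ d (T : measurableType d) (R : realType) (mu : {measure set T -> \bar R})
    (p : R) (a : R[i]) f : 0 < p -> cmeasurable f ->
  cLnorm mu p%:E (fun x => a * f x) = ((normc a)%:E * cLnorm mu p%:E f)%E.
Proof.
move=> p0 mf; rewrite !cLnormE.
under eq_integral do rewrite normcM powRM ?normc_ge0// EFinM.
rewrite ge0_integralZl_EFin ?powR_ge0//; last 2 first.
- by move=> x _; rewrite lee_fin powR_ge0.
- apply/measurable_EFinP; apply: (@measurableT_comp _ _ _ _ _ _ (@powR R ^~ p)) => //.
  exact: measurable_normc.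
rewrite poweRM ?lee_fin ?powR_ge0//; last first.
  by apply: integral_ge0 => x _; rewrite lee_fin powR_ge0.
by rewrite poweR_EFin -powRrM divff ?gt_eqF// powRr1// normc_ge0.
Qed.

Section restriction.
Context d (R : realType) (X : borelMetricType d R).
Variable mu : {measure set X -> \bar R}.
Variable E : set R -> (X -> R[i]) -> (X -> R[i]).
Hypothesis specE : spectral_decomposition mu E.

Lemma opnorm_spectral_indic (N : (X -> R[i]) -> \bar R) (B : set X) (A : set R) v :
  measurable A -> inL2 mu v -> (N v <= 1)%E ->
  (cLnorm mu 2%:E (E A (restr B v)) <=
   opnorm mu N (fun f => spectral_integral mu E (fun s => (\1_A s)%:C) (restr B f)))%E.
Proof.
move=> mA vL Nv; apply: le_trans (ereal_sup_ubound _); last by exists v.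
apply: le_ereal_inf_tmp => _ [g /(spectral_integral_indic specE mA) gE <-].
by rewrite !cLnorm2E gE.
Qed.

Lemma restriction_bound_homogeneous (p c : R) (B : set X) (P : (X -> R[i]) -> (X -> R[i])) :
  L2_contraction mu P -> measurable B -> 1 <= p -> 0 <= c ->
  (forall v, inL2 mu v -> (cLnorm mu p%:E v <= 1)%E ->
    (cLnorm mu 2%:E (P (restr B v)) <= c%:E)%E) ->
  restriction_bound mu p B P c.
Proof.
move=> cP mB p1 c0 H u uL uoo.
have p0 : 0 < p by exact: lt_le_trans p1.
have mu_ := inL2_measurable uL.
have BuL := inL2_restr mB uL.
have ufin : cLnorm mu p%:E u \is a fin_num by rewrite ge0_fin_numE// cLnorm_ge0.
have PuL := contr_L2 cP BuL.
have Ht (t : R) : 0 < t -> (cLnorm mu p%:E u <= t%:E)%E ->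
    (cLnorm mu 2%:E (P (restr B u)) <= c%:E * t%:E)%E.
  move=> t0 ut.
  have nt : normc (t^-1%:C : R[i]) = t^-1 by rewrite normcR ger0_norm// invr_ge0 ltW.
  pose v x := t^-1%:C * u x.
  have vL : inL2 mu v by exact: inL2Z.
  have v1 : (cLnorm mu p%:E v <= 1)%E.
    rewrite cLnormZ// nt -(fineK ufin) -EFinM lee_fin mulrC ler_pdivrMr// mul1r.
    by rewrite -lee_fin fineK.
  have := H v vL v1.
  have -> : restr B v = (fun x => t^-1%:C * restr B u x).
    by apply/funext => x; rewrite /restr /v mulrCA.
  have PE := contrZ cP (t^-1%:C) BuL.
  rewrite (cLnorm_ae_eq 2 _ _ PE); last 2 first.
  - exact: inL2_measurable (contr_L2 cP (inL2Z _ BuL)).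
  - exact: cmeasurableZ (inL2_measurable PuL).
  rewrite cLnormZ//; last exact: inL2_measurable PuL.
  by rewrite nt lee_pdivrMl// muleC.
apply/lee_addgt0Pr => /= e e0.
have N0 : 0 <= fine (cLnorm mu p%:E u) by rewrite fine_ge0// cLnorm_ge0.
(* [c + 1] rather than [c], which may be 0 *)
pose dl := e / (c + 1).
have c1 : 0 < c + 1 by rewrite ltr_pwDr.
have dl0 : 0 < dl by rewrite divr_gt0.
apply: le_trans (Ht (fine (cLnorm mu p%:E u) + dl) _ _) _.
- by rewrite ltr_wpDl.
- by rewrite -{1}(fineK ufin) lee_fin lerDl ltW.
rewrite -{2}(fineK ufin) -!EFinM -EFinD lee_fin mulrDr lerD2l /dl mulrCA.
by rewrite ger_pMr// ler_pdivrMr// mul1r lerDl.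
Qed.

(** Apply the restriction estimate to the indicator function of
    [{s | s / Rd \in Q}], whose dilate has [L^2] norm [|Q|^(1/2)]. *)
Lemma restriction_type_bound (n p : R) : 1 <= p -> restriction_type mu n E p ->
  exists2 C : R, 0 < C & forall (Rd r k : R) (x : X) (Q : set R),
    0 < Rd -> Rd^-1 <= r -> 0 <= k -> vol_factor mu n p Rd x r = k%:E ->
    measurable Q -> Q `<=` `[0, 1] ->
    restriction_bound mu p (ball x r) (E [set t | Q (Num.sqrt t / Rd)])
      (C * k * Num.sqrt (fine (lebesgue_measure Q))).
Proof.
move=> p1 [C C0 HC]; exists C => // Rd r k x Q Rd0 Rdr k0 kE mQ Q01.
pose A := [set t | Q (Num.sqrt t / Rd)].
have mA : measurable A by exact: measurable_sqrt_div.
pose F s : R[i] := (\1_Q (s / Rd))%:C.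
have mdiv : measurable_fun setT (fun s : R => s / Rd) by exact: measurable_funM.
have mF : cmeasurable F.
  by apply: cmeasurable_real; apply: measurableT_comp mdiv; exact: measurable_indic.
have sF : supp F `<=` `[0, Rd].
  have cI : closed [set` `[0, Rd]] by exact: itv_closed.
  rewrite [X in _ `<=` X](closure_id _).1//; apply: closure_subset => s /=.
  have [sQ _|sQ] := pselect (Q (s / Rd)); last by rewrite /F indic_out// eqxx.
  have := Q01 _ sQ; rewrite /= !in_itv /= ler_pdivrMr// mul1r.
  by rewrite ler_pdivlMr// mul0r.
have Qoo : (lebesgue_measure Q < +oo)%E.
  apply: (@le_lt_trans _ _ (lebesgue_measure (`[0, 1] : set R))).
    by apply: le_measure => //; rewrite inE.
  by rewrite lebesgue_measure_itv /= lte_fin ltr01 -EFinB ltry.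
apply: restriction_bound_homogeneous => //.
- exact: spectral_L2_contraction.
- exact: measurable_ball.
- by rewrite !mulr_ge0// ?sqrtr_ge0 ?ltW.
move=> v vL v1.
have := HC Rd Rd0 F mF sF x r Rdr.
have FA : (fun t => F (Num.sqrt t)) = (fun t => (\1_A t)%:C) by [].
have FQ : (fun l => F (Rd * l)) = (fun l => (\1_Q l)%:C).
  by apply/funext => l; rewrite /F mulrC mulKf// gt_eqF.
rewrite /fun_sqrt FA FQ kE cLnorm2E energy_indic//.
have Qfin : lebesgue_measure Q \is a fin_num by rewrite ge0_fin_numE.
rewrite -[X in (X `^ _)%E](fineK Qfin) poweR_EFin powR12_sqrt ?fine_ge0// -!EFinM.
by apply: le_trans; exact: opnorm_spectral_indic.
Qed.

(** A continuous operator that vanishes on a set of vectors vanishes on the closure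
    of their span. *)
Lemma contr_null (P : (X -> R[i]) -> (X -> R[i])) (G : set (set X)) f :
  L2_contraction mu P -> G `<=` measurable ->
  (forall C, G C -> (mu C < +oo)%E) ->
  (forall C, G C -> energy mu (P (fun x => (\1_C x)%:C)) = 0%E) ->
  inL2 mu f -> L2_span mu G f -> energy mu (P f) = 0%E.
Proof.
move=> cP GM Goo G0 fL sf; apply/eqP; rewrite eq_le energy_ge0 andbT.
apply/lee_addgt0Pr => /= e e0; rewrite add0e.
have [n [c [A [GA cA]]]] := sf _ (divr_gt0 e0 (ltr0n _ 2)).
have AL i : inL2 mu (fun x => (\1_(A i) x)%:C : R[i]).
  by apply: inL2_indic; [exact: GM|exact: Goo].
have sL : inL2 mu (step_fun c A) by apply: inL2_sum => i; exact: inL2Z.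
have PsL := contr_L2 cP sL; have PfL := contr_L2 cP fL.
have PAL i : inL2 mu (P (fun x => (\1_(A i) x)%:C)) by exact: contr_L2.
have Ps0 : energy mu (P (step_fun c A)) = 0%E.
  have := contr_sum cP (index_enum 'I_n) c AL => h.
  rewrite (energy_ae_eq (inL2_measurable PsL) _ h); last first.
    by apply: inL2_measurable; apply: inL2_sum => i; exact: inL2Z.
  apply/eqP; rewrite eq_le energy_ge0 andbT -(energy0 mu).
  have cPAL i : inL2 mu (fun x => c i * P (fun x => (\1_(A i) x)%:C) x) by exact: inL2Z.
  have cPA0 i : energy mu (fun x => c i * P (fun x => (\1_(A i) x)%:C) x) = 0%E.
    by rewrite (energyZ mu (c i) (inL2_measurable (PAL i))) (G0 _ (GA i)) mule0.
  rewrite energy0; elim: (index_enum _) => [|i r IH].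
    by under [X in energy mu X]eq_fun do rewrite big_nil; rewrite energy0.
  under [X in energy mu X]eq_fun do rewrite big_cons.
  apply: le_trans (energyD _ _ _) _.
  - exact: inL2_measurable (cPAL i).
  - by apply: inL2_measurable; exact: inL2_sum.
  by rewrite cPA0 mule0 add0e mule_ge0_le0.
have -> : P f = (fun x => (P f x - P (step_fun c A) x) + P (step_fun c A) x).
  by apply/funext => x; rewrite subrK.
apply: le_trans (energyD _ _ _) _.
- exact: (inL2_measurable (inL2B PfL PsL)).
- exact: inL2_measurable PsL.
rewrite Ps0 mule0 adde0.
have h2 : (energy mu (fun x => (P f x - P (step_fun c A) x)%R) <= (e / 2)%:E)%E.
  exact: le_trans (contr_dist cP fL sL) (ltW cA).
apply: le_trans (lee_wpmul2l _ h2) _ => //.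
by rewrite -EFinM mulrC divfK.
Qed.

(** On a bounded part of [N] the restriction estimate has right-hand side 0, so
    the projection kills the indicators of bounded sets of finite measure,
    which span a dense subspace. Thus the spectral measures of [sqrt L] are
    absolutely continuous. *)
Lemma restriction_type_null (n p : R) (N : set R) f : 1 <= p ->
  doubling mu n -> mu setT = +oo%E -> restriction_type mu n E p ->
  measurable N -> lebesgue_measure N = 0%E -> inL2 mu f ->
  energy mu (E [set t | N (Num.sqrt t)] f) = 0%E.
Proof.
move=> p1 dbl muT ST mN Nz fL.
have [x0] : exists x0 : X, True.
  apply: contrapT => noX; move: muT.
  by rewrite (_ : setT = set0) ?measure0//; apply/seteqP; split => // y _; case: noX; exists y.
move=> _.
have msqrt : measurable_fun setT (@Num.sqrt R).
  by apply: continuous_measurable_fun; exact: sqrt_continuous.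
have mA : measurable [set t | N (Num.sqrt t)].
  by rewrite -[X in measurable X]setTI; exact: msqrt.
have [C C0 HC] := restriction_type_bound p1 ST.
pose G := [set B | [/\ measurable B, (mu B < +oo)%E & exists k, B `<=` ball x0 k.+1%:R]].
have GM : G `<=` measurable by move=> B [].
apply: (@contr_null _ G) => //.
- exact: spectral_L2_contraction.
- by move=> B [].
- move=> B [mB Boo [k Bk]].
  have BL : inL2 mu (fun x => (\1_B x)%:C : R[i]) by exact: inL2_indic.
  pose A j := [set t | N (Num.sqrt t) /\ Num.sqrt t <= j.+1%:R].
  pose Q (j : nat) := [set s : R | N (j.+1%:R * s) /\ s \in `[0, 1]].
  have mQ j : measurable (Q j).
    apply: measurableI; last exact: measurable_itv.
    by rewrite -[X in measurable X]setTI; apply: (mulrl_measurable j.+1%:R measurableT).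
  have Q0 j : lebesgue_measure (Q j) = 0%E.
    have := lebesgue_measure_scale (ltr0Sn R j) mN; rewrite Nz => /esym/eqP.
    rewrite mule_eq0 eqe pnatr_eq0 /= => /eqP h.
    apply/eqP; rewrite eq_le measure_ge0 andbT -h; apply: le_measure.
    + by apply: mem_set; exact: mQ.
    + apply: mem_set; rewrite -[X in measurable X]setTI; exact: (mulrl_measurable j.+1%:R measurableT).
    + by move=> s [].
  have AQ j : A j = [set t | Q j (Num.sqrt t / j.+1%:R)].
    apply/seteqP; split => t /=.
      move=> [Nt tj]; split; first by rewrite mulrC divfK.
      by rewrite in_itv /= divr_ge0//= ler_pdivrMr// mul1r.
    by rewrite /Q /= mulrC divfK// in_itv /= ler_pdivrMr// mul1r => -[? /andP[]].
  have A0 j : energy mu (E (A j) (fun x => (\1_B x)%:C)) = 0%E.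
    have [v v0 vE] := vol_factor_fin p j.+1%:R x0 dbl muT (ltr0Sn R k).
    have jk : j.+1%:R^-1 <= k.+1%:R :> R.
      by rewrite (@le_trans _ _ 1)// ?ler1n// invf_le1// ler1n.
    have := HC j.+1%:R k.+1%:R v x0 (Q j) (ltr0Sn R j) jk v0 vE (mQ j).
    move=> /(_ (fun s => @proj2 _ _)) /(_ _ BL); rewrite -AQ Q0 sqrtr0 mulr0 mul0e.
    have -> : restr (ball x0 k.+1%:R) (fun x => (\1_B x)%:C) =
        (fun x => (\1_B x)%:C) :> (X -> R[i]).
      apply/funext => x; rewrite /restr; have [Bx|Bx] := pselect (B x).
        by rewrite (indic_in _ (Bk _ Bx)) mul1r.
      by rewrite (indic_out _ Bx) mulr0.
    have Bp : (cLnorm mu p%:E (fun x => (\1_B x)%:C) < +oo)%E.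
      have p0 : p != 0 by rewrite gt_eqF// (lt_le_trans _ p1).
      rewrite cLnormE; apply: poweR_lty; apply: le_lt_trans Boo.
      rewrite -(energy_indic mu mB); apply: ge0_le_integral => //.
      + by move=> x _; rewrite lee_fin powR_ge0.
      + apply/measurable_EFinP; apply: (@measurableT_comp _ _ _ _ _ _ (@powR R ^~ p)) => //.
        exact/measurable_normc/cmeasurable_indic.
      + exact/measurable_normc_sqr/cmeasurable_indic.
      + move=> x _; rewrite lee_fin normc_indic indicE.
        by case: (x \in B); rewrite ?powR1 ?expr1n// powR0// expr0n.
    move=> /(_ Bp) h; rewrite -cLnorm2_sqr; apply/eqP; rewrite poweR_eq0 ?cLnorm_ge0//.
    by rewrite eq_le h cLnorm_ge0 pnatr_eq0.
  have -> : [set t | N (Num.sqrt t)] = \bigcup_j A j.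
    apply/seteqP; split => [t Nt|t [j _ []]//].
    by exists (Num.truncn (Num.sqrt t)) => //; split => //; exact/ltW/truncnS_gt.
  have mAj j : measurable (A j) by rewrite AQ; exact: measurable_sqrt_div.
  have := @negligible_bigcup _ _ _ (spectral_finite_measure specE BL) A.
  move=> /(_ (fun j => _)) h.
  have /negligibleP : (spectral_finite_measure specE BL).-negligible (\bigcup_j A j).
    by apply: h => j; apply/negligibleP => //; exact: A0.
  by apply; exact: bigcupT_measurable.
- apply: (L2_span_trans (G := finite_measurable mu)) => //.
  + by move=> B [].
  + move=> B [mB Boo].
    apply: (@L2_span_nondecreasing _ _ _ _ _ (fun k => B `&` ball x0 k.+1%:R)) => //.
    * by move=> k; apply: measurableI => //; exact: measurable_ball.
    * by move=> k m km; apply: setIS; apply: le_ball; rewrite ler_nat.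
    * by rewrite -setI_bigcupr ball_bigcup setIT.
    * move=> k; apply: L2_span_indic; split.
      - by apply: measurableI => //; exact: measurable_ball.
      - apply: le_lt_trans Boo; apply: le_measure; rewrite ?inE//.
        by apply: measurableI => //; exact: measurable_ball.
      - by exists k.
  + exact: inL2_measurable fL.
  + exact: inL2_span.
Qed.

End restriction.

(** * From spectral measures to operator norms *)

Section opnorm.
Context d (T : measurableType d) (R : realType).
Variable mu : {measure set T -> \bar R}.
Context d' (S : measurableType d').
Variable E : set S -> (T -> R[i]) -> (T -> R[i]).
Hypothesis specE : spectral_decomposition mu E.

Lemma opnorm_spectral_le (N : (T -> R[i]) -> \bar R) (B : set T)
    (phi : S -> R[i]) (M : \bar R) :
  cmeasurable phi -> measurable B -> (0 <= M)%E ->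
  (forall f (fL : inL2 mu (restr B f)), inL2 mu f -> (N f <= 1)%E ->
    (energy (spectral_finite_measure specE fL) phi <= M `^ 2)%E) ->
  (opnorm mu N (fun f => spectral_integral mu E phi (restr B f)) <= M)%E.
Proof.
move=> mphi mB M0 H; have [->|Moo] := eqVneq M +oo%E; first exact: leey.
apply: ge_ereal_sup => _ [f [fL Nf] <-].
have BfL := inL2_restr mB fL.
have Hf := H f BfL fL Nf.
have phiL : inL2 (spectral_finite_measure specE BfL) phi.
  apply/inL2P; split => //; apply: le_lt_trans Hf _; apply: poweR_lty.
  by rewrite ltey.
have [g [gI gE]] := spectral_integral_exists phiL.
apply: (@le_trans _ _ (cLnorm mu 2%:E g)); first by apply: ereal_inf_lbound; exists g.
rewrite cLnorm2E; apply: (@le_trans _ _ ((M `^ 2) `^ 2^-1)%E).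
  apply: gt0_ler_poweR (le_trans gE Hf); rewrite ?invr_ge0//.
  - by rewrite in_itv /= energy_ge0 leey.
  - by rewrite in_itv /= poweR_ge0 leey.
by rewrite -poweRrM divff ?pnatr_eq0// poweRe1.
Qed.

End opnorm.

Section rectangle_domination.
Context d (S : measurableType d) d1 d2 (T1 : measurableType d1)
  (T2 : measurableType d2) (R : realType).

(** The image of [nu] under [psi], restricted to the box that carries [D], is
    dominated by [m] on rectangles, hence as a measure. *)
Lemma energy_le_rectangles (nu : {measure set S -> \bar R})
    (m : {measure set (T1 * T2) -> \bar R}) (psi : S -> T1 * T2)
    (K1 : set T1) (K2 : set T2) (D : T1 * T2 -> R[i]) :
  (nu setT < +oo)%E -> (m setT < +oo)%E -> measurable_fun setT psi ->
  measurable K1 -> measurable K2 ->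
  (forall Q1 Q2, measurable Q1 -> measurable Q2 -> Q1 `<=` K1 -> Q2 `<=` K2 ->
    (nu (psi @^-1` (Q1 `*` Q2)) <= m (Q1 `*` Q2))%E) ->
  cmeasurable D -> (forall z, ~ (K1 `*` K2) z -> D z = 0) ->
  (energy nu (fun s => D (psi s)) <= energy m D)%E.
Proof.
move=> nuoo moo mpsi mK1 mK2 H mD D0.
have mK : measurable (K1 `*` K2) by exact: measurableX.
pose g z := (normc (D z) ^+ 2)%:E.
have mg : measurable_fun setT g by exact: measurable_normc_sqr.
have g0 z : (0 <= g z)%E by rewrite lee_fin sqr_ge0.
have gK : g \_ (K1 `*` K2) = g.
  apply/funext => z; rewrite patchE; case: ifPn => // /negP zK.
  rewrite /g D0 ?normc0 ?expr0n// => zK'; apply: zK; exact: mem_set.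
have mpre Q : measurable Q -> measurable (psi @^-1` Q).
  by move=> mQ; rewrite -[X in measurable X]setTI; exact: mpsi.
pose pf0 := pushforward nu psi : {measure set (T1 * T2) -> \bar R}.
pose pf : {measure set (T1 * T2) -> \bar R} := pf0 mpsi.
have pfE C : pf C = nu (psi @^-1` C) by [].
pose pfK := mrestr pf mK.
have pfKE C : pfK C = nu (psi @^-1` (C `&` (K1 `*` K2))) by [].
have -> : energy nu (fun s => D (psi s)) = (\int[pf]_z g z)%E.
  rewrite (ge0_integral_pushforward mpsi nu measurableT mg) ?preimage_setT//.
rewrite /energy -/g -gK -!integral_mkcond -/pf.
apply: (@le_trans _ _ (\int[pfK]_(z in K1 `*` K2) g z)%E).
  rewrite (eq_measure_integral pfK)//.
  by move=> C mC CK; rewrite /pfK /= /mrestr setIidl.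
apply: ge0_le_measure_integral => // C mC.
apply: measure_le_rectangles => //.
- have mK' : measurable (psi @^-1` (setT `&` K1 `*` K2)) by apply: mpre; rewrite setTI.
  have h : (nu (psi @^-1` (setT `&` K1 `*` K2)) < +oo)%E.
    by apply: le_lt_trans nuoo; apply: le_measure => //; exact: mem_set.
  exact: h.
- move=> Q1 Q2 mQ1 mQ2; rewrite /= /mrestr.
  have -> : (Q1 `*` Q2) `&` (K1 `*` K2) = (Q1 `&` K1) `*` (Q2 `&` K2).
    by apply/seteqP; split => z /= [] [? ?] [? ?].
  apply: (@le_trans _ _ (m ((Q1 `&` K1) `*` (Q2 `&` K2)))).
    by apply: H => //; exact: measurableI.
  apply: le_measure; rewrite ?inE//.
  - by apply: measurableX; exact: measurableI.
  - exact: measurableX.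
  - by move=> z [[? ?] [? ?]].
Qed.

End rectangle_domination.

(** * The joint spectral projections *)

Section joint.
Context d1 d2 (T1 : measurableType d1) (T2 : measurableType d2) (R : realType).
Variables (mu1 : {sigma_finite_measure set T1 -> \bar R})
          (mu2 : {sigma_finite_measure set T2 -> \bar R}).
Local Notation mu := (mu1 \x mu2)%E.

Lemma ae_prod1 (Q : T1 -> Prop) : {ae mu1, forall x, Q x} ->
  {ae mu, forall z, Q z.1}.
Proof.
move=> [N [mN N0 NQ]]; exists (N `*` setT); split.
- exact: measurableX.
- rewrite product_measure1E//; apply/eqP; rewrite mule_eq0; apply/orP; left.
  by apply/eqP; exact: N0.
- by move=> z Qz; split => //; exact: NQ.
Qed.

Lemma ae_prod2 (Q : T2 -> Prop) : {ae mu2, forall y, Q y} ->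
  {ae mu, forall z, Q z.2}.
Proof.
move=> [N [mN N0 NQ]]; exists (setT `*` N); split.
- exact: measurableX.
- by rewrite product_measure1E// N0 mule0.
- by move=> z Qz; split => //; exact: NQ.
Qed.

Variables (E1 : set R -> (T1 -> R[i]) -> (T1 -> R[i]))
          (E2 : set R -> (T2 -> R[i]) -> (T2 -> R[i]))
          (E : set (R * R) -> (T1 * T2 -> R[i]) -> (T1 * T2 -> R[i])).
Hypotheses (specE1 : spectral_decomposition mu1 E1)
           (specE2 : spectral_decomposition mu2 E2)
           (specE : spectral_decomposition mu E)
           (tensorE : tensor_decomposition mu1 mu2 E1 E2 E).

Let tensor_indic A B : (fun z => (\1_(A `*` B) z)%:C) =
  tensor (fun x : T1 => (\1_A x)%:C) (fun y : T2 => (\1_B y)%:C) :> (_ -> R[i]).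
Proof.
apply/funext => -[x y]; rewrite /tensor /= -rmorphM; congr (_%:C).
by rewrite !indicE in_setX /=; case: (x \in A); rewrite ?mul1r ?mul0r.
Qed.

(** The product projection is the tensor product of [E1 A] with the identity, so
    it acts on each slice in the first variable as [E1 A]. *)
Lemma joint_slice1 (A : set R) : measurable A -> forall h, inL2 mu h ->
  {ae mu2, forall y, ae_eq_fun mu1 (fun x => E (A `*` setT) h (x, y))
                                   (E1 A (fun x => h (x, y)))}.
Proof.
move=> mA; have mAT : measurable (A `*` [set: R]) by exact: measurableX.
apply: slice1_contraction.
- exact: spectral_L2_contraction.
- exact: spectral_L2_contraction.
move=> B C mB Boo mC Coo; rewrite tensor_indic.
have BL : inL2 mu1 (fun x => (\1_B x)%:C : R[i]) by exact: inL2_indic.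
have CL : inL2 mu2 (fun x => (\1_C x)%:C : R[i]) by exact: inL2_indic.
apply: filterS2 (tensorE mA measurableT BL CL) (ae_prod2 (sd_setT specE2 CL)).
by move=> z -> /= h; rewrite /tensor h.
Qed.

Lemma joint_slice2 (A : set R) : measurable A -> forall h, inL2 mu h ->
  {ae mu1, forall x, ae_eq_fun mu2 (fun y => E (setT `*` A) h (x, y))
                                   (E2 A (fun y => h (x, y)))}.
Proof.
move=> mA; have mAT : measurable ([set: R] `*` A) by exact: measurableX.
apply: slice2_contraction.
- exact: spectral_L2_contraction.
- exact: spectral_L2_contraction.
move=> B C mB Boo mC Coo; rewrite tensor_indic.
have BL : inL2 mu1 (fun x => (\1_B x)%:C : R[i]) by exact: inL2_indic.
have CL : inL2 mu2 (fun x => (\1_C x)%:C : R[i]) by exact: inL2_indic.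
apply: filterS2 (tensorE measurableT mA BL CL) (ae_prod1 (sd_setT specE1 BL)).
by move=> z -> /= h; rewrite /tensor h.
Qed.

Let energy_rect A1 A2 f : measurable A1 -> measurable A2 -> inL2 mu f ->
  energy mu (E (A1 `*` A2) f) = energy mu (E (A1 `*` setT) (E (setT `*` A2) f)).
Proof.
move=> mA1 mA2 fL.
have m1 : measurable (A1 `*` [set: R]) by exact: measurableX.
have m2 : measurable ([set: R] `*` A2) by exact: measurableX.
have -> : A1 `*` A2 = (A1 `*` setT) `&` (setT `*` A2).
  by apply/seteqP; split => z /=; [move=> [? ?]|move=> [[? _] [_ ?]]].
apply: energy_ae_eq (sd_mul specE m1 m2 fL).
- by apply: inL2_measurable; apply: (sd_L2 specE) => //; exact: measurableI.
- by apply: inL2_measurable; do 2 apply: (sd_L2 specE) => //.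
Qed.

Lemma joint_mixed_bound (q1 q2 c1 c2 : R) (B1 : set T1) (B2 : set T2) A1 A2 f :
  1 <= q1 < 2 -> 0 <= c1 -> 0 <= c2 ->
  measurable B1 -> measurable B2 -> measurable A1 -> measurable A2 ->
  restriction_bound mu1 q1 B1 (E1 A1) c1 -> restriction_bound mu2 q2 B2 (E2 A2) c2 ->
  inL2 mu f -> (mixnorm12 mu1 mu2 q1%:E q2%:E f <= 1)%E ->
  (energy mu (E (A1 `*` A2) (restr (B1 `*` B2) f)) <= ((c1 * c2) ^+ 2)%:E)%E.
Proof.
move=> q12 c10 c20 mB1 mB2 mA1 mA2 H1 H2 fL f1.
have mB : measurable (B1 `*` B2) by exact: measurableX.
have m1 : measurable (A1 `*` [set: R]) by exact: measurableX.
have m2 : measurable ([set: R] `*` A2) by exact: measurableX.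
rewrite energy_rect//; last exact: inL2_restr.
exact: (mixed_bound (spectral_L2_contraction specE m1)
  (spectral_L2_contraction specE1 mA1) (spectral_L2_contraction specE m2)
  (spectral_L2_contraction specE2 mA2) (joint_slice1 mA1) (joint_slice2 mA2)
  q12 c10 c20 mB1 mB2 H1 H2 fL f1).
Qed.

Lemma joint_partial_bound (q c : R) (B : set T1) A1 A2 f :
  1 <= q < 2 -> 0 <= c -> measurable B -> measurable A1 -> measurable A2 ->
  restriction_bound mu1 q B (E1 A1) c ->
  inL2 mu f -> (mixnorm12 mu1 mu2 q%:E 2%:E f <= 1)%E ->
  (energy mu (E (A1 `*` A2) (restr (B `*` setT) f)) <=
     (c ^+ 2)%:E * energy mu (E (setT `*` A2) (normalize mu2 q f)))%E.
Proof.
move=> q12 c0 mB mA1 mA2 H1 fL f1.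
have mBT : measurable (B `*` [set: T2]) by exact: measurableX.
have m1 : measurable (A1 `*` [set: R]) by exact: measurableX.
have m2 : measurable ([set: R] `*` A2) by exact: measurableX.
rewrite energy_rect//; last exact: inL2_restr.
exact: (partial_bound (spectral_L2_contraction specE m1)
  (spectral_L2_contraction specE1 mA1) (spectral_L2_contraction specE m2)
  (spectral_L2_contraction specE2 mA2) (joint_slice1 mA1) (joint_slice2 mA2)).
Qed.

Lemma joint_null A2 h : measurable A2 -> inL2 mu h ->
  (forall u, inL2 mu2 u -> energy mu2 (E2 A2 u) = 0%E) ->
  energy mu (E (setT `*` A2) h) = 0%E.
Proof.
move=> mA2 hL H.
have m2 : measurable ([set: R] `*` A2) by exact: measurableX.
have EhL : inL2 mu (E (setT `*` A2) h) by exact: (sd_L2 specE).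
rewrite energy_fubini1; last exact: inL2_measurable EhL.
apply: etrans (integral0 mu1 setT); apply: ae_eq_integral => //.
  exact: (measurable_energy_slice2 mu2 (inL2_measurable EhL)).
apply: filterS2 (ae_and (inL2_slice2 hL) (inL2_slice2 EhL)) (joint_slice2 mA2 hL).
move=> x [hx Ehx] hE _; rewrite -(H _ hx); apply: energy_ae_eq hE.
- exact: inL2_measurable Ehx.
- exact: inL2_measurable (sd_L2 specE2 mA2 hx).
Qed.

End joint.

(** * Multipliers on the unit strip *)

Section unit_lebesgue.
Context {R : realType}.

Let mI : measurable (`[0, 1]%classic : set (measurableTypeR R)).
Proof. exact: measurable_itv. Qed.

Let Ioo : (lebesgue_measure (`[0%R, 1%R]%classic : set (measurableTypeR R)) < +oo)%E.
Proof. by rewrite lebesgue_measure_itv /= lte_fin ltr01 -EFinB ltry. Qed.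

Definition unit_lebesgue : {finite_measure set (measurableTypeR R) -> \bar R} :=
  mfrestr mI Ioo.

Lemma unit_lebesgueE C : C `<=` `[0, 1] -> unit_lebesgue C = lebesgue_measure C.
Proof. by move=> CI; rewrite /unit_lebesgue /= /mfrestr /mrestr setIidl. Qed.

Lemma unit_lebesgue_le C : measurable C -> (unit_lebesgue C <= lebesgue_measure C)%E.
Proof.
move=> mC; apply: le_measure => //; apply: mem_set => //.
exact: measurableI.
Qed.

End unit_lebesgue.

Lemma le_energy_measure d (T : measurableType d) (R : realType)
    (m1 m2 : {measure set T -> \bar R}) f : cmeasurable f ->
  (forall C, measurable C -> (m1 C <= m2 C)%E) -> (energy m1 f <= energy m2 f)%E.
Proof.
move=> mf m12; apply: ge0_le_measure_integral => //; last exact: measurable_normc_sqr.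
by move=> x; rewrite lee_fin sqr_ge0.
Qed.

Lemma energy_mscale d (T : measurableType d) (R : realType)
    (m : {measure set T -> \bar R}) (k : {nonneg R}) f : cmeasurable f ->
  energy (mscale k m) f = (k%:num%:E * energy m f)%E.
Proof.
move=> mf; rewrite /energy ge0_integral_mscale//; first exact: measurable_normc_sqr.
by move=> x _; rewrite lee_fin sqr_ge0.
Qed.

Section multiplier_bounds.
Context d (S : measurableType d) (R : realType).
Local Notation leb := (@lebesgue_measure R).
Variables (nu : {measure set S -> \bar R}) (psi : S -> R * R).
Hypotheses (nuoo : (nu setT < +oo)%E) (mpsi : measurable_fun setT psi).

Lemma mixed_multiplier (K : R) (D : R * R -> R[i]) : 0 <= K ->
  (forall Q1 Q2 : set R, measurable Q1 -> measurable Q2 -> Q1 `<=` `[0, 1] -> Q2 `<=` `[0, 1] ->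
    (nu (psi @^-1` (Q1 `*` Q2)) <= (K ^+ 2)%:E * (leb Q1 * leb Q2))%E) ->
  cmeasurable D -> (forall z : R * R, ~ (`[0, 1] `*` `[0, 1]) z -> D z = 0) ->
  (energy nu (fun s => D (psi s)) <= (K%:E * cLnorm (leb \x leb)%E 2%:E D) `^ 2)%E.
Proof.
move=> K0 H mD D0.
pose k := NngNum (sqr_ge0 K).
pose m := mscale k (unit_lebesgue \x unit_lebesgue)%E.
have mE (Q1 Q2 : set R) : measurable Q1 -> measurable Q2 ->
    m (Q1 `*` Q2) = ((K ^+ 2)%:E * (unit_lebesgue Q1 * unit_lebesgue Q2))%E.
  by move=> mQ1 mQ2; rewrite -(product_measure1E unit_lebesgue unit_lebesgue mQ1 mQ2).
have moo : (m (setT `*` setT) < +oo)%E.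
  rewrite mE// -ge0_fin_numE; last by rewrite !mule_ge0// lee_fin sqr_ge0.
  by rewrite fin_numM// fin_numM// fin_num_measure.
have le1 : (energy nu (fun s => D (psi s)) <= energy m D)%E.
  apply: (@energy_le_rectangles _ S _ _ (measurableTypeR R) (measurableTypeR R) R nu m psi
    `[0, 1]%classic `[0, 1]%classic D) => //.
  - by rewrite -setXTT; exact: moo.
  - move=> Q1 Q2 mQ1 mQ2 QI1 QI2; apply: le_trans (H _ _ mQ1 mQ2 QI1 QI2) _.
    by have := mE _ _ mQ1 mQ2; rewrite !unit_lebesgueE// => <-.
apply: le_trans le1 _; rewrite energy_mscale//.
have L0 : (0 <= cLnorm (leb \x leb)%E 2%:E D)%E by exact: cLnorm_ge0.
have K0' : (0 <= K%:E)%E by rewrite lee_fin.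
rewrite (poweRM _ K0' L0) cLnorm2_sqr poweR_EFin.
rewrite (powR_mulrn _ K0).
apply: lee_wpmul2l; first by rewrite lee_fin sqr_ge0.
rewrite !energy_fubini1//; apply: (@le_trans _ _
    (\int[unit_lebesgue]_x energy leb (fun y => D (x, y)))%E).
  apply: ge0_le_integral => //.
  - exact: (measurable_energy_slice2 unit_lebesgue mD).
  - exact: (measurable_energy_slice2 leb mD).
  - move=> x _; apply: le_energy_measure; first exact: cmeasurable_slice2.
    exact: unit_lebesgue_le.
apply: ge0_le_measure_integral => //; last exact: (measurable_energy_slice2 leb mD).
exact: unit_lebesgue_le.
Qed.

(** Integrating first in the first variable bounds the inner integral by the
    square of the essential supremum for almost every [y]; as [kappa] is
    absolutely continuous, this also holds [kappa]-almost everywhere, and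
    [kappa] has mass at most 1. *)
Lemma partial_multiplier (K : R) (kappa : {measure set R -> \bar R}) (D : R * R -> R[i]) :
  0 <= K -> (kappa setT <= 1)%E ->
  (forall N : set R, measurable N -> leb N = 0%E -> kappa N = 0%E) ->
  (forall Q1 Q2 : set R, measurable Q1 -> measurable Q2 -> Q1 `<=` `[0, 1] ->
    (nu (psi @^-1` (Q1 `*` Q2)) <= (K ^+ 2)%:E * leb Q1 * kappa Q2)%E) ->
  cmeasurable D -> (forall z, ~ `[0, 1]%classic z.1 -> D z = 0) ->
  (energy nu (fun s => D (psi s)) <=
    (K%:E * Lnorm leb +oo (fun y => cLnorm leb 2%:E (fun x => (D (x, y))%R))) `^ 2)%E.
Proof.
move=> K0 kT kac H mD D0.
have koo : (kappa setT < +oo)%E by exact: le_lt_trans kT (ltry _).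
(* [kappa] again, as a finite measure, to form product measures *)
pose kf : {finite_measure set R -> \bar R} := mfrestr measurableT koo.
have kfE C : kf C = kappa C by rewrite /kf /= /mfrestr /mrestr setIT.
have kf1 : (kf setT <= 1)%E by rewrite kfE.
pose k := NngNum (sqr_ge0 K).
pose m := mscale k (unit_lebesgue \x kf)%E.
have mE (Q1 Q2 : set R) : measurable Q1 -> measurable Q2 ->
    m (Q1 `*` Q2) = ((K ^+ 2)%:E * (unit_lebesgue Q1 * kappa Q2))%E.
  by move=> mQ1 mQ2; rewrite -kfE -(product_measure1E unit_lebesgue kf mQ1 mQ2).
have moo : (m (setT `*` setT) < +oo)%E.
  rewrite mE// -ge0_fin_numE; last by rewrite !mule_ge0// lee_fin sqr_ge0.
  by rewrite fin_numM// fin_numM// ?fin_num_measure// ge0_fin_numE.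
have le1 : (energy nu (fun s => D (psi s)) <= energy m D)%E.
  apply: (@energy_le_rectangles _ S _ _ (measurableTypeR R) R R nu m psi
    `[0, 1]%classic setT D) => //.
  - by rewrite -setXTT; exact: moo.
  - move=> Q1 Q2 mQ1 mQ2 QI1 QI2; apply: le_trans (H _ _ mQ1 mQ2 QI1) _.
    by have := mE _ _ mQ1 mQ2; rewrite !unit_lebesgueE// muleA => <-.
  - by move=> z zK; apply: D0 => z1; apply: zK.
apply: le_trans le1 _; rewrite energy_mscale//.
set L := Lnorm _ _ _.
have L0 : (0 <= L)%E by exact: Lnorm_ge0.
rewrite poweRM// poweR_EFin powR_mulrn//.
apply: lee_wpmul2l; first by rewrite lee_fin sqr_ge0.
rewrite energy_fubini2//.
apply: (@le_trans _ _ (\int[kf]_y (L `^ 2))%E); last first.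
  rewrite integral_cst// -[leRHS]mule1; apply: lee_wpmul2l; first exact: poweR_ge0.
  exact: kf1.
have msl := measurable_energy_slice1 unit_lebesgue mD.
apply: ae_ge0_le_integral => //; first by move=> y _; exact: poweR_ge0.
have Lae : {ae leb, forall y, (cLnorm leb 2%:E (fun x => (D (x, y))%R) <= L)%E}.
  rewrite /L unlock.
  have -> : (0 < leb setT)%E.
    apply: (@lt_le_trans _ _ (leb `[0%R, 1%R]%classic)).
      by rewrite lebesgue_measure_itv /= lte_fin ltr01 -EFinB subr0 lte_fin.
    by apply: le_measure => //; apply: mem_set => //; exact: measurable_itv.
  have := @ess_sup_ge _ _ _ leb (abse \o (fun y => cLnorm leb 2%:E (fun x => D (x, y)))).
  by apply: filterS => y /=; rewrite gee0_abs// cLnorm_ge0.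
have {}Lae : {ae kf, forall y, (cLnorm leb 2%:E (fun x => (D (x, y))%R) <= L)%E}.
  have [N [mN N0 NL]] := Lae; exists N; split => //.
  by rewrite kfE; exact: kac.
apply: filterS Lae => y yL _.
apply: (@le_trans _ _ (energy leb (fun x => D (x, y)))).
  apply: le_energy_measure; first exact: cmeasurable_slice1.
  exact: unit_lebesgue_le.
rewrite -cLnorm2_sqr; apply: gt0_ler_poweR yL => //.
- by rewrite in_itv /= cLnorm_ge0 leey.
- by rewrite in_itv /= L0 leey.
Qed.

End multiplier_bounds.

(** * Exchanging the two factors *)

Section swapped.
Context d1 d2 (T1 : measurableType d1) (T2 : measurableType d2) (R : realType).
Variables (mu1 : {sigma_finite_measure set T1 -> \bar R})
          (mu2 : {sigma_finite_measure set T2 -> \bar R}).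
Local Notation mu := (mu1 \x mu2)%E.
Variables (E1 : set R -> (T1 -> R[i]) -> (T1 -> R[i]))
          (E2 : set R -> (T2 -> R[i]) -> (T2 -> R[i]))
          (E : set (R * R) -> (T1 * T2 -> R[i]) -> (T1 * T2 -> R[i])).
Hypotheses (specE1 : spectral_decomposition mu1 E1)
           (specE2 : spectral_decomposition mu2 E2)
           (specE : spectral_decomposition mu E)
           (tensorE : tensor_decomposition mu1 mu2 E1 E2 E).

Let swapK (f : T1 * T2 -> R[i]) : swap_fun (swap_fun f) = f.
Proof. by apply/funext => -[]. Qed.

Let swapK' (f : T2 * T1 -> R[i]) : swap_fun (swap_fun f) = f.
Proof. by apply/funext => -[]. Qed.

(** [partial_bound] on the product taken in the other order, for the operators
    transported by the exchange of variables. *)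
Lemma joint_partial_bound_swap (q c : R) (B : set T2) A1 A2 f :
  1 <= q < 2 -> 0 <= c -> measurable B -> measurable A1 -> measurable A2 ->
  restriction_bound mu2 q B (E2 A2) c ->
  inL2 mu f -> (mixnorm21 mu1 mu2 q%:E 2%:E f <= 1)%E ->
  (energy mu (E (A1 `*` A2) (restr (setT `*` B) f)) <=
     (c ^+ 2)%:E *
     energy mu (E (A1 `*` setT) (swap_fun (normalize mu1 q (swap_fun f)))))%E.
Proof.
move=> q12 c0 mB mA1 mA2 H2 fL f1.
have mTB : measurable ([set: T1] `*` B) by exact: measurableX.
have m1 : measurable (A1 `*` [set: R]) by exact: measurableX.
have m2 : measurable ([set: R] `*` A2) by exact: measurableX.
have BfL : inL2 mu (restr (setT `*` B) f) by exact: inL2_restr.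
have E1L : inL2 mu (E (A1 `*` setT) (restr (setT `*` B) f)) by exact: (sd_L2 specE).
have E2L : inL2 mu (E (setT `*` A2) (E (A1 `*` setT) (restr (setT `*` B) f))).
  exact: (sd_L2 specE).
have -> : energy mu (E (A1 `*` A2) (restr (setT `*` B) f)) =
    energy mu (E (setT `*` A2) (E (A1 `*` setT) (restr (setT `*` B) f))).
  have -> : A1 `*` A2 = (setT `*` A2) `&` (A1 `*` setT).
    by apply/seteqP; split => z /=; [move=> [? ?]|move=> [[_ ?] [? _]]].
  apply: energy_ae_eq (sd_mul specE m2 m1 BfL).
  - by apply: inL2_measurable; apply: (sd_L2 specE) => //; exact: measurableI.
  - exact: inL2_measurable E2L.
have sfL := inL2_swap fL.
have nL : inL2 (mu2 \x mu1)%E (normalize mu1 q (swap_fun f)) by exact: inL2_normalize.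
have nEL : inL2 mu (E (A1 `*` setT) (swap_fun (normalize mu1 q (swap_fun f)))).
  exact: (sd_L2 specE m1 (inL2_swap nL)).
have s1 h : inL2 (mu2 \x mu1)%E h -> {ae mu1, forall y, ae_eq_fun mu2
    (fun x => swap_op (E (setT `*` A2)) h (x, y)) (E2 A2 (fun x => h (x, y)))}.
  by move=> /inL2_swap /(joint_slice2 specE1 specE2 specE tensorE mA2).
have s2 h : inL2 (mu2 \x mu1)%E h -> {ae mu2, forall x, ae_eq_fun mu1
    (fun y => swap_op (E (A1 `*` setT)) h (x, y)) (E1 A1 (fun y => h (x, y)))}.
  by move=> /inL2_swap /(joint_slice1 specE1 specE2 specE tensorE mA1).
have := partial_bound (swap_contraction (spectral_L2_contraction specE m2))
  (spectral_L2_contraction specE2 mA2)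
  (swap_contraction (spectral_L2_contraction specE m1))
  (spectral_L2_contraction specE1 mA1) s1 s2 q12 c0 mB H2 sfL f1.
rewrite /swap_op swapK.
have -> : swap_fun (restr (B `*` setT) (swap_fun f)) = restr (setT `*` B) f.
  apply/funext => -[x y]; rewrite /swap_fun /restr /= !indicE !in_setX /=.
  by rewrite !in_setT andbT.
rewrite energy_swap; last exact: inL2_measurable E2L.
by rewrite energy_swap; last exact: inL2_measurable nEL.
Qed.

Lemma joint_null_swap A1 h : measurable A1 -> inL2 mu h ->
  (forall u, inL2 mu1 u -> energy mu1 (E1 A1 u) = 0%E) ->
  energy mu (E (A1 `*` setT) h) = 0%E.
Proof.
move=> mA1 hL H.
have m1 : measurable (A1 `*` [set: R]) by exact: measurableX.
have EhL : inL2 mu (E (A1 `*` setT) h) by exact: (sd_L2 specE).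
rewrite energy_fubini2; last exact: inL2_measurable EhL.
apply: etrans (integral0 mu2 setT); apply: ae_eq_integral => //.
  exact: (measurable_energy_slice1 mu1 (inL2_measurable EhL)).
have hs := inL2_slice2 (inL2_swap hL).
have Ehs := inL2_slice2 (inL2_swap EhL).
apply: filterS2 (ae_and hs Ehs) (joint_slice1 specE1 specE2 specE tensorE mA1 hL).
move=> y [hy Ehy] hE _; rewrite -(H _ hy); apply: energy_ae_eq hE.
- exact: inL2_measurable Ehy.
- exact: inL2_measurable (sd_L2 specE1 mA1 hy).
Qed.

End swapped.

Section partial_opnorm.
Context d (T : measurableType d) (R : realType) (mu : {measure set T -> \bar R}).
Variable E : set (R * R) -> (T -> R[i]) -> (T -> R[i]).
Hypothesis specE : spectral_decomposition mu E.
Local Notation leb := (@lebesgue_measure R).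

(** The measure [kappa] of [partial_multiplier] is the distribution of the
    second component of [psi] under the spectral measure of [h]. *)
Lemma partial_opnorm (N : (T -> R[i]) -> \bar R) (B : set T) (psi : R * R -> R * R)
    (K : R) (D : R * R -> R[i]) :
  measurable B -> measurable_fun setT psi -> 0 <= K ->
  cmeasurable D -> (forall z, ~ `[0, 1]%classic z.1 -> D z = 0) ->
  (forall f, inL2 mu f -> (N f <= 1)%E -> exists h,
    [/\ inL2 mu h, (energy mu h <= 1)%E,
      forall Q1 Q2 : set R, measurable Q1 -> measurable Q2 -> Q1 `<=` `[0, 1] ->
       (energy mu (E (psi @^-1` (Q1 `*` Q2)) (restr B f)) <=
        (K ^+ 2)%:E * leb Q1 * energy mu (E (psi @^-1` (setT `*` Q2)) h))%E &
      forall Q2 : set R, measurable Q2 -> leb Q2 = 0%E ->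
       energy mu (E (psi @^-1` (setT `*` Q2)) h) = 0%E]) ->
  (opnorm mu N (fun f => spectral_integral mu E (fun t => D (psi t)) (restr B f)) <=
   K%:E * Lnorm leb +oo (fun y => cLnorm leb 2%:E (fun x => (D (x, y))%R)))%E.
Proof.
move=> mB mpsi K0 mD D0 H.
apply: (@opnorm_spectral_le _ _ _ mu _ _ E specE N B (fun t => D (psi t))) => //.
- exact: cmeasurable_comp mD mpsi.
- by rewrite mule_ge0 ?lee_fin// Lnorm_ge0.
move=> f BfL fL Nf; have [h [hL h1 hQ hN]] := H f fL Nf.
have mpsi2 : measurable_fun setT (fun t => (psi t).2).
  exact: (measurableT_comp measurable_snd mpsi).
pose kappa0 := pushforward (spectral_finite_measure specE hL) (fun t => (psi t).2)
  : {measure set R -> \bar R}.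
pose kappa : {measure set R -> \bar R} := kappa0 mpsi2.
have kappaE Q : kappa Q = energy mu (E (psi @^-1` (setT `*` Q)) h).
  have -> : psi @^-1` (setT `*` Q) = (fun t => (psi t).2) @^-1` Q.
    by apply/seteqP; split => t //= -[].
  by [].
apply: (@partial_multiplier _ _ _ (spectral_finite_measure specE BfL) psi _ _ K kappa) => //.
- by rewrite -ge0_fin_numE// fin_num_measure.
- rewrite kappaE; apply: le_trans h1; apply: (spectral_contraction specE) => //.
  by rewrite setXTT preimage_setT.
- by move=> Q mQ Q0; rewrite kappaE; exact: hN.
- by move=> Q1 Q2 mQ1 mQ2 Q1I; rewrite kappaE; exact: hQ.
Qed.

End partial_opnorm.

(** * The two-parameter estimates *)

Section supports.
Context {R : realType}.

Lemma supp_out (S : topologicalType) (F : S -> R[i]) (K : set S) s :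
  supp F `<=` K -> ~ K s -> F s = 0.
Proof.
move=> FK Ks; apply: contrapT => Fs; apply: Ks; apply: FK.
by apply: subset_closure => /=; exact/eqP.
Qed.

Lemma cmeasurable_dilate (R1 R2 : R) F : cmeasurable F -> cmeasurable (dilate R1 R2 F).
Proof.
move=> mF; apply: (cmeasurable_comp mF).
apply: measurable_fun_pair; apply: measurable_funM => //.
Qed.

Lemma unit_scale (k x : R) : 0 < k -> `[0, k]%classic (k * x) -> `[0, 1]%classic x.
Proof.
move=> k0; rewrite /= !in_itv /= pmulr_rge0// => /andP[-> /=].
by rewrite -[leRHS]mulr1 ler_pM2l.
Qed.

Lemma unit_lebesgue_fin (Q : set R) : measurable Q -> Q `<=` `[0, 1] ->
  lebesgue_measure Q = (fine (lebesgue_measure Q))%:E.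
Proof.
move=> mQ QI; rewrite fineK// -unit_lebesgueE//.
exact: fin_num_measure.
Qed.

End supports.

Section multiplier_opnorm.
Context d1 d2 (T1 : measurableType d1) (T2 : measurableType d2) (R : realType).
Variables (mu1 : {sigma_finite_measure set T1 -> \bar R})
          (mu2 : {sigma_finite_measure set T2 -> \bar R}).
Local Notation mu := (mu1 \x mu2)%E.
Local Notation leb := (@lebesgue_measure R).
Variables (E1 : set R -> (T1 -> R[i]) -> (T1 -> R[i]))
          (E2 : set R -> (T2 -> R[i]) -> (T2 -> R[i]))
          (E : set (R * R) -> (T1 * T2 -> R[i]) -> (T1 * T2 -> R[i])).
Hypotheses (specE1 : spectral_decomposition mu1 E1)
           (specE2 : spectral_decomposition mu2 E2)
           (specE : spectral_decomposition mu E)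
           (tensorE : tensor_decomposition mu1 mu2 E1 E2 E).

(** The restriction estimate for the projections of [sqrt L / Rd] on the subsets of
    the unit interval; [K] gathers the constant and the volume factor. *)
Definition unit_restriction d (T : measurableType d) (m : {measure set T -> \bar R})
    (q : R) (B : set T) (E0 : set R -> (T -> R[i]) -> (T -> R[i])) (Rd K : R) :=
  forall Q : set R, measurable Q -> Q `<=` `[0, 1] ->
  restriction_bound m q B (E0 [set t | Q (Num.sqrt t / Rd)])
    (K * Num.sqrt (fine (leb Q))).

Definition null_projections d (T : measurableType d) (m : {measure set T -> \bar R})
    (E0 : set R -> (T -> R[i]) -> (T -> R[i])) :=
  forall N : set R, measurable N -> leb N = 0%E ->
  forall u, inL2 m u -> energy m (E0 [set t | N (Num.sqrt t)] u) = 0%E.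

Let msqrt : measurable_fun setT (@Num.sqrt R).
Proof. by apply: continuous_measurable_fun; exact: sqrt_continuous. Qed.

Let msqrt_div (k : R) : measurable_fun setT (fun t : R => Num.sqrt t / k).
Proof. exact: measurable_funM. Qed.

Let msqrt_preim (Q : set R) : measurable Q -> measurable [set t | Q (Num.sqrt t)].
Proof. by move=> mQ; rewrite -[X in measurable X]setTI; exact: msqrt. Qed.

(** On rectangles the spectral measure of [P_B f], rescaled to the unit square,
    is at most [(K1 K2)^2] times Lebesgue measure. *)
Lemma mixed_opnorm (q1 q2 R1 R2 K1 K2 : R) B1 B2 (F : R * R -> R[i]) :
  1 <= q1 < 2 -> 0 < R1 -> 0 < R2 -> 0 <= K1 -> 0 <= K2 ->
  measurable B1 -> measurable B2 ->
  unit_restriction mu1 q1 B1 E1 R1 K1 -> unit_restriction mu2 q2 B2 E2 R2 K2 ->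
  cmeasurable F -> supp F `<=` `[0, R1] `*` `[0, R2] ->
  (opnorm mu (mixnorm12 mu1 mu2 q1%:E q2%:E)
     (fun f => fun_sqrt2 mu E F (restr (B1 `*` B2) f)) <=
   (K1 * K2)%:E * cLnorm (leb \x leb) 2%:E (dilate R1 R2 F))%E.
Proof.
move=> q12 R10 R20 K10 K20 mB1 mB2 H1 H2 mF sF.
pose psi (t : R * R) := (Num.sqrt t.1 / R1, Num.sqrt t.2 / R2).
have mpsi : measurable_fun setT psi.
  apply: measurable_fun_pair.
  - exact: (measurableT_comp (msqrt_div R1) measurable_fst).
  - exact: (measurableT_comp (msqrt_div R2) measurable_snd).
have mB : measurable (B1 `*` B2) by exact: measurableX.
pose D := dilate R1 R2 F.
have mD : cmeasurable D by exact: cmeasurable_dilate.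
have FD : (fun t : R * R => F (Num.sqrt t.1, Num.sqrt t.2)) = (fun t => D (psi t)).
  apply/funext => t; rewrite /D /dilate /psi /=; congr (F (_, _)).
    by rewrite mulrC divfK// gt_eqF.
  by rewrite mulrC divfK// gt_eqF.
rewrite /fun_sqrt2 FD.
apply: (@opnorm_spectral_le _ _ _ mu _ _ E specE _ _ (fun t => D (psi t))) => //.
- exact: cmeasurable_comp mD mpsi.
- by rewrite mule_ge0 ?lee_fin ?mulr_ge0// cLnorm_ge0.
move=> f BfL fL Nf.
apply: (@mixed_multiplier _ _ _ (spectral_finite_measure specE BfL) psi) => //.
- by rewrite -ge0_fin_numE// fin_num_measure.
- by rewrite mulr_ge0.
- move=> Q1 Q2 mQ1 mQ2 Q1I Q2I.
  have := joint_mixed_bound specE1 specE2 specE tensorE q12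
    (mulr_ge0 K10 (sqrtr_ge0 _)) (mulr_ge0 K20 (sqrtr_ge0 _)) mB1 mB2
    (measurable_sqrt_div R1 mQ1) (measurable_sqrt_div R2 mQ2)
    (H1 _ mQ1 Q1I) (H2 _ mQ2 Q2I) fL Nf.
  move=> h; apply: le_trans h _.
  rewrite (unit_lebesgue_fin mQ1 Q1I) (unit_lebesgue_fin mQ2 Q2I) -!EFinM lee_fin.
  have leb0 (Q : set R) : 0 <= fine (leb Q) by exact: fine_ge0.
  by rewrite mulrACA exprMn [X in _ * X]exprMn !sqr_sqrtr ?leb0.
- move=> z zI; apply: (supp_out sF) => -[z1 z2]; apply: zI.
  by split; [exact: unit_scale z1|exact: unit_scale z2].
Qed.

(** The measure [kappa] of [partial_multiplier] is the distribution of the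
    second component of [psi] under the spectral measure of [h]. *)
(** The factor [|Q2|] of the localized case is replaced by the spectral measure
    of the vector [normalize mu2 q f] in the second variable. *)
Lemma partial_opnorm1 (q R1 K : R) B (F : R * R -> R[i]) :
  1 <= q < 2 -> 0 < R1 -> 0 <= K -> measurable B ->
  unit_restriction mu1 q B E1 R1 K -> null_projections mu2 E2 ->
  cmeasurable F -> supp F `<=` `[0, R1] `*` `[0, +oo[ ->
  (opnorm mu (mixnorm12 mu1 mu2 q%:E 2%:E)
     (fun f => fun_sqrt2 mu E F (restr (B `*` setT) f)) <=
   K%:E * mixnorm21 leb leb +oo 2%:E (dilate R1 1 F))%E.
Proof.
move=> q12 R10 K0 mB H1 Hnull mF sF.
pose psi (t : R * R) := (Num.sqrt t.1 / R1, Num.sqrt t.2).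
have mpsi : measurable_fun setT psi.
  apply: measurable_fun_pair.
  - exact: (measurableT_comp (msqrt_div R1) measurable_fst).
  - exact: (measurableT_comp msqrt measurable_snd).
have mBT : measurable (B `*` [set: T2]) by exact: measurableX.
pose D := dilate R1 1 F.
have mD : cmeasurable D by exact: cmeasurable_dilate.
have FD : (fun t : R * R => F (Num.sqrt t.1, Num.sqrt t.2)) = (fun t => D (psi t)).
  apply/funext => t; rewrite /D /dilate /psi /= mul1r; congr (F (_, _)).
  by rewrite mulrC divfK// gt_eqF.
rewrite /fun_sqrt2 FD.
apply: (@partial_opnorm _ _ _ mu E specE _ _ psi K D) => //.
  move=> z zI; apply: (supp_out sF) => -[z1 _]; apply: zI; exact: unit_scale z1.
move=> f fL Nf; exists (normalize mu2 q f); split.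
- exact: inL2_normalize.
- exact: energy_normalize.
- move=> Q1 Q2 mQ1 mQ2 Q1I.
  have := joint_partial_bound specE1 specE2 specE tensorE q12
    (mulr_ge0 K0 (sqrtr_ge0 _)) mB (measurable_sqrt_div R1 mQ1) (msqrt_preim mQ2)
    (H1 _ mQ1 Q1I) fL Nf.
  rewrite exprMn sqr_sqrtr ?fine_ge0// EFinM -(unit_lebesgue_fin mQ1 Q1I).
  by [].
- move=> Q2 mQ2 Q20.
  have := joint_null specE1 specE2 specE tensorE (msqrt_preim mQ2)
    (inL2_normalize q12 fL Nf) (Hnull _ mQ2 Q20).
  by [].
Qed.

(** The measure [kappa] of [partial_multiplier] is the distribution of the
    second component of [psi] under the spectral measure of [h]. *)
Lemma partial_opnorm2 (q R2 K : R) B (F : R * R -> R[i]) :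
  1 <= q < 2 -> 0 < R2 -> 0 <= K -> measurable B ->
  unit_restriction mu2 q B E2 R2 K -> null_projections mu1 E1 ->
  cmeasurable F -> supp F `<=` `[0, +oo[ `*` `[0, R2] ->
  (opnorm mu (mixnorm21 mu1 mu2 q%:E 2%:E)
     (fun f => fun_sqrt2 mu E F (restr (setT `*` B) f)) <=
   K%:E * mixnorm12 leb leb +oo 2%:E (dilate 1 R2 F))%E.
Proof.
move=> q12 R20 K0 mB H2 Hnull mF sF.
pose psi (t : R * R) := (Num.sqrt t.2 / R2, Num.sqrt t.1).
have mpsi : measurable_fun setT psi.
  apply: measurable_fun_pair.
  - exact: (measurableT_comp (msqrt_div R2) measurable_snd).
  - exact: (measurableT_comp msqrt measurable_fst).
have mTB : measurable ([set: T1] `*` B) by exact: measurableX.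
pose D := swap_fun (dilate 1 R2 F).
have mD : cmeasurable D by apply: cmeasurable_swap; exact: cmeasurable_dilate.
have FD : (fun t : R * R => F (Num.sqrt t.1, Num.sqrt t.2)) = (fun t => D (psi t)).
  apply/funext => t; rewrite /D /swap_fun /dilate /psi /= mul1r; congr (F (_, _)).
  by rewrite mulrC divfK// gt_eqF.
rewrite /fun_sqrt2 FD.
apply: (@partial_opnorm _ _ _ mu E specE _ _ psi K D) => //.
  move=> z zI; apply: (supp_out sF) => -[_ z2]; apply: zI; exact: unit_scale z2.
move=> f fL Nf; have sfL := inL2_swap fL.
have psiE (Q1 Q2 : set R) : psi @^-1` (Q1 `*` Q2) =
    [set t | Q2 (Num.sqrt t)] `*` [set t | Q1 (Num.sqrt t / R2)].
  by apply/seteqP; split => t /= [].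
have psiTE (Q2 : set R) : psi @^-1` (setT `*` Q2) = [set t | Q2 (Num.sqrt t)] `*` setT.
  by apply/seteqP; split => t /= [].
have nL : inL2 (mu2 \x mu1)%E (normalize mu1 q (swap_fun f)) by exact: inL2_normalize.
exists (swap_fun (normalize mu1 q (swap_fun f))); split.
- exact: inL2_swap.
- rewrite energy_swap; last exact: inL2_measurable nL.
  exact: energy_normalize.
- move=> Q1 Q2 mQ1 mQ2 Q1I; rewrite psiE psiTE.
  have := joint_partial_bound_swap specE1 specE2 specE tensorE q12
    (mulr_ge0 K0 (sqrtr_ge0 _)) mB (msqrt_preim mQ2) (measurable_sqrt_div R2 mQ1)
    (H2 _ mQ1 Q1I) fL Nf.
  rewrite exprMn sqr_sqrtr ?fine_ge0// EFinM -(unit_lebesgue_fin mQ1 Q1I).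
  by [].
- move=> Q2 mQ2 Q20; rewrite psiTE.
  exact: (joint_null_swap specE1 specE2 specE tensorE (msqrt_preim mQ2)
    (inL2_swap nL) (Hnull _ mQ2 Q20)).
Qed.

End multiplier_opnorm.

Local Close Scope complex_scope.

Theorem lemma5p1 (R : realType) (d1 d2 : measure_display)
  (X1 : borelMetricType d1 R) (X2 : borelMetricType d2 R)
  (mu1 : {sigma_finite_measure set X1 -> \bar R})
  (mu2 : {sigma_finite_measure set X2 -> \bar R})
  (n1 n2 : R)
  (doubling1 : doubling mu1 n1) (doubling2 : doubling mu2 n2)
  (mu1_infinite : mu1 setT = +oo%E) (mu2_infinite : mu2 setT = +oo%E)
  (L1 : (X1 -> R[i]) -> set (X1 -> R[i]))
  (L2 : (X2 -> R[i]) -> set (X2 -> R[i]))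
  (sa1 : self_adjoint mu1 L1) (nonneg1 : nonnegative mu1 L1)
  (sa2 : self_adjoint mu2 L2) (nonneg2 : nonnegative mu2 L2)
  (E1 : set R -> (X1 -> R[i]) -> (X1 -> R[i]))
  (E2 : set R -> (X2 -> R[i]) -> (X2 -> R[i]))
  (spec1 : spectral_decomposition_of mu1 L1 E1)
  (spec2 : spectral_decomposition_of mu2 L2 E2)
  (E : set (R * R) -> (X1 * X2 -> R[i]) -> (X1 * X2 -> R[i]))
  (specE : spectral_decomposition (mu1 \x mu2)%E E)
  (tensorE : tensor_decomposition mu1 mu2 E1 E2 E)
  (p1 p2 : R) (hp1 : 1 <= p1 < 2) (hp2 : 1 <= p2 < 2)
  (ST1 : restriction_type mu1 n1 E1 p1) (ST2 : restriction_type mu2 n2 E2 p2) :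
  exists2 C : R, 0 < C &
  [/\ (forall (R1 R2 : R), 0 < R1 -> 0 < R2 ->
       forall F : R * R -> R[i],
       cmeasurable F -> supp F `<=` `[0, R1] `*` `[0, R2] ->
       forall (x1 : X1) (x2 : X2) (r1 r2 : R), R1^-1 <= r1 -> R2^-1 <= r2 ->
       (opnorm (mu1 \x mu2) (mixnorm12 mu1 mu2 p1%:E p2%:E)
          (fun f => fun_sqrt2 (mu1 \x mu2) E F
                      (restr (ball x1 r1 `*` ball x2 r2) f))
        <= C%:E * (vol_factor mu1 n1 p1 R1 x1 r1 * vol_factor mu2 n2 p2 R2 x2 r2)
           * cLnorm (lebesgue_measure \x lebesgue_measure) 2%:E
               (dilate R1 R2 F))%E),
      (forall R1 : R, 0 < R1 ->
       forall F : R * R -> R[i],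
       cmeasurable F -> supp F `<=` `[0, R1] `*` `[0, +oo[ ->
       forall (x1 : X1) (r1 : R), R1^-1 <= r1 ->
       (opnorm (mu1 \x mu2) (mixnorm12 mu1 mu2 p1%:E 2%:E)
          (fun f => fun_sqrt2 (mu1 \x mu2) E F (restr (ball x1 r1 `*` setT) f))
        <= C%:E * vol_factor mu1 n1 p1 R1 x1 r1
           * mixnorm21 lebesgue_measure lebesgue_measure +oo 2%:E
               (dilate R1 1 F))%E) &
      (forall R2 : R, 0 < R2 ->
       forall F : R * R -> R[i],
       cmeasurable F -> supp F `<=` `[0, +oo[ `*` `[0, R2] ->
       forall (x2 : X2) (r2 : R), R2^-1 <= r2 ->
       (opnorm (mu1 \x mu2) (mixnorm21 mu1 mu2 p2%:E 2%:E)
          (fun f => fun_sqrt2 (mu1 \x mu2) E F (restr (setT `*` ball x2 r2) f))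
        <= C%:E * vol_factor mu2 n2 p2 R2 x2 r2
           * mixnorm12 lebesgue_measure lebesgue_measure +oo 2%:E
               (dilate 1 R2 F))%E)].
Proof.
have [p11 p12] := andP hp1; have [p21 p22] := andP hp2.
have [sE1 _] := spec1; have [sE2 _] := spec2.
have [C1 C10 H1] := restriction_type_bound sE1 p11 ST1.
have [C2 C20 H2] := restriction_type_bound sE2 p21 ST2.
have N1 : null_projections mu1 E1.
  by move=> N mN N0 u uL; exact: (restriction_type_null sE1 p11 doubling1 mu1_infinite ST1).
have N2 : null_projections mu2 E2.
  by move=> N mN N0 u uL; exact: (restriction_type_null sE2 p21 doubling2 mu2_infinite ST2).
have C120 : 0 < C1 * C2 by exact: mulr_gt0.
exists (C1 * C2 + C1 + C2); first by rewrite !addr_gt0.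
have pos (Rd r : R) : 0 < Rd -> Rd^-1 <= r -> 0 < r.
  by move=> Rd0; apply: lt_le_trans; rewrite invr_gt0.
split.
- move=> R1 R2 R10 R20 F mF sF x1 x2 r1 r2 Rr1 Rr2.
  have [k1 k10 k1E] := vol_factor_fin p1 R1 x1 doubling1 mu1_infinite (pos _ _ R10 Rr1).
  have [k2 k20 k2E] := vol_factor_fin p2 R2 x2 doubling2 mu2_infinite (pos _ _ R20 Rr2).
  have U1 : unit_restriction mu1 p1 (ball x1 r1) E1 R1 (C1 * k1).
    by move=> Q mQ QI; exact: H1.
  have U2 : unit_restriction mu2 p2 (ball x2 r2) E2 R2 (C2 * k2).
    by move=> Q mQ QI; exact: H2.
  apply: le_trans (mixed_opnorm sE1 sE2 specE tensorE hp1 R10 R20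
    (mulr_ge0 (ltW C10) k10) (mulr_ge0 (ltW C20) k20) (measurable_ball x1 r1)
    (measurable_ball x2 r2) U1 U2 mF sF) _.
  rewrite k1E k2E -!EFinM; apply: lee_wpmul2r; first exact: cLnorm_ge0.
  rewrite lee_fin mulrACA ler_wpM2r ?mulr_ge0// -addrA lerDl.
  by rewrite addr_ge0// ltW.
- move=> R1 R10 F mF sF x1 r1 Rr1.
  have [k1 k10 k1E] := vol_factor_fin p1 R1 x1 doubling1 mu1_infinite (pos _ _ R10 Rr1).
  have U1 : unit_restriction mu1 p1 (ball x1 r1) E1 R1 (C1 * k1).
    by move=> Q mQ QI; exact: H1.
  apply: le_trans (partial_opnorm1 sE1 sE2 specE tensorE hp1 R10
    (mulr_ge0 (ltW C10) k10) (measurable_ball x1 r1) U1 N2 mF sF) _.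
  rewrite k1E -!EFinM; apply: lee_wpmul2r; first exact: Lnorm_ge0.
  rewrite lee_fin ler_wpM2r// addrAC lerDr.
  by rewrite addr_ge0// ltW.
- move=> R2 R20 F mF sF x2 r2 Rr2.
  have [k2 k20 k2E] := vol_factor_fin p2 R2 x2 doubling2 mu2_infinite (pos _ _ R20 Rr2).
  have U2 : unit_restriction mu2 p2 (ball x2 r2) E2 R2 (C2 * k2).
    by move=> Q mQ QI; exact: H2.
  apply: le_trans (partial_opnorm2 sE1 sE2 specE tensorE hp2 R20
    (mulr_ge0 (ltW C20) k20) (measurable_ball x2 r2) U2 N1 mF sF) _.
  rewrite k2E -!EFinM; apply: lee_wpmul2r; first exact: Lnorm_ge0.
  rewrite lee_fin ler_wpM2r// lerDr.
  by rewrite addr_ge0// ltW.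
Qed.
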